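(* Let ND be a class of network design problems in the sense described in the context. If there exists a deterministic (respectively randomized) polynomial-time $\gamma$-approximation algorithm for the prize-collecting problem PCND, then there exists an $O(\gamma\log(\min\{k,|\mathcal{E}|\}))$-competitive deterministic (respectively randomized) online algorithm for ND with delay, which runs in polynomial time. Here $k$ is the number of requests in the input and $\mathcal{E}$ is the set of elements.
   Context: An instance of an (abstract) network design problem consists of a finite set $\mathcal{E}$ of elements with costs $c:\mathcal{E}\to\mathbb{R}^+$; each request $q$ is associated with an upward-closed family $X_q\subseteq 2^{\mathcal{E}}$; a set $E$ satisfies $q$ if $E\in X_q$. ND denotes a class of such problems. The prize-collecting problem PCND: given requests $Q$ and penalties $\pi:Q\to\mathbb{R}^+$, choose $E\subseteq\mathcal{E}$ minimizing $\sum_{e\in E}c(e)+\sum_{q\in Q:\,E\notin X_q}\pi(q)$. A $\gamma$-approximation algorithm returns a solution of cost at most $\gamma$ times optimal; for randomized algorithms the approximation guarantee is deterministic and the running-time bound holds in expectation. ND with delay: elements and costs known in advance; request $q$ released at time $r_q$ with a continuous, monotone non-decreasing delay function $d_q(t)$ tending to infinity, revealed at release ($k$ is not known in advance); at any time the algorithm may transmit $E\subseteq\mathcal{E}$ at cost $\sum_{e\in E}c(e)$, serving every pending request $q$ with $E\in X_q$. The cost is the total transmission cost plus, for each request $q$, the delay $d_q(t_q)$ accumulated until its service time $t_q$. An algorithm is $\alpha$-competitive if its (expected) cost is always at most $\alpha$ times the optimal offline cost. *)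

(* Defs.v *)
From HB Require Import structures.
From mathcomp Require Import all_boot all_order all_algebra.
From mathcomp Require Import all_classical all_reals all_analysis.

Set Implicit Arguments.
Unset Strict Implicit.
Unset Printing Implicit Defensive.

Import Order.TTheory GRing.Theory Num.Theory.
Import numFieldNormedType.Exports.

Local Open Scope classical_set_scope.
Local Open Scope ring_scope.

(* Model of computation: Jones's WHILE language on binary trees ("Computability
   and Complexity"), extended to a real RAM.  Leaves may be real numbers,
   constants in programs are natural numbers, every command and every exact
   arithmetic operation or comparison costs one step.  Programs may toss fair
   coins, ask oracle questions tagged by a type [Op], and call other programs
   (without recursion). *)

Inductive data (R : Type) : Type :=
| DNil
| DReal of R
| DCons of data R & data R.
Arguments DNil {R}.

Inductive expr : Type :=
| EVar of nat
| ENil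
| ENat of nat
| ECons of expr & expr
| EHead of expr
| ETail of expr
| EAdd of expr & expr
| ESub of expr & expr
| EMul of expr & expr
| EDiv of expr & expr
| ELe of expr & expr
| EIsReal of expr
| EIsCons of expr.

Inductive program (Op : Type) : Type :=
| PSkip
| PAssign of nat & expr
| PSeq of program Op & program Op
| PIf of expr & program Op & program Op
| PWhile of expr & program Op
| PFlip of nat
| PAsk of nat & Op & expr
| PCall of nat & program Op & expr.
Arguments PSkip {Op}.
Arguments PAssign {Op}.
Arguments PFlip {Op}.

Fixpoint deterministic (Op : Type) (p : program Op) : bool :=
  match p with
  | PSkip | PAssign _ _ | PAsk _ _ _ => true
  | PSeq p1 p2 | PIf _ p1 p2 => deterministic p1 && deterministic p2
  | PWhile _ p1 | PCall _ p1 _ => deterministic p1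
  | PFlip _ => false
  end.

Section Semantics.
Variables (R : realType) (Op : Type) (oracle : Op -> data R -> data R).

Definition store := nat -> data R.

(* [DNil] is false, every other tree is true. *)
Definition dbool (b : bool) : data R := if b then DReal 1 else DNil.
Definition truthy (d : data R) : bool := if d is DNil then false else true.

Definition dhead (d : data R) : data R := if d is DCons a _ then a else DNil.
Definition dtail (d : data R) : data R := if d is DCons _ b then b else DNil.

Definition dop (f : R -> R -> data R) (d1 d2 : data R) : data R :=
  match d1, d2 with DReal x, DReal y => f x y | _, _ => DNil end.

Fixpoint eval (e : expr) (s : store) : data R :=
  match e with
  | EVar x => s x
  | ENil => DNil
  | ENat n => DReal n%:R
  | ECons e1 e2 => DCons (eval e1 s) (eval e2 s)
  | EHead e1 => dhead (eval e1 s)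
  | ETail e1 => dtail (eval e1 s)
  | EAdd e1 e2 => dop (fun x y => DReal (x + y)) (eval e1 s) (eval e2 s)
  | ESub e1 e2 => dop (fun x y => DReal (x - y)) (eval e1 s) (eval e2 s)
  | EMul e1 e2 => dop (fun x y => DReal (x * y)) (eval e1 s) (eval e2 s)
  | EDiv e1 e2 => dop (fun x y => DReal (x / y)) (eval e1 s) (eval e2 s)
  | ELe e1 e2 => dop (fun x y => dbool (x <= y)) (eval e1 s) (eval e2 s)
  | EIsReal e1 => dbool (if eval e1 s is DReal _ then true else false)
  | EIsCons e1 => dbool (if eval e1 s is DCons _ _ then true else false)
  end.

Definition update (s : store) (x : nat) (d : data R) : store :=
  fun y => if y == x then d else s y.

(* Input and output are passed in variable 0. *)
Definition init_store (d : data R) : store := update (fun=> DNil) 0 d.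

(* [exec p s w s' n]: from store [s], program [p] halts in store [s'] after
   [n] steps, having tossed exactly the coins [w], in that order. *)
Inductive exec :
    program Op -> store -> seq bool -> store -> nat -> Prop :=
| ExecSkip s : exec PSkip s [::] s 1
| ExecAssign x e s : exec (PAssign x e) s [::] (update s x (eval e s)) 1
| ExecSeq p1 p2 s s1 s2 w1 w2 n1 n2 :
    exec p1 s w1 s1 n1 -> exec p2 s1 w2 s2 n2 ->
    exec (PSeq p1 p2) s (w1 ++ w2) s2 (n1 + n2).+1
| ExecIf e p1 p2 s s' w n :
    exec (if truthy (eval e s) then p1 else p2) s w s' n ->
    exec (PIf e p1 p2) s w s' n.+1
| ExecWhileStop e p s :
    ~~ truthy (eval e s) -> exec (PWhile e p) s [::] s 1
| ExecWhileStep e p s s1 s2 w1 w2 n1 n2 :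
    truthy (eval e s) -> exec p s w1 s1 n1 ->
    exec (PWhile e p) s1 w2 s2 n2 ->
    exec (PWhile e p) s (w1 ++ w2) s2 (n1 + n2).+1
| ExecFlip x b s : exec (PFlip x) s [:: b] (update s x (dbool b)) 1
| ExecAsk x o e s :
    exec (PAsk x o e) s [::] (update s x (oracle o (eval e s))) 1
| ExecCall x p e s s' w n :
    exec p (init_store (eval e s)) w s' n ->
    exec (PCall x p e) s w (update s x (s' 0%N)) n.+1.

Definition run (p : program Op) (input : data R) (w : seq bool)
    (output : data R) (n : nat) : Prop :=
  exists2 s, exec p (init_store input) w s n & output = s 0%N.

End Semantics.

(* A randomized computation is described by the set of its halting outcomes
   [(w, x)], where [w] is the sequence of coins tossed by that computation
   (so that it has probability 2 ^- size w) and [w] determines [x]. *)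
Section Randomized.
Variables (R : realType) (T : choiceType).

Definition expectation_over (S : set (seq bool * T)) (f : T -> \bar R) :
    \bar R :=
  \esum_(o in S) ((2^-1 ^+ size o.1)%:E * f o.2)%E.

Definition halts_almost_surely (S : set (seq bool * T)) : Prop :=
  expectation_over S (fun=> 1%E) = 1%E.

End Randomized.

Section Encodings.
Variable R : realType.

Fixpoint data_size (d : data R) : nat :=
  if d is DCons a b then (data_size a + data_size b).+1 else 1.

Fixpoint dlist (s : seq (data R)) : data R :=
  if s is d :: s' then DCons d (dlist s') else DNil.

Fixpoint undlist (d : data R) : seq (data R) :=
  if d is DCons a b then a :: undlist b else [::].

(* A set of elements is encoded as the list of its indices. *)
Definition decode_set (n : nat) (d : data R) : {set 'I_n} :=
  [set e : 'I_n |
    has (fun a => if a is DReal x then x == (e : nat)%:R else false)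
      (undlist d)].

End Encodings.

(* A class of network design problems, as the collection of its instances.
   The elements of an instance [i] are indexed by ['I_(nelem i)]. [request i]
   is the type of all requests that may be issued in [i]; the codes are what
   the algorithms receive as descriptions of instances and requests. *)
Record nd_class (R : realType) := NDClass {
  instance : Type;
  nelem : instance -> nat;
  cost : forall i, 'I_(nelem i) -> R;
  cost_ge0 : forall i e, 0 <= @cost i e;
  request : instance -> Type;
  satisfies : forall i, {set 'I_(nelem i)} -> request i -> bool;
  satisfies_up : forall i (q : request i) (E F : {set 'I_(nelem i)}),
    E \subset F -> satisfies E q -> satisfies F q;
  instance_code : instance -> data R;
  request_code : forall i, request i -> data R;
  request_code_inj : forall i, injective (@request_code i)
}.

Section Problems.
Variables (R : realType) (ND : nd_class R).
Implicit Type i : instance ND.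

Definition set_cost i (E : {set 'I_(nelem i)}) : R := \sum_(e in E) cost e.

Definition instance_data i : data R :=
  DCons (instance_code i)
    (dlist [seq DReal (cost e) | e <- enum 'I_(nelem i)]).

(* Membership access to the families X_q, with requests given by their code. *)
Definition sat_oracle i (d : data R) : data R :=
  dbool R `[< exists2 q : request i, dhead d = request_code q
              & satisfies (decode_set (nelem i) (dtail d)) q >].

Definition pc_input i := seq (request i * R).

Definition pc_cost i (Q : pc_input i) (E : {set 'I_(nelem i)}) : R :=
  set_cost E + \sum_(qp <- Q | ~~ satisfies E qp.1) qp.2.

Definition pc_opt i (Q : pc_input i) : R :=
  pc_cost Q [arg min_(E < finset.set0) pc_cost Q E]%O.

Definition penalties_ge0 i (Q : pc_input i) : bool :=
  all (fun qp => 0 <= qp.2) Q.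

Definition pc_data i (Q : pc_input i) : data R :=
  DCons (instance_data i)
    (dlist [seq DCons (request_code qp.1) (DReal qp.2) | qp <- Q]).

Inductive pc_op := PCSat.

Definition pc_run (P : program pc_op) i (Q : pc_input i) (w : seq bool)
    (E : {set 'I_(nelem i)}) (n : nat) : Prop :=
  exists2 out, run (fun=> sat_oracle i) P (pc_data Q) w out n
    & E = decode_set (nelem i) out.

Definition deterministic_pc_approx (P : program pc_op) (gamma : R) : Prop :=
  deterministic P /\
  exists a b : nat, forall i (Q : pc_input i), penalties_ge0 Q ->
    exists E n, [/\ pc_run P Q [::] E n,
      (n <= a * data_size (pc_data Q) ^ b)%N
      & pc_cost Q E <= gamma * pc_opt Q].

Definition pc_outcomes (P : program pc_op) i (Q : pc_input i) :
    set (seq bool * nat) :=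
  [set o | exists E, pc_run P Q o.1 E o.2].

Definition randomized_pc_approx (P : program pc_op) (gamma : R) : Prop :=
  exists a b : nat, forall i (Q : pc_input i), penalties_ge0 Q ->
    [/\ halts_almost_surely R (pc_outcomes P Q),
      (expectation_over (pc_outcomes P Q) (fun n => n%:R%:E) <=
        (a * data_size (pc_data Q) ^ b)%:R%:E :> \bar R)%E
      & forall w E n, pc_run P Q w E n -> pc_cost Q E <= gamma * pc_opt Q].

(* [delay] is only meaningful on [release, +oo[. *)
Record delay_request i := DelayRequest {
  req : request i;
  release : R;
  delay : R -> R;
  delay_ge0 : forall t, release <= t -> 0 <= delay t;
  delay_continuous : {within `[release, +oo[, continuous delay};
  delay_mono : forall t u, release <= t -> t <= u -> delay t <= delay u;
  delay_unbounded : delay t @[t --> +oo] --> +oo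
}.

Definition schedule i := seq (R * {set 'I_(nelem i)}).

(* +oo if the request is never served; such a request has infinite cost, its
   delay being unbounded. *)
Definition service_time i (s : schedule i) (q : delay_request i) : \bar R :=
  \big[Order.min/+oo%E]_(tE <- s |
    (release q <= tE.1) && satisfies tE.2 (req q)) tE.1%:E.

Definition delay_cost i (s : schedule i) (q : delay_request i) : \bar R :=
  if service_time s q is t%:E then (delay q t)%:E else +oo%E.

Definition schedule_cost i (rs : seq (delay_request i)) (s : schedule i) :
    \bar R :=
  ((\sum_(tE <- s) set_cost tE.2)%:E + \sum_(q <- rs) delay_cost s q)%E.

Definition offline_opt i (rs : seq (delay_request i)) : \bar R :=
  ereal_inf [set schedule_cost rs s | s in [set: schedule i]].

(* Access to the delay functions of the requests released so far, numbered
   from 0 in order of release: [AskDelay] maps (j, t) to d_j(t), and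
   [AskDelayInv] maps (j, y) to the first time at which d_j reaches y. *)
Inductive online_op := AskSat | AskDelay | AskDelayInv.

Definition lookup i (rs : seq (delay_request i)) (d : data R) :
    option (delay_request i) :=
  if d is DReal x then
    if x \is a Num.nat then onth rs (Num.truncn x) else None
  else None.

Definition online_oracle i (released : seq (delay_request i)) (o : online_op)
    (d : data R) : data R :=
  match o with
  | AskSat => sat_oracle i d
  | AskDelay =>
      match lookup released (dhead d), dtail d with
      | Some q, DReal t => if release q <= t then DReal (delay q t) else DNil
      | _, _ => DNil
      end
  | AskDelayInv =>
      match lookup released (dhead d), dtail d with
      | Some q, DReal y =>
          DReal (inf [set t | release q <= t /\ y <= delay q t])
      | _, _ => DNil
      end
  end.

(* An online algorithm is a program started afresh at each event, i.e., when
   requests are released or when the alarm it has set goes off. Its input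
   consists of the instance, the current time, the codes of the newly released
   requests, and its own memory; its output is (memory, (alarm, transmissions)),
   the transmissions being performed at the current time. *)
Definition event_data i (t : R) (new : seq (delay_request i)) (mem : data R) :
    data R :=
  DCons (instance_data i) (DCons (DReal t)
    (DCons (dlist [seq request_code (req q) | q <- new]) mem)).

Definition new_memory (out : data R) : data R := dhead out.

(* An alarm set in the past goes off immediately; +oo means no alarm. *)
Definition new_alarm (t : R) (out : data R) : \bar R :=
  if dhead (dtail out) is DReal a then (Num.max t a)%:E else +oo%E.

Definition transmissions i (t : R) (out : data R) : schedule i :=
  [seq (t, decode_set (nelem i) d) | d <- undlist (dtail (dtail out))].

Definition next_event i (future : seq (delay_request i)) (alarm : \bar R) :
    \bar R :=
  Order.min alarm (\big[Order.min/+oo%E]_(q <- future) (release q)%:E).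

Inductive online_steps (A : program online_op) i :
    seq (delay_request i) -> seq (delay_request i) -> \bar R -> data R ->
    seq bool -> schedule i -> nat -> Prop :=
| OnlineEnd past future alarm mem :
    next_event future alarm = +oo%E ->
    online_steps A past future alarm mem [::] [::] 0
| OnlineEvent past future alarm mem t w1 w2 out s n1 n2 :
    next_event future alarm = t%:E ->
    let new := [seq q <- future | release q <= t] in
    let rest := [seq q <- future | t < release q] in
    run (online_oracle (past ++ new)) A (event_data t new mem) w1 out n1 ->
    online_steps A (past ++ new) rest (new_alarm t out) (new_memory out)
      w2 s n2 ->
    online_steps A past future alarm mem
      (w1 ++ w2) (transmissions i t out ++ s) (n1 + n2).

Definition online_run (A : program online_op) i (rs : seq (delay_request i))
    (w : seq bool) (s : schedule i) (n : nat) : Prop :=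
  online_steps A [::] rs +oo%E DNil w s n.

Definition online_size i (rs : seq (delay_request i)) : nat :=
  data_size (instance_data i) +
  \sum_(q <- rs) (data_size (request_code (req q))).+1.

(* [ratio k m] is the competitive ratio on inputs with [k] requests and [m]
   elements. *)
Definition deterministic_competitive (A : program online_op)
    (ratio : nat -> nat -> R) : Prop :=
  deterministic A /\
  exists a b : nat, forall i (rs : seq (delay_request i)),
    exists s n, [/\ online_run A rs [::] s n,
      (n <= a * online_size rs ^ b)%N
      & (schedule_cost rs s <=
          (ratio (size rs) (nelem i))%:E * offline_opt rs)%E].

Definition online_outcomes (A : program online_op) i
    (rs : seq (delay_request i)) : set (seq bool * (schedule i * nat)) :=
  [set o | online_run A rs o.1 o.2.1 o.2.2].

Definition randomized_competitive (A : program online_op)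
    (ratio : nat -> nat -> R) : Prop :=
  exists a b : nat, forall i (rs : seq (delay_request i)),
    [/\ halts_almost_surely R (online_outcomes A rs),
      (expectation_over (online_outcomes A rs) (fun sn => sn.2%:R%:E) <=
        (a * online_size rs ^ b)%:R%:E :> \bar R)%E
      & (expectation_over (online_outcomes A rs)
           (fun sn => schedule_cost rs sn.1) <=
          (ratio (size rs) (nelem i))%:E * offline_opt rs)%E].

End Problems.

(* log(min{k, m}), bounded below by 1 so that O(log(min{k, m})) is meaningful
   when min{k, m} <= 1. *)
Definition log_min (R : realType) (k m : nat) : R :=
  Num.max 1 (ln (minn k m)%:R).

(* Main.v *)
Require Import Defs.
From HB Require Import structures.
From mathcomp Require Import all_boot all_order all_algebra.
From mathcomp Require Import all_classical all_reals all_analysis.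
From mathcomp Require Import ring lra zify.

Set Implicit Arguments.
Unset Strict Implicit.
Unset Printing Implicit Defensive.

Import Order.TTheory GRing.Theory Num.Theory.
Import numFieldNormedType.Exports.

Local Open Scope ring_scope.

(* Every released request q is first given a solution of its own, by running the
   prize-collecting algorithm on q alone with a prohibitive penalty; the cost of
   that solution divided by g (an integer, gamma <= g <= 2 gamma) is a lower
   bound on the cost of serving q and is the initial level of q.  A level v is
   critical when the pending requests of level at most v have accumulated a
   delay v that has not been paid for.  A service of budget B = 2v then starts:
   it pays the delays of the requests of level at most B, buys the elements of
   cost at most B / |E| and the own solutions of base cost at most B / k, and
   raises the remaining requests to level B.  For those it looks ahead in time:
   with the residual delays at a later time as penalties, it moves that time
   forward until the prize-collecting solution costs at least g B, transmits the
   last solution found before that, and pays the delays up to that time for the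
   requests left unserved.

   When a request left behind becomes critical again, the optimum of the
   prize-collecting instance, which was at least B, shows that the offline
   schedule has spent order of B, on delay, charged once, or on transmissions.
   Budgets charged to one transmission double, and they exceed its cost at most
   by a factor of order min(k, |E|), because cheaper elements and solutions were
   bought outright: hence the logarithm.  Both this accounting and the bound on
   the number of events, each of which is charged to the halving of the ratio
   between a base cost times k and a level, are potential functions.

   Budgets are arbitrary reals rather than powers of two, and the look-ahead
   jumps to the first time at which some delay grows by a 1/n fraction of the
   budget, so that the number of steps does not depend on the magnitudes of the
   costs.  The algorithm is written in a small functional language whose terms
   compile to WHILE programs with a running time read off the term; the coins
   tossed by successive runs form prefix-free sets of words, over which
   expectations are summed. *)

(** The factor [gamma] is rounded up to an integer because the constants of a program are natural
    numbers. In the tests of the algorithm the number of requests at hand stands for [k], which is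
    never known online. Two guarantees of the prize-collecting program shape the proof. Its running
    time is bounded in expectation only, so the work of one event has to be affine in that time: a
    product of two random times would have no bound. Its cost, on the contrary, is bounded for every
    sequence of coins, so the competitive analysis is made run by run, against one fixed offline
    schedule, and averaging comes last. The deterministic statement is then the case in which the
    only coin word is empty. *)

Local Notation eval := Defs.eval.

(** * Executions *)

Section Executions.
Variables (R : realType) (Op : Type) (oracle : Op -> data R -> data R).

(** With empty suffixes this is determinism once the coins are fixed; with arbitrary ones it makes
    the coin words of halting runs prefix-free. The induction needs the suffixes too: in a sequence,
    the coins of the first half are known only as a prefix of the whole word. *)
Lemma exec_functional (p : program Op) (s : store R) w1 s1 n1 w2 s2 n2 u1 u2 :
  exec oracle p s w1 s1 n1 -> exec oracle p s w2 s2 n2 ->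
  w1 ++ u1 = w2 ++ u2 -> [/\ w1 = w2, s1 = s2 & n1 = n2].
Proof.
move=> H; elim: H w2 s2 n2 u1 u2 => {p s w1 s1 n1}.
- by move=> s w2 s2 n2 u1 u2 H; inversion H; subst.
- by move=> x e s w2 s2 n2 u1 u2 H; inversion H; subst.
- move=> p1 p2 s s1 s2 w1 w2 n1 n2 _ IH1 _ IH2 w s' n u1 u2 H.
  inversion H; subst; rewrite -!catA => E.
  have [? ? ?] := IH1 _ _ _ _ _ ltac:(eassumption) E; subst.
  move/eqP: E; rewrite eqseq_cat // => /andP[_ /eqP E].
  by have [? ? ?] := IH2 _ _ _ _ _ ltac:(eassumption) E; subst.
- move=> e p1 p2 s s' w n _ IH w2 s2 n2 u1 u2 H; inversion H; subst => E.
  by have [? ? ?] := IH _ _ _ _ _ ltac:(eassumption) E; subst.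
- move=> e p s Hf w2 s2 n2 u1 u2 H; inversion H; subst => // E.
  by match goal with X : is_true (truthy _) |- _ => rewrite (negbTE Hf) in X end.
- move=> e p s s1 s2 w1 w2 n1 n2 Ht _ IH1 _ IH2 w s' n u1 u2 H.
  inversion H; subst; first by match goal with X : is_true (~~ _) |- _ => rewrite Ht in X end.
  rewrite -!catA => E.
  have [? ? ?] := IH1 _ _ _ _ _ ltac:(eassumption) E; subst.
  move/eqP: E; rewrite eqseq_cat // => /andP[_ /eqP E].
  by have [? ? ?] := IH2 _ _ _ _ _ ltac:(eassumption) E; subst.
- by move=> x b s w2 s2 n2 u1 u2 H; inversion H; subst => -[->].
- by move=> x o e s w2 s2 n2 u1 u2 H; inversion H; subst.
- move=> x p e s s' w n _ IH w2 s2 n2 u1 u2 H; inversion H; subst => E.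
  by have [? ? ?] := IH _ _ _ _ _ ltac:(eassumption) E; subst.
Qed.

Lemma deterministic_exec (p : program Op) (s : store R) w s' n :
  deterministic p -> exec oracle p s w s' n -> w = [::].
Proof.
move=> + H; elim: H => {p s w s' n} //=.
- by move=> p1 p2 s s1 s2 w1 w2 n1 n2 _ IH1 _ IH2 /andP[/IH1-> /IH2->].
- by move=> e p1 p2 s s' w n; case: ifP => _ _ IH /andP[? ?]; apply: IH.
- by move=> e p s s1 s2 w1 w2 n1 n2 _ _ IH1 _ IH2 d; rewrite IH1 ?IH2.
Qed.

(** Height rather than [data_size]: assigning the pair of [x] with itself to [x] doubles the size in
    one step but adds only 1 to the height. The height thus stays linear in the running time, and it
    still bounds the length of a list. *)
Fixpoint height (d : data R) : nat :=
  if d is DCons a b then (maxn (height a) (height b)).+1 else 1.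

Lemma size_undlist d : (size (undlist d) <= height d)%N.
Proof. by elim: d => //= a _ b IH; rewrite ltnS (leq_trans IH) // leq_maxr. Qed.

Fixpoint esize (e : expr) : nat :=
  match e with
  | EVar _ | ENil | ENat _ => 1
  | ECons a b | EAdd a b | ESub a b | EMul a b | EDiv a b | ELe a b =>
      (esize a + esize b).+1
  | EHead a | ETail a | EIsReal a | EIsCons a => (esize a).+1
  end.

Lemma height_dbool b : height (dbool R b) = 1%N.
Proof. by case: b. Qed.

Lemma height_dop f (d1 d2 : data R) :
  (forall x y, height (f x y) = 1%N) -> height (dop f d1 d2) = 1%N.
Proof. by move=> Hf; case: d1 => [|x|a b] //; case: d2 => [|y|c d] //=; rewrite Hf. Qed.

Lemma height_gt0 d : (0 < height d)%N. Proof. by case: d. Qed.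

Lemma height_eval e (s : store R) h :
  (0 < h)%N -> (forall x, height (s x) <= h)%N ->
  (height (eval e s) <= h + esize e)%N.
Proof.
move=> h0 Hs; elim: e => //=.
- by move=> x; rewrite (leq_trans (Hs x)) ?leq_addr.
- by rewrite addn1.
- by move=> _; rewrite addn1.
- by move=> a Ha b Hb; rewrite addnS ltnS geq_max; apply/andP; split; lia.
- by move=> a; case: (eval a s) => [|x|d1 d2] //= ; lia.
- by move=> a; case: (eval a s) => [|x|d1 d2] //= ; lia.
- by move=> a _ b _; rewrite height_dop //; lia.
- by move=> a _ b _; rewrite height_dop //; lia.
- by move=> a _ b _; rewrite height_dop //; lia.
- by move=> a _ b _; rewrite height_dop //; lia.
- by move=> a _ b _; rewrite height_dop ?height_dbool //; [lia|move=> x y; rewrite height_dbool].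
- by move=> a _; rewrite height_dbool; lia.
- by move=> a _; rewrite height_dbool; lia.
Qed.

Fixpoint psize (p : program Op) : nat :=
  match p with
  | PSkip | PFlip _ => 1
  | PAssign _ e | PAsk _ _ e => (esize e).+1
  | PSeq p1 p2 => (psize p1 + psize p2)%N
  | PIf e p1 p2 => (esize e + psize p1 + psize p2)%N
  | PWhile e p1 => (esize e + psize p1)%N
  | PCall _ p1 e => (esize e + psize p1).+1
  end.

Lemma height_exec (p : program Op) (s : store R) w s' n h :
  (forall o d, height (oracle o d) = 1)%N ->
  exec oracle p s w s' n -> (0 < h)%N -> (forall x, height (s x) <= h)%N ->
  forall x, (height (s' x) <= h + psize p * n)%N.
Proof.
move=> Ho H; elim: H h => {p s w s' n} /=.
- by move=> s h h0 Hs x; rewrite (leq_trans (Hs x)) ?leq_addr.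
- move=> x e s h h0 Hs y; rewrite /update; case: eqP => _.
    by rewrite (leq_trans (height_eval e h0 Hs)) //; lia.
  by rewrite (leq_trans (Hs y)) ?leq_addr.
- move=> p1 p2 s s1 s2 w1 w2 n1 n2 _ IH1 _ IH2 h h0 Hs x.
  have H1 := IH1 _ h0 Hs.
  have := IH2 _ _ H1 x; rewrite addn_gt0 h0 => /(_ isT) /leq_trans; apply.
  nia.
- move=> e p1 p2 s s' w n; case: ifP => _ _ IH h h0 Hs x.
    by have := IH _ h0 Hs x; move/leq_trans; apply; nia.
  by have := IH _ h0 Hs x; move/leq_trans; apply; nia.
- by move=> e p s _ h h0 Hs x; rewrite (leq_trans (Hs x)) ?leq_addr.
- move=> e p s s1 s2 w1 w2 n1 n2 _ _ IH1 _ IH2 h h0 Hs x.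
  have H1 := IH1 _ h0 Hs.
  have := IH2 _ _ H1 x; rewrite addn_gt0 h0 => /(_ isT) /leq_trans; apply.
  nia.
- move=> x b s h h0 Hs y; rewrite /update; case: eqP => _.
    by rewrite height_dbool; lia.
  by rewrite (leq_trans (Hs y)) ?leq_addr.
- move=> x o e s h h0 Hs y; rewrite /update; case: eqP => _.
    by rewrite Ho; lia.
  by rewrite (leq_trans (Hs y)) ?leq_addr.
- move=> x p e s s' w n _ IH h h0 Hs y; rewrite /update; case: eqP => _; last first.
    by rewrite (leq_trans (Hs y)) ?leq_addr.
  have := IH (h + esize e)%N; rewrite addn_gt0 h0 => /(_ isT).
  have Hi : forall z, (height (init_store (eval e s) z) <= h + esize e)%N.
    move=> z; rewrite /init_store /update; case: eqP => _ /=; last by lia.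
    exact: height_eval.
  move=> /(_ Hi 0%N) /leq_trans; apply.
  nia.
Qed.

End Executions.

(** The given program asks its questions under the tag [PCSat], the online one under [AskSat];
    renaming tags lets the former be called by the latter. *)
Fixpoint pmap_op (Op Op' : Type) (f : Op -> Op') (p : program Op) : program Op' :=
  match p with
  | PSkip => PSkip
  | PAssign x e => PAssign x e
  | PSeq p1 p2 => PSeq (pmap_op f p1) (pmap_op f p2)
  | PIf e p1 p2 => PIf e (pmap_op f p1) (pmap_op f p2)
  | PWhile e p1 => PWhile e (pmap_op f p1)
  | PFlip x => PFlip x
  | PAsk x o e => PAsk x (f o) e
  | PCall x p1 e => PCall x (pmap_op f p1) e
  end.

Lemma deterministic_pmap_op Op Op' (f : Op -> Op') p :
  deterministic (pmap_op f p) = deterministic p.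
Proof. by elim: p => //= [p1 -> p2 -> //|e p1 -> p2 ->]. Qed.

Section MapOp.
Variables (R : realType) (Op Op' : Type) (f : Op -> Op').
Variable (oracle : Op' -> data R -> data R).

Lemma exec_pmap_op (p : program Op) s w s' n :
  exec oracle (pmap_op f p) s w s' n <-> exec (oracle \o f) p s w s' n.
Proof.
split.
  move Eq: (pmap_op f p) => q H; elim: H p Eq => {q s w s' n}.
  - by move=> s [] //= _; constructor.
  - by move=> x e s [] //= x' e' [? ?]; subst; constructor.
  - move=> p1 p2 s s1 s2 w1 w2 n1 n2 _ IH1 _ IH2 [] //= q1 q2 [E1 E2].
    by econstructor; [apply: IH1|apply: IH2].
  - move=> e p1 p2 s s' w n _ IH [] //= e' q1 q2 [E E1 E2]; subst.
    by constructor; apply: IH; case: ifP => _.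
  - by move=> e p s Hf [] //= e' q1 [E E1]; subst; constructor.
  - move=> e p s s1 s2 w1 w2 n1 n2 Ht _ IH1 _ IH2 [] //= e' q1 [E E1]; subst.
    by econstructor => //; [apply: IH1|apply: (IH2 (PWhile e q1))].
  - by move=> x b s [] //= x' [?]; subst; constructor.
  - by move=> x o e s [] //= x' o' e' [? ? ?]; subst; apply: (ExecAsk (oracle \o f)).
  - move=> x p e s s' w n _ IH [] //= x' p1 e' [? E ?]; subst.
    by constructor; apply: IH.
elim => {p s w s' n} /=.
- by constructor.
- by constructor.
- by move=> *; econstructor; eassumption.
- by move=> e p1 p2 s s' w n _ IH; constructor; case: ifP IH.
- by constructor.
- by move=> *; econstructor; eassumption.
- by constructor.
- by move=> x o e s; apply: ExecAsk.
- by move=> *; constructor.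
Qed.

End MapOp.

(** * A first-order functional language *)

(** The argument 0 is excluded so that exponents can be raised: [x ^ b <= x ^ (b + b')] fails for
    [x = b = 0], [b' > 0]. *)
Definition poly_bounded (f : nat -> nat) : Prop :=
  exists a b : nat, forall x, (0 < x)%N -> (f x <= a * x ^ b)%N.

Lemma poly_bounded_cst c : poly_bounded (fun=> c).
Proof. by exists c, 0%N => x _; rewrite expn0 muln1. Qed.

Lemma poly_bounded_id : poly_bounded id.
Proof. by exists 1%N, 1%N => x _; rewrite expn1 mul1n. Qed.

Lemma poly_boundedD f h : poly_bounded f -> poly_bounded h ->
  poly_bounded (fun x => f x + h x)%N.
Proof.
move=> [a [b H]] [a' [b' H']]; exists (a + a')%N, (b + b')%N => x x0.
have e1 : (x ^ b <= x ^ (b + b'))%N by rewrite leq_pexp2l ?leq_addr.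
have e2 : (x ^ b' <= x ^ (b + b'))%N by rewrite leq_pexp2l ?leq_addl.
rewrite mulnDl leq_add //.
  by apply: leq_trans (H x x0) _; rewrite leq_mul2l e1 orbT.
by apply: leq_trans (H' x x0) _; rewrite leq_mul2l e2 orbT.
Qed.

Lemma poly_boundedM f h : poly_bounded f -> poly_bounded h ->
  poly_bounded (fun x => f x * h x)%N.
Proof.
move=> [a [b H]] [a' [b' H']]; exists (a * a')%N, (b + b')%N => x x0.
by rewrite expnD mulnACA leq_mul // ?H ?H'.
Qed.

Lemma poly_boundedX f n : poly_bounded f -> poly_bounded (fun x => f x ^ n)%N.
Proof.
move=> pf; elim: n => [|n IH]; first exact: (poly_bounded_cst 1).
have [a [b H]] := poly_boundedM pf IH.
by exists a, b => x /H; rewrite expnS.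
Qed.

(* A term evaluated with [n] variables in scope binds variable [n] in a
   [FLet].  [FFold j l i env b] folds [b] from the right over the list [l],
   starting from [i]; [b] is closed and receives (element, (accumulator, env))
   in variable 0.  The label [j] only serves to bound the length of [l]. *)
Inductive fn (Op : Type) : Type :=
| FExp of expr
| FLet of fn Op & fn Op
| FIf of expr & fn Op & fn Op
| FAsk of Op & expr
| FCall of fn Op & expr
| FFold of nat & expr & expr & expr & fn Op.
Arguments FExp {Op}.

Fixpoint closed_expr (n : nat) (e : expr) : bool :=
  match e with
  | EVar x => (x < n)%N
  | ENil | ENat _ => true
  | ECons a b | EAdd a b | ESub a b | EMul a b | EDiv a b | ELe a b =>
      closed_expr n a && closed_expr n b
  | EHead a | ETail a | EIsReal a | EIsCons a => closed_expr n a
  end.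

Fixpoint closed_fn (Op : Type) (n : nat) (f : fn Op) : bool :=
  match f with
  | FExp e | FAsk _ e => closed_expr n e
  | FLet f g => closed_fn n f && closed_fn n.+1 g
  | FIf e f g => [&& closed_expr n e, closed_fn n f & closed_fn n g]
  | FCall f e => closed_fn 1 f && closed_expr n e
  | FFold _ l i env b =>
      [&& closed_expr n l, closed_expr n i, closed_expr n env & closed_fn 1 b]
  end.

(** * Compilation into WHILE programs, with correctness and running time *)

Section Compile.
Variable Op : Type.

Definition subroutine (p : program Op) := PSeq p (PAssign 0 (EVar 1)).

Definition while_cons (n : nat) (p : program Op) :=
  PWhile (EIsCons (EVar n)) (PSeq p (PAssign n (ETail (EVar n)))).

(** With the variables below [n] in scope, the code leaves its result in variable [n] and may
    overwrite everything from [n] on. A fold first reverses its list, since a loop consumes a list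
    from the front while [foldr] starts at the back; its body runs as a called program, in a store
    of its own. *)
Fixpoint compile (n : nat) (f : fn Op) : program Op :=
  match f with
  | FExp e => PAssign n e
  | FLet f g => PSeq (compile n f) (PSeq (compile n.+1 g) (PAssign n (EVar n.+1)))
  | FIf e f g => PIf e (compile n f) (compile n g)
  | FAsk o e => PAsk n o e
  | FCall f e => PCall n (subroutine (compile 1 f)) e
  | FFold _ l i env b =>
      PSeq (PAssign n ENil) (PSeq (PAssign n.+1 l)
      (PSeq (while_cons n.+1 (PAssign n (ECons (EHead (EVar n.+1)) (EVar n))))
      (PSeq (PAssign n.+1 (EVar n)) (PSeq (PAssign n i)
      (while_cons n.+1 (PCall n (subroutine (compile 1 b))
         (ECons (EHead (EVar n.+1)) (ECons (EVar n) env))))))))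
  end.

Definition fprog (f : fn Op) : program Op := subroutine (compile 1 f).

Lemma deterministic_compile n f : deterministic (compile n f).
Proof.
elim: f n => //= [f IHf g IHg n|e f IHf g IHg n|f IHf e n|j l i e b IH n].
- by rewrite IHf IHg.
- by rewrite IHf IHg.
- by rewrite IHf.
- by rewrite IH.
Qed.

Lemma deterministic_fprog f : deterministic (fprog f).
Proof. by rewrite /= deterministic_compile. Qed.

(** In a fold, an element of the list costs 4 steps in the reversing loop and [time_bound L b + 6]
    in the main one, which explains the 10. *)
Fixpoint time_bound (L : nat -> nat) (f : fn Op) : nat :=
  match f with
  | FExp _ | FAsk _ _ => 1
  | FLet f g => (time_bound L f + time_bound L g).+3
  | FIf _ f g => (maxn (time_bound L f) (time_bound L g)).+1
  | FCall f _ => (time_bound L f).+3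
  | FFold j _ _ _ b => (L j * (time_bound L b + 10) + 12)%N
  end.

Lemma poly_bounded_time f : poly_bounded (fun x => time_bound (fun=> x) f).
Proof.
have c1 := poly_bounded_cst; have pX := poly_bounded_id.
elim: f => /= [_|f Hf g Hg|_ f Hf g Hg|_ _|f Hf _|_ _ _ _ f Hf]; try exact: c1.
- under eq_fun do rewrite -addn3; exact: poly_boundedD (poly_boundedD _ _) (c1 _).
- have [a [b H]] := poly_boundedD (poly_boundedD Hf Hg) (c1 1%N).
  by exists a, b => x /H; apply: leq_trans; rewrite addn1 ltnS geq_max leq_addr leq_addl.
- by under eq_fun do rewrite -addn3; exact: poly_boundedD Hf (c1 _).
- exact: poly_boundedD (poly_boundedM pX (poly_boundedD Hf (c1 _))) (c1 _).
Qed.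

Variables (R : realType) (oracle : Op -> data R -> data R).

Fixpoint den (n : nat) (f : fn Op) (s : store R) : data R :=
  match f with
  | FExp e => eval e s
  | FLet f g => den n.+1 g (update s n (den n f s))
  | FIf e f g => if truthy (eval e s) then den n f s else den n g s
  | FAsk o e => oracle o (eval e s)
  | FCall f e => den 1 f (init_store (eval e s))
  | FFold _ l i env b =>
      foldr (fun x acc => den 1 b (init_store (DCons x (DCons acc (eval env s)))))
        (eval i s) (undlist (eval l s))
  end.

Definition dfun (f : fn Op) (d : data R) : data R := den 1 f (init_store d).

(** The body of a fold must have short loops on every element and accumulator, not just on those
    that occur; no invariant on accumulators is then needed. *)
Fixpoint short_loops (L : nat -> nat) (n : nat) (f : fn Op) (s : store R) : Prop :=
  match f with
  | FExp _ | FAsk _ _ => True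
  | FLet f g => short_loops L n f s /\
      short_loops L n.+1 g (update s n (den n f s))
  | FIf e f g =>
      if truthy (eval e s) then short_loops L n f s else short_loops L n g s
  | FCall f e => short_loops L 1 f (init_store (eval e s))
  | FFold j l i env b => (size (undlist (eval l s)) <= L j)%N /\
      forall x acc, short_loops L 1 b (init_store (DCons x (DCons acc (eval env s))))
  end.

Lemma eval_agree n e (s s' : store R) :
  closed_expr n e -> (forall x, (x < n)%N -> s x = s' x) -> eval e s = eval e s'.
Proof.
move=> + H; elim: e => //=.
- by move=> a IHa b IHb /andP[/IHa-> /IHb->].
- by move=> a IHa /IHa->.
- by move=> a IHa /IHa->.
- by move=> a IHa b IHb /andP[/IHa-> /IHb->].
- by move=> a IHa b IHb /andP[/IHa-> /IHb->].
- by move=> a IHa b IHb /andP[/IHa-> /IHb->].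
- by move=> a IHa b IHb /andP[/IHa-> /IHb->].
- by move=> a IHa b IHb /andP[/IHa-> /IHb->].
- by move=> a IHa /IHa->.
- by move=> a IHa /IHa->.
Qed.

Lemma truthy_dbool b : truthy (dbool R b) = b.
Proof. by case: b. Qed.

Lemma updateE (s : store R) x d : update s x d x = d.
Proof. by rewrite /update eqxx. Qed.

Lemma update_neq (s : store R) x d y : y != x -> update s x d y = s y.
Proof. by rewrite /update => /negbTE->. Qed.

Lemma exec_seq_quiet p1 p2 (s s1 s2 : store R) n1 n2 :
  exec oracle p1 s [::] s1 n1 -> exec oracle p2 s1 [::] s2 n2 ->
  exec oracle (PSeq p1 p2) s [::] s2 (n1 + n2).+1.
Proof. exact: (@ExecSeq _ _ _ _ _ _ _ _ [::] [::]). Qed.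

Lemma exec_while_cons n (p : program Op) (F : data R -> data R -> data R)
    (t : nat) (good : store R -> Prop) :
  (forall s a b, good s -> s n.+1 = DCons a b -> exists s' t',
     [/\ exec oracle p s [::] s' t', (t' <= t)%N, s' n = F a (s n),
       s' n.+1 = DCons a b & forall d, good (update s' n.+1 d)]) ->
  forall s d, good s -> s n.+1 = d -> exists s' t',
    [/\ exec oracle (while_cons n.+1 p) s [::] s' t',
      (t' <= size (undlist d) * (t + 3) + 1)%N,
      s' n = foldl (fun acc x => F x acc) (s n) (undlist d) & good s'].
Proof.
move=> Hp s d; elim: d s => [|x|a _ b IH] s gs Hs.
- exists s, 1%N; split => //; apply: ExecWhileStop.
  by rewrite /= Hs truthy_dbool.
- exists s, 1%N; split => //; apply: ExecWhileStop.
  by rewrite /= Hs truthy_dbool.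
- have [s1 [t1 [E1 L1 N1 C1 G1]]] := Hp s a b gs Hs.
  have [||s2 [t2 [E2 L2 N2 G2]]] := IH (update s1 n.+1 b).
  + exact: G1.
  + by rewrite updateE.
  exists s2, ((t1 + 1).+1 + t2).+1; split => //.
  + apply: (@ExecWhileStep _ _ _ _ _ _ _ _ [::] [::]); [|apply: exec_seq_quiet|exact: E2].
    * by rewrite /= Hs truthy_dbool.
    * exact: E1.
    * have -> : b = eval (ETail (EVar n.+1)) s1 by rewrite /= C1.
      exact: ExecAssign.
  + by move: L2 => /=; nia.
  + by rewrite N2 update_neq ?N1 // ltn_eqF.
Qed.

Lemma undlist_catrev (l : seq (data R)) d :
  undlist (foldl (fun acc x => DCons x acc) d l) = catrev l (undlist d).
Proof. by elim: l d => //= x l IH d; rewrite IH. Qed.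

(** Two stores, because [den] is read in [s] while the code starts in any [s'] that agrees with it
    below [n]: earlier computations leave garbage from [n] on. *)
Lemma compileP L f n (s s' : store R) : closed_fn n f ->
  (forall x, (x < n)%N -> s x = s' x) -> short_loops L n f s ->
  exists s'' t, [/\ exec oracle (compile n f) s' [::] s'' t,
    s'' n = den n f s, (forall x, (x < n)%N -> s'' x = s x) &
    (t <= time_bound L f)%N].
Proof.
elim: f n s s' => /= [e|f IHf g IHg|e f IHf g IHg|o e|f IHf e|j l i env b IHb] n s s' W A B.
- exists (update s' n (eval e s')), 1%N; split => //; first exact: ExecAssign.
    by rewrite updateE; apply/esym/(eval_agree W).
  by move=> x xn; rewrite update_neq ?A // ltn_eqF.
- case/andP: W => Wf Wg; case: B => Bf Bg.
  have [s1 [t1 [E1 N1 A1 T1]]] := IHf _ _ _ Wf A Bf.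
  have A2 x : (x < n.+1)%N -> update s n (den n f s) x = s1 x.
    rewrite ltnS leq_eqVlt => /orP[/eqP->|xn]; first by rewrite updateE.
    by rewrite update_neq ?A1 // ltn_eqF.
  have [s2 [t2 [E2 N2 A3 T2]]] := IHg _ _ _ Wg A2 Bg.
  exists (update s2 n (s2 n.+1)), (t1 + (t2 + 1).+1).+1; split.
  + apply: exec_seq_quiet; first exact: E1.
    apply: exec_seq_quiet; first exact: E2.
    exact: (ExecAssign _ n (EVar n.+1)).
  + by rewrite updateE.
  + move=> x xn; have xn1 : (x < n.+1)%N by rewrite ltnS ltnW.
    by rewrite update_neq ?ltn_eqF // (A3 _ xn1) update_neq ?ltn_eqF.
  + by lia.
- case/and3P: W => We Wf Wg.
  have Ee : eval e s' = eval e s by apply/esym/(eval_agree We).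
  case: ifP B => tr B.
    have [s1 [t1 [E1 N1 A1 T1]]] := IHf _ _ _ Wf A B.
    exists s1, t1.+1; split => //; last by lia.
    by apply: ExecIf; rewrite Ee tr.
  have [s1 [t1 [E1 N1 A1 T1]]] := IHg _ _ _ Wg A B.
  exists s1, t1.+1; split => //; last by lia.
  by apply: ExecIf; rewrite Ee tr.
- exists (update s' n (oracle o (eval e s'))), 1%N; split => //; first exact: ExecAsk.
    by rewrite updateE (eval_agree W A).
  by move=> x xn; rewrite update_neq ?A // ltn_eqF.
- case/andP: W => Wf We.
  have Ee : eval e s' = eval e s by apply/esym/(eval_agree We).
  have [//|s1 [t1 [E1 N1 A1 T1]]] := IHf 1%N _ (init_store (eval e s)) Wf _ B.
  exists (update s' n (s1 1%N)), (t1 + 1).+2; split => //.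
  + rewrite -[s1 1%N](updateE s1 0); apply: ExecCall; rewrite Ee.
    apply: exec_seq_quiet; first exact: E1.
    exact: (ExecAssign _ 0 (EVar 1)).
  + by rewrite updateE.
  + by move=> x xn; rewrite update_neq ?A // ltn_eqF.
  + by lia.
- case/and4P: W => Wl Wi We Wb; case: B => Bl Bb.
  pose good (s1 : store R) := forall x, (x < n)%N -> s1 x = s x.
  have goodU s1 d : good s1 -> good (update s1 n d).
    by move=> G x xn; rewrite update_neq ?G // ltn_eqF.
  have goodU' s1 d : good s1 -> good (update s1 n.+1 d).
    by move=> G x xn; rewrite update_neq ?G // ltn_eqF // ltnS ltnW.
  set s0 := update (update s' n DNil) n.+1 (eval l s).
  have G0 : good s0 by apply/goodU'/goodU => x xn; rewrite A.
  have [||s1 [t1 [E1 L1 N1 G1]]] := @exec_while_cons n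
    (PAssign n (ECons (EHead (EVar n.+1)) (EVar n))) (@DCons R) 1 good _ s0 (eval l s) G0.
  + move=> s1 a c G H.
    exists (update s1 n (DCons a (s1 n))), 1%N; split => //.
    * by have := ExecAssign oracle n (ECons (EHead (EVar n.+1)) (EVar n)) s1; rewrite /= H.
    * by rewrite updateE.
    * by rewrite update_neq // gtn_eqF.
    * by move=> d; apply/goodU'/goodU.
  + by rewrite /s0 updateE.
  set s2 := update (update s1 n.+1 (s1 n)) n (eval i s).
  have G2 : good s2 by apply/goodU/goodU'.
  pose F x acc := den 1 b (init_store (DCons x (DCons acc (eval env s)))).
  have [||s3 [t3 [E3 L3 N3 G3]]] := @exec_while_cons n
    (PCall n (subroutine (compile 1 b)) (ECons (EHead (EVar n.+1)) (ECons (EVar n) env)))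
    F (time_bound L b + 3)%N good _ s2 (s1 n) G2.
  + move=> s3 a c G H.
    have [//|s4 [t4 [E4 N4 A4 T4]]] := IHb 1%N _
       (init_store (DCons a (DCons (s3 n) (eval env s)))) Wb _ (Bb a (s3 n)).
    exists (update s3 n (s4 1%N)), (t4 + 1).+2; split.
    * rewrite -[s4 1%N](updateE s4 0); apply: ExecCall => /=.
      rewrite H /= (eval_agree We G).
      apply: exec_seq_quiet; first exact: E4.
      exact: (ExecAssign _ 0 (EVar 1)).
    * by lia.
    * by rewrite updateE.
    * by rewrite update_neq // gtn_eqF.
    * by move=> d; apply/goodU'/goodU.
  + by rewrite /s2 update_neq ?updateE // gtn_eqF.
  exists s3, (1 + (1 + (t1 + (1 + (1 + t3).+1).+1).+1).+1).+1; split => //.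
  + apply: exec_seq_quiet; first exact: ExecAssign.
    apply: exec_seq_quiet; first exact: ExecAssign.
    rewrite /= (_ : eval l (update s' n DNil) = eval l s); last first.
      by apply/esym/(eval_agree Wl) => x xn; rewrite update_neq ?A // ltn_eqF.
    apply: exec_seq_quiet; first exact: E1.
    apply: exec_seq_quiet; first exact: ExecAssign.
    apply: exec_seq_quiet; first exact: ExecAssign.
    rewrite /= (_ : eval i _ = eval i s); first exact: E3.
    apply/esym/(eval_agree Wi) => x xn.
    by rewrite update_neq ?G1 // ltn_eqF // ltnS ltnW.
  + rewrite N3 N1 /s2 /s0 updateE update_neq ?updateE ?ltn_eqF // undlist_catrev /=.
    by rewrite catrevE cats0 foldl_rev.
  + move: L3; rewrite N1 undlist_catrev /= catrevE size_cat size_rev.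
    rewrite /s0 update_neq ?updateE ?ltn_eqF //= addn0 => L3.
    have : (size (undlist (eval l s)) * (time_bound L b + 3 + 3) <=
       L j * (time_bound L b + 3 + 3))%N by rewrite leq_mul2r Bl orbT.
    nia.
Qed.

Lemma run_fprog L f d : closed_fn 1 f -> short_loops L 1 f (init_store d) ->
  exists2 t, run oracle (fprog f) d [::] (dfun f d) t & (t <= time_bound L f + 2)%N.
Proof.
move=> W B; have [//|s [t [E N A T]]] := @compileP L f 1 _ (init_store d) W _ B.
exists (t + 1).+1; last by lia.
exists (update s 0 (s 1%N)); last by rewrite updateE N.
apply: exec_seq_quiet; first exact: E.
exact: (ExecAssign _ 0 (EVar 1)).
Qed.

End Compile.

(** * The online algorithm *)

(** Requests carry functions, so their equality is classical; it serves membership and permutations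
    in the analysis, never a program. *)
HB.instance Definition _ (R : realType) (ND : nd_class R) (i : instance ND) :=
  gen_eqMixin (delay_request i).

Section Algorithm.
Variables (R : realType) (ND : nd_class R) (i : instance ND).
Implicit Types (t u x y : R) (q : delay_request i).

(* A pending request: its index in order of release, a set serving it, that
   set's cost divided by [g], its current level, and the part of its delay
   already paid for. *)
Record pending := Pending {
  prq : delay_request i;
  pidx : nat;
  psol : data R;
  pbase : R;
  plevel : R;
  ppaid : R
}.

HB.instance Definition _ := gen_eqMixin pending.

Implicit Types (p : pending) (l : seq pending).

Definition decode (d : data R) : {set 'I_(nelem i)} := decode_set (nelem i) d.
Definition serves (d : data R) q : bool := satisfies (decode d) (req q).

(** The delay already paid may exceed the current one, since a service pays up to the later time it
    has looked ahead to. *)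
Definition raised t p : R := Num.max (ppaid p) (delay (prq p) t).
Definition residual t p : R := raised t p - ppaid p.

Definition residual_sum l t x : R := \sum_(p <- l | plevel p <= x) residual t p.

(** The least critical level [v] is chosen: by minimality the requests with level in [(v / 2, v]]
    alone account for a residual delay of [v / 2]. *)
Definition critical_level l t : option R :=
  foldr (fun p acc =>
    if plevel p <= residual_sum l t (plevel p) then
      Some (if acc is Some v then (if plevel p <= v then plevel p else v)
            else plevel p)
    else acc) None l.

Definition delay_inv q y : R := inf [set t | release q <= t /\ y <= delay q t].

(** The number [n] is separate from [l] because a look-ahead passes only the unserved candidates as
    [l] but divides by the number of all candidates. As [n] is at least the length of [l], the
    residual delays of the requests in [l] of level at most [x] grow by at most [x] in total until
    the returned time. *)
Definition next_time (n : nat) t l : option R :=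
  foldr (fun p acc =>
    let a := delay_inv (prq p) (raised t p + plevel p / n%:R) in
    Some (if acc is Some b then (if a <= b then a else b) else a)) None l.

(* A service in progress: its budget, the time up to which it has looked ahead,
   the last solution found, and the requests that it may serve. *)
Record service := Service {
  budget : R;
  ahead : R;
  last_sol : data R;
  candidates : seq pending
}.

Record state := State {
  queue : seq (delay_request i * nat);
  pendings : seq pending;
  serving : option service
}.

(** Together these elements cost at most [B], while every set that contains any other element costs
    more than [B / nelem i]. *)
Definition cheap_elements (B : R) : data R :=
  dlist [seq DReal (nat_of_ord e)%:R | e <- enum 'I_(nelem i)
                                & cost e * (nelem i)%:R <= B].

Definition pay t p : pending :=
  Pending (prq p) (pidx p) (psol p) (pbase p) (plevel p) (raised t p).

Definition pay_upgrade B t p : pending :=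
  Pending (prq p) (pidx p) (psol p) (pbase p) B (raised t p).

Definition service_pc (s : service) : pc_input i :=
  [seq (req (prq p), residual (ahead s) p) | p <- candidates s].

Variable g : nat.

(** The penalty exceeds [g] times the cost of all elements, so an answer within factor [g] of the
    optimum serves the queued request whenever some set does. *)
Definition pc_of (st : state) : pc_input i :=
  match queue st with
  | (q, _) :: _ => [:: (req q, g%:R * (\sum_(e : 'I_(nelem i)) cost e) + 1)]
  | [::] => if serving st is Some s then service_pc s else [::]
  end.

(** A candidate that is kept has [B < pbase p * n] with [n <= k] candidates, so its new level stays
    below [k] times its base. [DNil] is the empty solution: it costs nothing, the residual delays
    being 0 at time [t] after payment. *)
Definition start_service t (l : seq pending) B : service :=
  let cands := [seq p <- l | plevel p <= B] in
  Service B t DNil [seq pay_upgrade B t p | p <- cands &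
    (B < pbase p * (size cands)%:R) && ~~ serves (cheap_elements B) (prq p)].

Definition start_transmissions (l : seq pending) B : seq (data R) :=
  let cands := [seq p <- l | plevel p <= B] in
  cheap_elements B ::
    [seq psol p | p <- cands & pbase p * (size cands)%:R <= B].

(** An event makes one prize-collecting call and one transition; a state with more to do sets its
    alarm to the current time. By the choice of the penalty, a queued request is dropped unserved
    only if no set satisfies it, in which case every schedule costs [+oo]. A request that can be
    served for free is served at once, so that all levels are positive. *)
Definition step t (st : state) (out : data R) :
    state * option R * seq (data R) :=
  match queue st with
  | (q, j) :: qs =>
      let c := set_cost (decode out) in
      if ~~ serves out q then (State qs (pendings st) (serving st), Some t, [::])
      else if c <= 0 then (State qs (pendings st) (serving st), Some t, [:: out])
      else (State qs (Pending q j out (c / g%:R) (c / g%:R) (delay q t)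
                        :: pendings st) (serving st), Some t, [::])
  | [::] =>
    match serving st with
    | Some s =>
        if g%:R * budget s <= pc_cost (service_pc s) (decode out) then
          (State [::] ([seq pay (ahead s) p | p <- candidates s
                         & ~~ serves (last_sol s) (prq p)] ++ pendings st) None,
           Some t, [:: last_sol s])
        else
          match next_time (size (candidates s)) (ahead s)
                  [seq p <- candidates s | ~~ serves out (prq p)] with
          | Some u => (State [::] (pendings st)
              (Some (Service (budget s) u out (candidates s))), Some t, [::])
          | None => (State [::] (pendings st) None, Some t, [:: out])
          end
    | None =>
        match critical_level (pendings st) t with
        | Some v =>
            (State [::] [seq p <- pendings st | 2 * v < plevel p]
               (Some (start_service t (pendings st) (2 * v))),
             Some t, start_transmissions (pendings st) (2 * v))
        | None =>
            (st, next_time (size (pendings st)) t (pendings st), [::])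
        end
    end
  end.

Definition enqueue (n : nat) (st : state) (new : seq (delay_request i)) : state :=
  State (queue st ++ zip new (iota n (size new))) (pendings st) (serving st).

Lemma residual_ge0 t p : 0 <= residual t p.
Proof. by rewrite subr_ge0 le_max lexx. Qed.

Lemma set_cost_ge0 (E : {set 'I_(nelem i)}) : 0 <= set_cost E.
Proof. by apply: sumr_ge0 => e _; apply: cost_ge0. Qed.

Lemma set_costS (E F : {set 'I_(nelem i)}) : E \subset F -> set_cost E <= set_cost F.
Proof.
move=> EF; rewrite /set_cost [leRHS](finset.big_setID E) /= (finset.setIidPr EF) lerDl.
by apply: sumr_ge0 => e _; apply: cost_ge0.
Qed.

Lemma le_residual t u p : release (prq p) <= t -> t <= u -> residual t p <= residual u p.
Proof.
move=> rt tu; rewrite lerD2r /raised ge_max !le_max lexx /=.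
by rewrite (delay_mono rt tu) orbT.
Qed.

Lemma critical_levelP l t : match critical_level l t with
  | Some v => [/\ exists2 p, p \in l & plevel p = v, v <= residual_sum l t v &
      forall p, p \in l -> plevel p < v -> residual_sum l t (plevel p) < plevel p]
  | None => forall p, p \in l -> residual_sum l t (plevel p) < plevel p
  end.
Proof.
rewrite /critical_level.
elim: {2 3 5 7}l => [|p l' IH] //=; case: ifP => [Hp|/negbT]; last first.
  rewrite -ltNge => Hp; case: (foldr _ _ _) IH => [v [[p' p'l <-] H1 H2]|IH].
    split => //; first by exists p'; rewrite // inE p'l orbT.
    by move=> p''; rewrite inE => /predU1P[->//|]; apply: H2.
  by move=> p''; rewrite inE => /predU1P[->//|]; apply: IH.
case: (foldr _ _ _) IH => [v [[p' p'l <-] H1 H2]|IH]; last first.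
  split => //; first by exists p; rewrite // mem_head.
  by move=> p''; rewrite inE => /predU1P[->|/IH//]; rewrite ltxx.
case: ifP => [Hle|/negbT]; last rewrite -ltNge => Hlt.
  split => //; first by exists p; rewrite // mem_head.
  move=> p''; rewrite inE => /predU1P[->|p''l H]; first by rewrite ltxx.
  by apply: H2 => //; apply: lt_le_trans Hle.
split => //; first by exists p'; rewrite // inE p'l orbT.
move=> p''; rewrite inE => /predU1P[->|p''l H]; last exact: H2.
by move=> H; have := lt_trans H Hlt; rewrite ltxx.
Qed.

(** The algorithm tests only levels that occur in [l]. The sum at [x] equals the sum at the largest
    level not above [x], or is empty, and then 0. *)
Lemma residual_sum_lt l t x : 0 < x ->
  (forall p, p \in l -> plevel p <= x -> residual_sum l t (plevel p) < plevel p) ->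
  residual_sum l t x < x.
Proof.
move=> x0 H; case: (boolP (has (fun p => plevel p <= x) l)) => [|/hasPn no]; last first.
  rewrite /residual_sum big_seq_cond big1 // => p /andP[/no /negbTE->].
  by [].
move=> /hasP[p0 p0l p0x].
have [p [pl px pmax]] : exists p, [/\ p \in l, plevel p <= x &
    forall p', p' \in l -> plevel p' <= x -> plevel p' <= plevel p].
  elim: (l) {H} p0 p0l p0x => // a l' IH p0.
  rewrite inE => p0l p0x.
  have [/hasP[p1 p1l p1x]|/hasPn no] := boolP (has (fun p => plevel p <= x) l').
    have [p [pl px pmax]] := IH _ p1l p1x.
    have [ap|pa] := leP (plevel a) (plevel p).
      exists p; split => //; first by rewrite inE pl orbT.
      by move=> p'; rewrite inE => /predU1P[->|/pmax].
    have [ax|xa] := leP (plevel a) x.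
      exists a; split => //; first by rewrite mem_head.
      move=> p'; rewrite inE => /predU1P[->//|/pmax p'p /p'p] /le_trans; apply.
      exact: ltW.
    exists p; split => //; first by rewrite inE pl orbT.
    by move=> p'; rewrite inE => /predU1P[->|/pmax//]; rewrite leNgt xa.
  have {p0l} ? : p0 = a.
    by case/predU1P: p0l => // /no; rewrite p0x.
  subst p0; exists a; split => //; first by rewrite mem_head.
  by move=> p'; rewrite inE => /predU1P[->//|/no /negbTE->].
have -> : residual_sum l t x = residual_sum l t (plevel p); last exact: lt_le_trans (H _ pl px) px.
rewrite /residual_sum big_seq_cond [RHS]big_seq_cond; apply: eq_bigl => p'.
case: (boolP (p' \in l)) => //= p'l.
by apply/idP/idP => [/(pmax _ p'l)//|/le_trans]; apply.
Qed.

(** Divergence makes the set of times nonempty, and continuity turns its infimum into a time at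
    which [y] is attained exactly. Being strictly after [t], it makes every jump a progress. *)
Lemma delay_inv_spec q t y : release q <= t -> delay q t < y ->
  t < delay_inv q y /\ delay q (delay_inv q y) = y.
Proof.
move=> rt dty.
have cont a b : release q <= a -> {within `[a, b], continuous (delay q)}%classic.
  move=> ra; apply: continuous_subspaceW (@delay_continuous _ _ _ q).
  by move=> z /=; rewrite !in_itv /= andbT => /andP[az _]; apply: le_trans az.
have ivt a b v : release q <= a -> a <= b -> delay q a <= v <= delay q b ->
    exists2 c, a <= c <= b & delay q c = v.
  move=> ra ab /andP[av vb].
  have [//|c] := @IVT R (delay q) a b v ab (cont _ _ ra).
    by rewrite min_l ?max_r ?(delay_mono ra ab) // av.
  by rewrite in_itv /= => cab <-; exists c.
have [w tw yw] : exists2 w, t <= w & y <= delay q w.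
  have /cvgryPge/(_ y) [M [_ HM]] := @delay_unbounded _ _ _ q.
  exists (Num.max t (M + 1)); first by rewrite le_max lexx.
  by apply: HM; rewrite lt_max ltrDl ltr01 orbT.
have [c /andP[tc _] dc] := ivt _ _ y rt tw ltac:(by rewrite yw ltW).
set A := [set t | release q <= t /\ y <= delay q t]%classic.
have Ac : A c by split; [apply: le_trans tc|rewrite dc].
have lbt : lbound A t.
  move=> z [rz yz]; rewrite leNgt; apply/negP => zt.
  by have := lt_le_trans dty yz; rewrite ltNge (delay_mono rz (ltW zt)).
have hA : has_inf A by split; [exists c|exists t].
have ta : t <= inf A by apply: lb_le_inf => //; exists c.
have ac : inf A <= c by apply: ge_inf => //; exists t.
have ra : release q <= inf A by apply: le_trans ta.
have dle : delay q (inf A) <= y by rewrite -dc; apply: delay_mono.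
have E : delay q (inf A) = y.
  apply/eqP; rewrite eq_le dle /= leNgt; apply/negP => dlt.
  (* Were the delay at the infimum below [y], a value halfway would be attained at some later [z];
     by monotonicity [z] is still a lower bound of [A], hence not beyond the infimum. *)
  have [|z /andP[az zc] dz] := ivt _ _ ((delay q (inf A) + y) / 2) ra ac.
    by rewrite dc; apply/andP; split; lra.
  have : z <= inf A.
    apply: lb_le_inf; first by exists c.
    move=> w' [rw' yw']; rewrite leNgt; apply/negP => w'z.
    have := delay_mono rw' (ltW w'z); rewrite dz; lra.
  move=> za; have := delay_mono ra az; have := delay_mono (le_trans ra az) za.
  by rewrite dz; lra.
split => //; rewrite lt_neqAle ta andbT; apply/eqP => te.
by move: dty; rewrite te E ltxx.
Qed.

Lemma next_timeP n t l :
  (forall p, p \in l -> release (prq p) <= t /\ 0 < plevel p / n%:R) ->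
  match next_time n t l with
  | Some a => [/\ t < a,
      exists2 p, p \in l & residual a p = residual t p + plevel p / n%:R &
      forall p, p \in l -> forall u, t <= u -> u <= a ->
        residual u p <= residual t p + plevel p / n%:R]
  | None => l = [::]
  end.
Proof.
have key p : release (prq p) <= t -> 0 < plevel p / n%:R ->
   let a := delay_inv (prq p) (raised t p + plevel p / n%:R) in
   [/\ t < a, residual a p = residual t p + plevel p / n%:R &
      forall u, t <= u -> u <= a ->
        residual u p <= residual t p + plevel p / n%:R].
  move=> rt v0 a.
  have [|ta da] := @delay_inv_spec (prq p) t (raised t p + plevel p / n%:R) rt.
    by apply: le_lt_trans (_ : _ <= raised t p) _; rewrite ?le_max ?lexx ?orbT ?ltrDl.
  have Ea : residual a p = residual t p + plevel p / n%:R.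
    rewrite {1}/residual /raised da max_r ?[in RHS]/residual; first by rewrite addrAC.
    by apply: le_trans (_ : _ <= raised t p) _; rewrite ?le_max ?lexx // lerDl ltW.
  split => // u tu ua; rewrite -Ea; apply: le_residual => //.
  exact: le_trans tu.
rewrite /next_time; elim: l => //= p l IH H.
have [rp vp] := H p (mem_head _ _).
have [ta ea ua] := key p rp vp.
set a := delay_inv _ _ in ta ea ua *.
have {}IH := IH (fun p' p'l => H p' (@mem_behead _ (p :: l) _ p'l)).
case: (foldr _ _ _) IH => [b [tb [p' p'l Hp'] Hb]|->]; last first.
  split => //; first by exists p; rewrite ?mem_head.
  by move=> p'; rewrite inE => /eqP->.
case: ifP => [ab|/negbT]; last rewrite -ltNge => ba.
  split => //; first by exists p; rewrite ?mem_head.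
  move=> p''; rewrite inE => /predU1P[->//|p''l] u tu ule.
  by apply: Hb => //; apply: le_trans ab.
split => //; first by exists p'; rewrite // inE p'l orbT.
move=> p''; rewrite inE => /predU1P[->|p''l] u tu ule; last exact: Hb.
by apply: ua => //; apply: le_trans (ltW ba).
Qed.

Lemma decode_cheap_elements B :
  decode (cheap_elements B) = [set e | cost e * (nelem i)%:R <= B].
Proof.
have undlist_dlist (s : seq (data R)) : undlist (dlist s) = s by elim: s => //= d s ->.
apply/setP => e; rewrite !inE undlist_dlist has_map.
apply/idP/idP => [/hasP[e' ]|He].
  by rewrite mem_filter => /andP[+ _] /=; rewrite eqr_nat => He' /eqP/val_inj <-.
by apply/hasP; exists e; rewrite /= ?mem_filter ?He -?enumT ?mem_enum.
Qed.

Lemma pc_opt_le (Q : pc_input i) E : pc_opt Q <= pc_cost Q E.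
Proof. by rewrite /pc_opt; case: arg_minP => // F _; apply. Qed.

Lemma pc_cost_ge0 (Q : pc_input i) E : penalties_ge0 Q -> 0 <= pc_cost Q E.
Proof.
move=> H; rewrite addr_ge0 ?set_cost_ge0 //.
elim: Q H => [|qp Q IH] /=; first by rewrite big_nil.
rewrite big_cons => /andP[H0 /IH {}IH].
by case: ifP => // _; apply: addr_ge0.
Qed.

End Algorithm.

(** * The number of events *)

Lemma ler_sum_seq (R : realType) (T : eqType) (l : seq T) (F G : T -> R) :
  (forall x, x \in l -> F x <= G x) -> \sum_(x <- l) F x <= \sum_(x <- l) G x.
Proof. by move=> H; rewrite big_seq [leRHS]big_seq; apply: ler_sum. Qed.

Lemma ler_sum_gap (R : realType) (T : eqType) (l : seq T) (F G : T -> R) a x0 :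
  (forall x, x \in l -> F x <= G x) -> x0 \in l -> F x0 + a <= G x0 ->
  \sum_(x <- l) F x + a <= \sum_(x <- l) G x.
Proof.
elim: l => // y l IH H; rewrite inE !big_cons => /predU1P[->|x0l] Ha.
  have := @ler_sum_seq _ _ l F G (fun x xl => H x (@mem_behead _ (y :: l) _ xl)); lra.
have := IH (fun x xl => H x (@mem_behead _ (y :: l) _ xl)) x0l Ha.
by have := H y (mem_head _ _); lra.
Qed.

Lemma sumr_ge0_seq (R : realType) (T : eqType) (l : seq T) (F : T -> R) :
  (forall x, x \in l -> 0 <= F x) -> 0 <= \sum_(x <- l) F x.
Proof. by move=> H; rewrite big_seq; apply: sumr_ge0. Qed.

Lemma sumr_const_seq (R : realType) (T : Type) (l : seq T) (a : R) :
  \sum_(x <- l) a = (size l)%:R * a.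
Proof. by rewrite big_const_seq count_predT iter_addr addr0 mulr_natl. Qed.

Lemma ln2_ge (R : realType) : 2^-1 <= ln 2 :> R.
Proof.
have : ln (1 + (- 2^-1)) <= - 2^-1 :> R by apply: le_ln1Dx; lra.
rewrite (_ : 1 + - 2^-1 = 2^-1 :> R); last by lra.
by rewrite lnV ?posrE; lra.
Qed.

Lemma ln_le_self (R : realType) (x : R) : 0 < x -> ln x <= x.
Proof.
move=> x0; have : ln (1 + (x - 1)) <= x - 1 by apply: le_ln1Dx; lra.
by rewrite addrC subrK; lra.
Qed.

Lemma mem_zip_iota (T : eqType) (l : seq T) (n m : nat) (x : T) :
  (x, m) \in zip l (iota n (size l)) ->
  [/\ x \in l, (n <= m)%N & onth l (m - n) = Some x].
Proof.
elim: l n => //= y l IH n; rewrite inE => /predU1P[[-> ->]|/IH[xl nm xm]].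
  by split; rewrite ?eqxx ?mem_head ?leqnn ?subnn.
split; [by rewrite ?inE xl orbT|exact: ltnW|].
by rewrite -(subnSK nm).
Qed.

Section EventCount.
Variables (R : realType) (ND : nd_class R) (i : instance ND) (g k : nat).
Hypothesis g_gt0 : (0 < g)%N.
Implicit Types (t u x : R) (p : pending i) (q : delay_request i).

(** Together [pending_level_le] and [pending_opt] say that a set serving [p] costs at least
    [plevel p / k]; the former also limits how often a level can double. *)
Record pending_ok u p : Prop := {
  pending_release : release (prq p) <= u;
  pending_base : 0 < pbase p;
  pending_level : pbase p <= plevel p;
  pending_level_le : plevel p <= k%:R * pbase p;
  pending_serves : serves (psol p) (prq p);
  pending_cost : set_cost (decode i (psol p)) = g%:R * pbase p;
  pending_paid : 0 <= ppaid p;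
  pending_opt : forall E : {set 'I_(nelem i)},
    satisfies E (req (prq p)) -> pbase p <= set_cost E
}.

(** In [service_last], the solution cost less than [g * budget s] when it was found, and the jump
    made since then added at most [budget s] of residual delay. *)
Record service_ok u (s : service i) : Prop := {
  service_budget : 0 < budget s;
  service_ahead : u <= ahead s;
  service_pending : forall p, p \in candidates s -> pending_ok u p;
  service_level : forall p, p \in candidates s -> plevel p = budget s;
  service_paid : forall p, p \in candidates s -> delay (prq p) u <= ppaid p;
  service_hard : forall p, p \in candidates s ->
    ~~ serves (cheap_elements i (budget s)) (prq p);
  service_last : pc_cost (service_pc s) (decode i (last_sol s)) <=
    (g%:R + 1) * budget s
}.

Definition candidates_of (st : state i) : seq (pending i) :=
  if serving st is Some s then candidates s else [::].

(** The factor 2 in [state_residual]: when the algorithm falls idle no level is critical, so the sum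
    is below [x], and it grows by at most [x] before the next event. [state_mode] holds because a
    service runs through at a single instant, between two arrivals. *)
Record state_ok u (st : state i) (future : seq (delay_request i)) : Prop := {
  state_size : (size (queue st) + size (pendings st) + size (candidates_of st)
    + size future <= k)%N;
  state_queue : forall q n, (q, n) \in queue st -> release q = u;
  state_future : forall q, q \in future -> u < release q;
  state_mode : queue st = [::] \/ serving st = None;
  state_pending : forall p, p \in pendings st -> pending_ok u p;
  state_service : if serving st is Some s then service_ok u s else True;
  state_residual : forall x, 0 < x -> residual_sum (pendings st) u x <= 2 * x
}.

Definition good_solution (st : state i) (out : data R) : Prop :=
  pc_cost (pc_of g st) (decode i out) <= g%:R * pc_opt (pc_of g st).

(** A service with [n <= k] candidates makes at most [n ^ 2 * (g + 1)] jumps, [progress] being at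
    most [n * (g + 1)] budgets and rising by a fraction [1 / n] of the budget each time. It may turn
    every candidate back into a pending request, worth [2 * k] more, and it has an opening and a
    closing event. *)
Definition service_worth : R := k%:R ^+ 2 * (g%:R + 1) + 2 * k%:R ^+ 2 + 2.
(** A request entering at its base level has [doublings] equal to [2 * ln (2 * k)]; the last 1 pays
    for its passage through the queue. *)
Definition queue_worth : R := service_worth * (2 * ln (2 * k%:R)) + 2 * k%:R + 1.

(* Twice the logarithm in base e bounds the number of times the level of [p]
   may still double. *)
Definition doublings p : R := 2 * ln (2 * k%:R * pbase p / plevel p).

(** The second summand counts alarms: a residual delay is at most twice the level, and each alarm
    raises one of them by at least [plevel p / k]. *)
Definition pending_worth u p : R :=
  service_worth * doublings p + k%:R * (2 - residual u p / plevel p).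

(** The cap is needed because the candidates served by the current answer do not limit the jump:
    their residual delays may grow without control meanwhile. *)
Definition progress (s : service i) : R :=
  \sum_(p <- candidates s) Num.min (residual (ahead s) p) ((g%:R + 1) * budget s).

Definition current_worth (s : service i) : R :=
  let n : R := (size (candidates s))%:R in
  \sum_(p <- candidates s) service_worth * doublings p
    + (n ^+ 2 * (g%:R + 1) - n / budget s * progress s) + 2 * k%:R * n + 1.

(** A future request is worth 1 more than a queued one, to pay for the event at which it arrives. *)
Definition events_left u (st : state i) (future : seq (delay_request i)) : R :=
  (queue_worth + 1) * (size future)%:R + queue_worth * (size (queue st))%:R
  + \sum_(p <- pendings st) pending_worth u p
  + (if serving st is Some s then current_worth s else 0).

Lemma service_worth_ge2 : 2 <= service_worth.
Proof.
by rewrite /service_worth lerDr addr_ge0 // mulr_ge0 ?exprn_ge0 ?addr_ge0.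
Qed.

Lemma queue_worth_ge1 : (0 < k)%N -> 1 <= queue_worth.
Proof.
move=> k0; rewrite /queue_worth lerDr addr_ge0 ?mulr_ge0 //.
  by have := service_worth_ge2; lra.
apply: ln_ge0; have : 1 <= k%:R :> R by rewrite ler1n.
by lra.
Qed.

Lemma pending_level_gt0 u p : pending_ok u p -> 0 < plevel p.
Proof. by move=> H; apply: lt_le_trans (pending_base H) (pending_level H). Qed.

Lemma doublings_ge1 u p : pending_ok u p -> 1 <= doublings p.
Proof.
move=> H; have v0 := pending_level_gt0 H.
have : ln 2 <= ln (2 * k%:R * pbase p / plevel p).
  rewrite ler_ln ?posrE //; first by rewrite ler_pdivlMr // -mulrA ler_pM2l // (pending_level_le H).
  rewrite divr_gt0 // -mulrA mulr_gt0 //; apply: lt_le_trans v0 (pending_level_le H).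
by rewrite /doublings; have := ln2_ge R; lra.
Qed.

Lemma residual_le_level (l : seq (pending i)) u p :
  (forall x, 0 < x -> residual_sum l u x <= 2 * x) ->
  p \in l -> 0 < plevel p -> residual u p <= 2 * plevel p.
Proof.
move=> H pl v0; apply: le_trans (H _ v0); rewrite /residual_sum big_mkcond.
rewrite (big_rem p) //= lexx lerDl; apply: sumr_ge0 => p' _.
by case: ifP => _ //; apply: residual_ge0.
Qed.

Lemma pending_worth_ge (l : seq (pending i)) u p :
  (forall x, 0 < x -> residual_sum l u x <= 2 * x) ->
  p \in l -> pending_ok u p -> service_worth * doublings p <= pending_worth u p.
Proof.
move=> H pl ok; have v0 := pending_level_gt0 ok.
rewrite /pending_worth lerDl mulr_ge0 // subr_ge0 ler_pdivrMr //.
exact: residual_le_level H pl v0.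
Qed.

Lemma pending_worth_le u p : pending_ok u p ->
  pending_worth u p <= service_worth * doublings p + 2 * k%:R.
Proof.
move=> ok; rewrite /pending_worth lerD2l mulrC ler_wpM2r // gerBl.
by rewrite divr_ge0 ?residual_ge0 // ltW // (pending_level_gt0 ok).
Qed.

Lemma current_worth_ge u s : service_ok u s ->
  \sum_(p <- candidates s) (service_worth * doublings p + 2 * k%:R) + 1
    <= current_worth s.
Proof.
move=> ok; rewrite /current_worth big_split /= sumr_const_seq.
set n := (size (candidates s))%:R : R.
have B0 := service_budget ok.
suff : n / budget s * progress s <= n ^+ 2 * (g%:R + 1).
  by rewrite [n * _]mulrC; lra.
rewrite mulrAC ler_pdivrMr //.
apply: le_trans (_ : n * (n * ((g%:R + 1) * budget s)) <= _).
  rewrite ler_wpM2l // -sumr_const_seq; apply: ler_sum_seq => p _.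
  by rewrite ge_min lexx orbT.
by rewrite expr2 !mulrA.
Qed.

Lemma doublings_ge0_service u s p : service_ok u s -> p \in candidates s ->
  0 <= service_worth * doublings p.
Proof.
move=> ok pl; have := doublings_ge1 (service_pending ok pl).
by have := service_worth_ge2; nra.
Qed.

Lemma events_left_ge0 u st future : state_ok u st future ->
  0 <= events_left u st future.
Proof.
move=> ok; rewrite /events_left.
have k0 : (0 < k)%N \/ (size future = 0 /\ size (queue st) = 0)%N.
  by have := state_size ok; lia.
rewrite !addr_ge0 //.
- case: k0 => [/queue_worth_ge1 H|[-> _]]; last by rewrite mulr0.
  by rewrite mulr_ge0 //; lra.
- case: k0 => [/queue_worth_ge1 H|[_ ->]]; last by rewrite mulr0.
  by rewrite mulr_ge0 //; lra.
- apply: sumr_ge0_seq => p pl.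
  apply: le_trans (pending_worth_ge (state_residual ok) pl (state_pending ok pl)).
  have := doublings_ge1 (state_pending ok pl).
  by have := service_worth_ge2; nra.
- case: (serving st) (state_service ok) => // s sok.
  apply: le_trans (current_worth_ge sok); rewrite addr_ge0 //.
  apply: sumr_ge0_seq => p pl; rewrite addr_ge0 ?mulr_ge0 //.
    by have := service_worth_ge2; lra.
  by have := doublings_ge1 (service_pending sok pl); rewrite /doublings; lra.
Qed.

Lemma residual_sum_filter (l : seq (pending i)) (a : pred (pending i)) u x :
  residual_sum [seq p <- l | a p] u x <= residual_sum l u x.
Proof.
rewrite /residual_sum big_filter_cond [leRHS](bigID a) /=.
rewrite (eq_bigl (fun p => (plevel p <= x) && a p)); last by move=> p; rewrite andbC.
by rewrite lerDl sumr_ge0 // => p _; apply: residual_ge0.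
Qed.

Lemma pay_ok u t p : pending_ok u p -> pending_ok u (pay t p).
Proof.
case=> *; split => //=; rewrite /raised le_max; apply/orP; by left.
Qed.

Lemma residual_pay t u p : release (prq p) <= u -> u <= t -> residual u (pay t p) = 0.
Proof.
move=> ru ut; apply/eqP; rewrite subr_eq0 /raised /= max_l //.
by rewrite le_max (delay_mono ru ut) orbT.
Qed.

Definition idle (st : state i) u : bool :=
  [&& nilp (queue st), ~~ serving st & ~~ critical_level (pendings st) u].

Lemma g_gt0R : 0 < g%:R :> R. Proof. by rewrite ltr0n. Qed.

Lemma step_queue u st future out q n qs :
  queue st = (q, n) :: qs -> state_ok u st future -> good_solution st out ->
  [/\ state_ok u (step g u st out).1.1 future, (step g u st out).1.2 = Some u &
    events_left u (step g u st out).1.1 future + 1 <= events_left u st future].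
Proof.
move=> Eq ok gs.
have k0 : (0 < k)%N by have := state_size ok; rewrite Eq /=; lia.
have Qw := queue_worth_ge1 k0.
have S0 : serving st = None by case: (state_mode ok) => //; rewrite Eq.
have C0 : candidates_of st = [::] by rewrite /candidates_of S0.
have qu q' n' : (q', n') \in qs -> release q' = u.
  by move=> qn; apply: (@state_queue _ _ _ ok q' n'); rewrite Eq inE qn orbT.
have drop : state_ok u (State qs (pendings st) (serving st)) future.
  case: (ok) => sz _ fu _ pe se re; split => //=; last by right.
  by move: sz; rewrite Eq C0 /= /candidates_of /= S0 /=; lia.
have dropM : events_left u (State qs (pendings st) (serving st)) future + 1
   <= events_left u st future.
  by rewrite /events_left /= S0 Eq /= -natr1 mulrDr; lra.
rewrite /step Eq; case: ifP => [_|/negbFE sat]; first by split.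
case: ifP => [_|/negbT]; first by split.
rewrite -ltNge => c0 /=; set c := set_cost _ in c0 *.
have g0 := g_gt0R.
have cg0 : 0 < c / g%:R by rewrite divr_gt0.
(* A set that serves [q] pays no penalty, so [c <= g * pc_opt <= g * set_cost E]. *)
have opt E : satisfies E (req q) -> c / g%:R <= set_cost E.
  move=> satE; rewrite ler_pdivrMr // mulrC.
  move: gs; rewrite /good_solution /pc_of Eq => gs.
  have := pc_opt_le [:: (req q, g%:R * (\sum_(e : 'I_(nelem i)) cost e) + 1)] E.
  rewrite {1}/pc_cost big_cons big_nil /= satE /= addr0 => H.
  rewrite -(ler_pM2l g0) in H; apply: le_trans H; apply: le_trans gs.
  by rewrite /pc_cost lerDl big_cons big_nil /=; rewrite /serves in sat; rewrite sat.
have rq : release q = u by apply: (@state_queue _ _ _ ok q n); rewrite Eq mem_head.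
set p := Pending _ _ _ _ _ _.
have pok : pending_ok u p.
  split => //=.
  - by rewrite rq.
  - by rewrite ler_peMl ?ler1n // ltW.
  - by rewrite mulrC divfK // gt_eqF.
  - by apply: delay_ge0; rewrite rq.
split => //.
  case: (ok) => sz _ fu _ pe se re; split => //=.
  - by move: sz; rewrite Eq C0 /= /candidates_of /= S0 /=; lia.
  - by right.
  - by move=> p'; rewrite inE => /predU1P[->//|]; apply: pe.
  - move=> x x0; rewrite /residual_sum big_cons; case: ifP => _; last exact: re.
    by rewrite {1}/residual /raised /= maxxx subrr add0r; apply: re.
rewrite /events_left /= S0 Eq big_cons /= -natr1 mulrDr.
have := pending_worth_le pok.
have -> : doublings p = 2 * ln (2 * k%:R).
  by rewrite /doublings /= -mulrA mulfV ?mulr1 // gt_eqF.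
by rewrite /queue_worth; lra.
Qed.

Lemma step_finish u st future s :
  queue st = [::] -> serving st = Some s -> state_ok u st future ->
  let st' := State [::] ([seq pay (ahead s) p | p <- candidates s
     & ~~ serves (last_sol s) (prq p)] ++ pendings st) None in
  state_ok u st' future /\ events_left u st' future + 1 <= events_left u st future.
Proof.
move=> Q0 Es ok st'.
case: (ok) => sz _ fu _ pe se re; rewrite Es in se.
have inv p : p \in [seq pay (ahead s) p | p <- candidates s
     & ~~ serves (last_sol s) (prq p)] -> exists2 p', p' \in candidates s & p = pay (ahead s) p'.
  by case/mapP => p'; rewrite mem_filter => /andP[_ p'c] ->; exists p'.
split.
  split => //=.
  - move: sz; rewrite /candidates_of Es /= size_cat size_map size_filter.
    by have := count_size (fun p => ~~ serves (last_sol s) (prq p)) (candidates s); lia.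
  - by left.
  - move=> p; rewrite mem_cat => /orP[/inv[p' p'c ->]|]; last exact: pe.
    by apply/pay_ok/(service_pending se).
  - move=> x x0; rewrite /residual_sum big_cat /= big_seq_cond big1 ?add0r; first exact: re.
    move=> p /andP[/inv[p' p'c ->] _]; apply: residual_pay (service_ahead se).
    exact: pending_release (service_pending se p'c).
rewrite /events_left /= Q0 Es /= big_cat /=.
have := current_worth_ge se.
suff : \sum_(p <- [seq pay (ahead s) p | p <- candidates s
     & ~~ serves (last_sol s) (prq p)]) pending_worth u p <=
   \sum_(p <- candidates s) (service_worth * doublings p + 2 * k%:R) by lra.
rewrite big_map big_filter big_mkcond /=; apply: ler_sum_seq => p pc.
have ok' := service_pending se pc.
case: ifP => _; first exact: pending_worth_le (pay_ok _ ok').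
by rewrite addr_ge0 ?(doublings_ge0_service se pc) // mulr_ge0.
Qed.

Lemma step_drop_service u st future s :
  queue st = [::] -> serving st = Some s -> state_ok u st future ->
  let st' := State [::] (pendings st) None in
  state_ok u st' future /\ events_left u st' future + 1 <= events_left u st future.
Proof.
move=> Q0 Es ok st'.
case: (ok) => sz _ fu _ pe se re; rewrite Es in se.
split.
  by split => //=; [move: sz; rewrite /candidates_of /=; lia|left].
rewrite /events_left /= Q0 Es /=.
have := current_worth_ge se.
suff : 0 <= \sum_(p <- candidates s) (service_worth * doublings p + 2 * k%:R) by lra.
apply: sumr_ge0_seq => p pc.
by rewrite addr_ge0 ?(doublings_ge0_service se pc) // mulr_ge0.
Qed.

Lemma service_pcE s (E : {set 'I_(nelem i)}) : pc_cost (service_pc s) E =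
  set_cost E + \sum_(p <- candidates s | ~~ satisfies E (req (prq p))) residual (ahead s) p.
Proof. by rewrite /pc_cost big_map. Qed.

Lemma residual_le_pc s (E : {set 'I_(nelem i)}) p : p \in candidates s ->
  ~~ satisfies E (req (prq p)) -> residual (ahead s) p <= pc_cost (service_pc s) E.
Proof.
move=> pc un; rewrite service_pcE ler_wpDl ?set_cost_ge0 //.
rewrite big_mkcond (big_rem p) //= un lerDl sumr_ge0 // => p' _.
by case: ifP => // _; apply: residual_ge0.
Qed.

Lemma step_look u st future out s a :
  queue st = [::] -> serving st = Some s -> state_ok u st future ->
  pc_cost (service_pc s) (decode i out) < g%:R * budget s ->
  next_time (size (candidates s)) (ahead s)
     [seq p <- candidates s | ~~ serves out (prq p)] = Some a ->
  let s' := Service (budget s) a out (candidates s) in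
  let st' := State [::] (pendings st) (Some s') in
  [/\ state_ok u st' future, events_left u st' future + 1 <= events_left u st future &
    ahead s < a].
Proof.
move=> Q0 Es ok lt Ea s' st'.
case: (ok) => sz _ fu _ pe se re; rewrite Es in se.
have B0 := service_budget se.
have := @next_timeP _ _ _ (size (candidates s)) (ahead s)
   [seq p <- candidates s | ~~ serves out (prq p)].
rewrite Ea => -[|tau_a [p0 p0U Hp0] Ha].
  move=> p; rewrite mem_filter => /andP[_ pc]; split.
    exact: le_trans (pending_release (service_pending se pc)) (service_ahead se).
  rewrite divr_gt0 ?(pending_level_gt0 (service_pending se pc)) // ltr0n.
  by case: (candidates s) pc.
move: p0U; rewrite mem_filter => /andP[p0un p0c].
set n := (size (candidates s))%:R : R in Hp0 Ha.
have n0 : 0 < n by rewrite ltr0n; case: (candidates s) p0c.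
split => //.
  split => //=; first by move: sz; rewrite /candidates_of Es Q0 /=; lia.
    by left.
  case: (se) => ? uahead *; split => //=; first exact: le_trans uahead (ltW tau_a).
  rewrite service_pcE /=.
  apply: le_trans (_ : set_cost (decode i out) + \sum_(p <- candidates s |
     ~~ satisfies (decode i out) (req (prq p))) (residual (ahead s) p + budget s / n) <= _).
    rewrite lerD2l big_seq_cond [leRHS]big_seq_cond; apply: ler_sum => p /andP[pc un].
    rewrite -(service_level se pc); apply: Ha => //; last exact: ltW.
    by rewrite mem_filter un.
  rewrite big_split /= addrA -service_pcE mulrDl mul1r; apply: lerD; first exact: ltW.
  apply: le_trans (_ : \sum_(p <- candidates s) budget s / n <= _).
    rewrite big_mkcond; apply: ler_sum => p _; case: ifP => // _.
    by rewrite divr_ge0 // ltW.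
  by rewrite sumr_const_seq -/n mulrCA mulfV ?mulr1 // gt_eqF.
rewrite /events_left /= Q0 Es /=.
rewrite /current_worth /= -/n.
suff : n / budget s * progress s + 1 <= n / budget s * progress s' by lra.
(* The jump stops when an unserved candidate has gained [budget s / n]. Its residual delay was part
   of a cost below [g * budget s], so the cap does not hide this gain. *)
suff : progress s + budget s / n <= progress s'.
  rewrite -(ler_pM2l (_ : 0 < n / budget s)) ?divr_gt0 // mulrDr.
  rewrite (_ : n / budget s * (budget s / n) = 1) //.
  by field; rewrite !gt_eqF.
have release_p p : p \in candidates s -> release (prq p) <= ahead s.
  by move=> pc; apply: le_trans (pending_release (service_pending se pc)) (service_ahead se).
apply: (@ler_sum_gap _ _ _ _ _ _ p0) => //= [p pc|].
  rewrite le_min !ge_min lexx orbT andbT le_residual ?release_p //; exact: ltW.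
rewrite Hp0 (service_level se p0c).
have H1 : residual (ahead s) p0 < g%:R * budget s.
  by apply: le_lt_trans lt; apply: residual_le_pc.
have H2 : budget s / n <= budget s.
  rewrite ler_pdivrMr // ler_peMr //; first exact: ltW.
    by rewrite ler1n; case: (candidates s) p0c.
by rewrite !min_l; lra.
Qed.

Lemma step_start u st future v :
  queue st = [::] -> serving st = None -> state_ok u st future ->
  critical_level (pendings st) u = Some v ->
  let st' := State [::] [seq p <- pendings st | 2 * v < plevel p]
               (Some (start_service u (pendings st) (2 * v))) in
  state_ok u st' future /\ events_left u st' future + 1 <= events_left u st future.
Proof.
move=> Q0 Es ok Ev st'.
case: (ok) => sz _ fu _ pe _ re.
have := critical_levelP (pendings st) u; rewrite Ev => -[[p0 p0l p0v] Hv _].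
have v0 : 0 < v by rewrite -p0v; apply: pending_level_gt0 (pe _ p0l).
set B := 2 * v in st' *.
have B0 : 0 < B by rewrite /B; lra.
set s := start_service u (pendings st) B in st' *.
pose cands := [seq p <- pendings st | plevel p <= B].
pose nc p := (B < pbase p * (size cands)%:R) && ~~ serves (cheap_elements i B) (prq p).
have szc : (size [seq p <- pendings st | (B < plevel p)%R] + size cands =
    size (pendings st))%N.
  rewrite !size_filter addnC -(count_predC (fun p => plevel p <= B)); congr addn.
  by apply: eq_count => p /=; rewrite ltNge.
have szs : (size (candidates s) <= size cands)%N.
  by rewrite size_map size_filter count_size.
have szk : (size cands <= k)%N by lia.
have k0 : 0 < k%:R :> R.
  rewrite ltr0n; have : (0 < size (pendings st))%N by case: (pendings st) p0l.
  by lia.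
have cokay p : p \in cands -> nc p -> pending_ok u (pay_upgrade B u p).
  rewrite mem_filter => /andP[pB pl] /andP[pn _].
  case: (pe _ pl) => *; split => //=.
  - exact: le_trans pB.
  - apply: le_trans (ltW pn) _; rewrite mulrC ler_wpM2r ?ler_nat //; exact: ltW.
  - by rewrite /raised le_max; apply/orP; left.
have inv p : p \in candidates s -> exists p', [/\ p' \in cands, nc p' & p = pay_upgrade B u p'].
  by case/mapP => p'; rewrite mem_filter => /andP[? ?] ->; exists p'.
have res0 p : residual u (pay_upgrade B u p) = 0.
  by apply/eqP; rewrite subr_eq0 /raised /= max_l // le_max lexx orbT.
have sok : service_ok u s.
  split => //=.
  - by move=> p /inv[p' [? ? ->]]; apply: cokay.
  - by move=> p /inv[p' [? ? ->]].
  - by move=> p /inv[p' [? ? ->]]; rewrite /= /raised le_max lexx orbT.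
  - by move=> p /inv[p' [? /andP[_ ?] ->]].
  - rewrite service_pcE big_seq_cond big1 ?addr0; last first.
      by move=> p /andP[/inv[p' [? ? ->]] _]; rewrite /= res0.
    rewrite /decode /decode_set /= /set_cost big1; first by rewrite mulr_ge0 ?addr_ge0 // ltW.
    by move=> e; rewrite !inE.
split.
  split.
  - change (0 + size [seq p <- pendings st | (B < plevel p)%R] + size (candidates s)
      + size future <= k)%N.
    by move: (sz); rewrite {1}Q0 {1}/candidates_of {1}Es {1}/size; lia.
  - by [].
  - by [].
  - by left.
  - by move=> p; rewrite mem_filter => /andP[_]; apply: pe.
  - by [].
  - by move=> x x0; apply: le_trans (residual_sum_filter _ _ _ _) (re _ x0).
rewrite /events_left /= Q0 Es /=.
have -> : \sum_(p <- pendings st) pending_worth u p =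
    \sum_(p <- [seq p <- pendings st | B < plevel p]) pending_worth u p +
    \sum_(p <- cands) pending_worth u p.
  rewrite !big_filter (bigID (fun p => B < plevel p)) /=; congr (_ + _).
  by apply: eq_bigl => p; rewrite leNgt.
suff : current_worth s + 1 <= \sum_(p <- cands) pending_worth u p by lra.
apply: le_trans (_ : _ <= \sum_(p <- cands) service_worth * doublings p) _; last first.
  apply: ler_sum_seq => p; rewrite mem_filter => /andP[_ pl].
  exact: pending_worth_ge re pl (pe _ pl).
rewrite /current_worth.
have -> : progress s = 0.
  rewrite /progress big_seq big1 // => p /inv[p' [_ _ ->]].
  by rewrite /= res0 min_l // mulr_ge0 ?addr_ge0 // ltW.
have distr (l : seq (pending i)) : \sum_(p <- l) service_worth * doublings p =
  service_worth * \sum_(p <- l) doublings p by rewrite big_distrr.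
rewrite mulr0 subr0 !distr.
set n := (size (candidates s))%:R : R.
have n0 : 0 <= n by rewrite ler0n.
have nk : n <= k%:R by rewrite ler_nat (leq_trans szs szk).
have W2 := service_worth_ge2.
have H1 : n ^+ 2 * (g%:R + 1) + 2 * k%:R * n + 1 + 1 <= service_worth.
  rewrite /service_worth -addrA lerD //.
  have : n ^+ 2 <= k%:R ^+ 2 by rewrite ler_sqr ?nnegrE.
  have : k%:R * n <= k%:R ^+ 2 by rewrite expr2 ler_wpM2l.
  have : 0 <= g%:R :> R by [].
  by move=> a b c; apply: lerD; [rewrite ler_wpM2r //; lra|rewrite -mulrA ler_pM2l].
(* The critical request either leaves, releasing [doublings >= 1], or rises from [v] to [2 * v],
   which takes off [2 * ln 2 >= 1]. That one unit is worth the whole service. *)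
suff : \sum_(p <- candidates s) doublings p + 1 <= \sum_(p <- cands) doublings p.
  rewrite -(ler_pM2l (_ : 0 < service_worth)); last by lra.
  rewrite [service_worth * (_ + 1)]mulrDr mulr1 => H2.
  by rewrite -!addrA; apply: le_trans H2; rewrite lerD2l !addrA.
rewrite /s /= big_map big_filter big_mkcond /=.
have half p : p \in cands -> plevel p <= B.
  by rewrite mem_filter => /andP[].
apply: (@ler_sum_gap _ _ _ _ _ _ p0).
- move=> p pc; have ok' : pending_ok u p by apply: pe; move: pc; rewrite mem_filter => /andP[].
  case: ifP => pnc; last by have := doublings_ge1 ok'; lra.
  have l0 := pending_level_gt0 ok'; have b0 := pending_base ok'.
  rewrite /doublings ler_pM2l // ler_ln ?posrE /= ?divr_gt0 ?mulr_gt0 //.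
  by rewrite ler_pM2l ?mulr_gt0 // lef_pV2 ?posrE // half.
- by rewrite mem_filter p0l p0v andbT /B; lra.
- have ok' := pe _ p0l; case: ifP => pnc; last by have := doublings_ge1 ok'; lra.
  have l0 := pending_level_gt0 ok'; have b0 := pending_base ok'.
  rewrite /doublings /= p0v.
  have -> : 2 * k%:R * pbase p0 / v = 2 * (2 * k%:R * pbase p0 / B).
    by rewrite /B; field; rewrite gt_eqF.
  set y := 2 * k%:R * pbase p0 / B.
  have y0 : 0 < y by rewrite divr_gt0 ?mulr_gt0.
  by rewrite (lnM (_ : 2 \is Num.pos)) ?posrE //; have := ln2_ge R; lra.
Qed.

Lemma step_busy u st future out :
  state_ok u st future -> good_solution st out -> ~~ idle st u ->
  [/\ state_ok u (step g u st out).1.1 future, (step g u st out).1.2 = Some u &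
    events_left u (step g u st out).1.1 future + 1 <= events_left u st future].
Proof.
move=> ok gs; rewrite /idle.
case Eq : (queue st) => [|[q n] qs] /=; last by move=> _; apply: step_queue Eq ok gs.
case Es : (serving st) => [s|] /=.
  move=> _; rewrite /step Eq Es; case: ifP => [_|/negbT].
    by have [? ?] := step_finish Eq Es ok; split.
  rewrite -ltNge => lt; case Ea : (next_time _ _ _) => [a|].
    by have [? ? _] := step_look Eq Es ok lt Ea; split.
  by have [? ?] := step_drop_service Eq Es ok; split.
case Ev : (critical_level _ _) => [v|] //= _.
by rewrite /step Eq Es Ev; have [? ?] := step_start Eq Es ok Ev; split.
Qed.

Lemma step_idle u st out : idle st u ->
  step g u st out = (st, next_time (size (pendings st)) u (pendings st), [::]).
Proof.
case/and3P; rewrite /step; case: (queue st) => //= _.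
by case: (serving st) => //= _; case: (critical_level _ _).
Qed.

Lemma pending_ok_le u u' p : u <= u' -> pending_ok u p -> pending_ok u' p.
Proof. by move=> uu' []*; split => //; apply: le_trans uu'. Qed.

Lemma idle_advance u st future u' (n : nat) :
  state_ok u st future -> idle st u ->
  u < u' -> (forall q, q \in future -> u' <= release q) ->
  (forall a, next_time (size (pendings st)) u (pendings st) = Some a -> u' <= a) ->
  next_time (size (pendings st)) u (pendings st) = Some u' \/
    (exists2 q, q \in future & release q = u') ->
  let new := [seq q <- future | release q <= u'] in
  let rest := [seq q <- future | u' < release q] in
  state_ok u' (enqueue n st new) rest /\
  events_left u' (enqueue n st new) rest + 1 <= events_left u st future.
Proof.
move=> ok; rewrite /idle; case: st ok => -[|? ?] pe [?|] //= ok.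
case Ec: (critical_level _ _) => [?|] //= _ uu' fu ha hu.
set new := [seq q <- future | release q <= u'].
set rest := [seq q <- future | u' < release q].
case: (ok) => /= sz _ _ _ pok _ re.
have szf : (size new + size rest = size future)%N.
  rewrite !size_filter -(count_predC (fun q => release q <= u')); congr addn.
  by apply: eq_count => q /=; rewrite ltNge.
have := critical_levelP pe u; rewrite Ec => nocrit.
have nlast p : p \in pe -> 0 < plevel p / (size pe)%:R.
  by move=> pl; rewrite divr_gt0 ?(pending_level_gt0 (pok _ pl)) // ltr0n; case: (pe) pl.
have incr p : p \in pe -> residual u' p <= residual u p + plevel p / (size pe)%:R.
  move=> pl; have := @next_timeP _ _ _ (size pe) u pe.
  case Ea: (next_time _ _ _) => [a|] H.
    case: H.
      by move=> p' p'l; split; [apply: pending_release (pok _ p'l)|apply: nlast].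
    by move=> _ _; apply => //; [apply: ltW|apply: ha].
  move: pl; rewrite H // => p' p'l.
  by split; [apply: pending_release (pok _ p'l)|apply: nlast].
have re' x : 0 < x -> residual_sum pe u' x <= 2 * x.
  move=> x0; apply: le_trans (_ : residual_sum pe u x + x <= _); last first.
    have : residual_sum pe u x < x by apply: residual_sum_lt => // p pl _; apply: nocrit.
    by lra.
  case: (posnP (size pe)) => [/size0nil ->|n0].
    by rewrite /residual_sum !big_nil; lra.
  apply: le_trans (_ : \sum_(p <- pe | plevel p <= x) (residual u p + x / (size pe)%:R) <= _).
    rewrite /residual_sum big_seq_cond [leRHS]big_seq_cond; apply: ler_sum => p /andP[pl px].
    apply: le_trans (incr _ pl) _; rewrite lerD2l ler_wpM2r //.
  rewrite big_split lerD2l /=.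
  apply: le_trans (_ : \sum_(p <- pe) x / (size pe)%:R <= _).
    rewrite big_mkcond; apply: ler_sum => p _; case: ifP => // _.
    by rewrite divr_ge0 // ltW.
  by rewrite sumr_const_seq mulrCA mulfV ?mulr1 // pnatr_eq0 -lt0n.
have okst : state_ok u' (enqueue n (State [::] pe None) new) rest.
  split => //=.
  - by move: sz; rewrite size_zip size_iota minnn /candidates_of /=; lia.
  - move=> q m /mem_zip_iota [qn _ _].
    by move: qn; rewrite mem_filter => /andP[qu /fu uq]; apply/eqP; rewrite eq_le qu.
  - by move=> q; rewrite mem_filter => /andP[].
  - by right.
  - by move=> p /pok; apply: pending_ok_le; apply: ltW.
split => //.
rewrite /events_left /= size_zip size_iota minnn -szf natrD.
have mono p : p \in pe -> pending_worth u' p <= pending_worth u p.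
  move=> pl; have := pok _ pl => pk; rewrite lerD2l ler_wpM2l // lerB // ler_wpM2r //.
    by rewrite invr_ge0 ltW // (pending_level_gt0 pk).
  by apply: le_residual (pending_release pk) _; apply: ltW.
have Hs := ler_sum_seq mono.
case: hu => [Ea|[q qf qu]]; last first.
  have n1 : 1 <= (size new)%:R :> R.
    rewrite ler1n; have : q \in new by rewrite mem_filter qf qu lexx.
    by case: (new).
  by rewrite !mulrDl mulrDr; lra.
have := @next_timeP _ _ _ (size pe) u pe; rewrite Ea => -[|_ [p0 p0l Hp0] _].
  by move=> p' p'l; split; [apply: pending_release (pok _ p'l)|apply: nlast].
(* When the alarm rings for [p0], its residual delay has gained [plevel p0 / n], where [n <= k]: its
   worth falls by [k / n >= 1]. *)
suff : \sum_(p <- pe) pending_worth u' p + 1 <= \sum_(p <- pe) pending_worth u p.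
  by have : 0 <= (size new)%:R :> R by []; rewrite !mulrDl mulrDr; lra.
apply: (@ler_sum_gap _ _ _ _ _ _ p0) => //.
have v0 := pending_level_gt0 (pok _ p0l).
rewrite /pending_worth Hp0 -addrA lerD2l mulrDl.
have n0 : 0 < (size pe)%:R :> R by rewrite ltr0n; case: (pe) p0l.
have nk : (size pe)%:R <= k%:R :> R by rewrite ler_nat; lia.
rewrite (_ : plevel p0 / (size pe)%:R / plevel p0 = ((size pe)%:R)^-1); last first.
  by field; rewrite !gt_eqF.
have : 1 <= k%:R / (size pe)%:R :> R by rewrite ler_pdivlMr // mul1r.
lra.
Qed.

End EventCount.

(** * The competitive ratio *)

Section CompetitiveRatio.
Variables (R : realType) (ND : nd_class R) (i : instance ND) (g k : nat).
Hypothesis g_gt0 : (0 < g)%N.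
Variable offline : schedule i.
Implicit Types (t u B : R) (p : pending i) (q : delay_request i).
Implicit Types (S : R * {set 'I_(nelem i)}) (H : seq (R * R)).

Lemma bigmin_attained (T : eqType) (s : seq T) (P : pred T) (F : T -> R) y :
  \big[Order.min/+oo%E]_(z <- s | P z) (F z)%:E = y%:E ->
  exists z, [/\ z \in s, P z & F z = y].
Proof.
elim: s => [|a s IH]; first by rewrite big_nil.
rewrite big_cons; case: ifP => [Pa|_ /IH[x [xs Px Fx]]]; last first.
  by exists x; rewrite inE xs orbT.
rewrite minEle; case: ifP => [_ [<-]|_ /IH[x [xs Px Fx]]].
  by exists a; rewrite mem_head.
by exists x; rewrite inE xs orbT.
Qed.

Definition offline_serves q : bool := service_time offline q \is a fin_num.
Definition offline_delay q : R := fine (delay_cost offline q).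

Lemma offline_servesP q : offline_serves q -> exists S,
  [/\ S \in offline, release q <= S.1, satisfies S.2 (req q) &
    offline_delay q = delay q S.1].
Proof.
rewrite /offline_serves /offline_delay /delay_cost.
case E: (service_time offline q) => [t| |] // _.
by have [S [Ss /andP[rS sS] <-]] := bigmin_attained E; exists S.
Qed.

Lemma offline_dichotomy q u : offline_serves q -> release q <= u ->
  (exists S, [/\ S \in offline, release q <= S.1, S.1 <= u & satisfies S.2 (req q)])
  \/ delay q u <= offline_delay q.
Proof.
move=> /offline_servesP[S [Ss rS sS ->]] ru.
have [Su|uS] := leP S.1 u; first by left; exists S.
by right; apply: delay_mono ru (ltW uS).
Qed.

Lemma offline_delay_release q : offline_serves q ->
  delay q (release q) <= offline_delay q.
Proof.
by move=> /offline_servesP[S [Ss rS sS ->]]; apply: delay_mono.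
Qed.

Lemma offline_delay_ge0 q : offline_serves q -> 0 <= offline_delay q.
Proof.
by move=> /offline_servesP[S [Ss rS sS ->]]; apply: delay_ge0.
Qed.

Definition K : R := (minn k (nelem i))%:R.
Notation L := (log_min R k (nelem i)).

(* A history lists the times and budgets of the services started so far, most
   recent first.  The transmissions that a new service of budget [B] may charge
   to are those that no service of budget above [B / 2] has followed, so the
   budgets charged to one transmission double. *)
Definition chargeable H t B S : bool :=
  [&& S.1 <= t, B <= 4 * K * set_cost S.2 &
    all (fun h => (B / 2 < h.2) ==> (h.1 < S.1)) H].

Fixpoint charged H S : R :=
  if H is (t, B) :: H' then
    charged H' S + (if chargeable H' t B S then Num.min (set_cost S.2) B else 0)
  else 0.

Lemma L_ge1 : 1 <= L. Proof. by rewrite /log_min le_max lexx. Qed.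

(** The budgets charged to [S] double. Those up to its cost [c] form a geometric sum; the later ones
    contribute [c] each, and there are logarithmically many because all are at most [4 * K * c]. The
    total is at most [3c + 2c ln(4K) <= 7c + 2cL <= 9Lc]. *)
Lemma charged_le H S : (forall h, h \in H -> 0 < h.2) ->
  charged H S <= 9 * L * set_cost S.2.
Proof.
set c := set_cost S.2 => Hpos.
have c0 : 0 <= c by apply: set_cost_ge0.
have L1 := L_ge1.
move: c0; rewrite le_eqVlt => /predU1P[c0|c0].
  (* A free transmission is never chargeable, since [B <= 4 * K * 0] contradicts the positivity of
     budgets. *)
  rewrite -c0 mulr0; elim: H Hpos => //= -[t B] H IH Hpos.
  rewrite (_ : chargeable _ _ _ _ = false) ?addr0.
    by apply: IH => h hH; apply: Hpos; rewrite inE hH orbT.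
  apply/negbTE/negP => /and3P[_]; rewrite -/c -c0 mulr0.
  by have /= := Hpos (t, B) (mem_head _ _); lra.
(* Here [x] is the last budget charged. Beyond [c], doubling [x] raises [f] by [2 * c * ln 2 >= c],
   which covers the new charge. *)
pose f x := if x <= c then 2 * x else 3 * c + 2 * c * ln (x / c).
have [x [x0 xK _ xf]] : exists x, [/\ 0 <= x, x <= 4 * K * c,
    x = 0 \/ (exists h, [/\ h \in H, S.1 <= h.1 & x = h.2]) & charged H S <= f x].
  elim: H Hpos => [|[t B] H IH] Hpos /=.
    exists 0; split => //; [|by left|by rewrite /f (ltW c0) mulr0].
    by rewrite !mulr_ge0 // ?ler0n // ltW.
  have [h hH|x [x0 xK xH xf]] := IH.
    by apply: Hpos; rewrite inE hH orbT.
  have /= B0 := Hpos (t, B) (mem_head _ _).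
  case: ifP => [/and3P[St BK /allP nb]|_]; last first.
    exists x; rewrite addr0; split => //; case: xH => [|[h [hH Sh xh]]]; [by left|right].
    by exists h; rewrite inE hH orbT.
  (* The service of budget [x] did not precede [S], so [chargeable] allows the new one only if
     [x <= B / 2]. *)
  have xB : 2 * x <= B.
    case: xH => [->|[h [hH Sh ->]]]; first by lra.
    have := nb h hH; rewrite [h.1 < _]ltNge Sh implybF -leNgt; lra.
  exists B; split => //; first exact: ltW.
    by right; exists (t, B); rewrite mem_head.
  rewrite -/c; apply: le_trans (lerD xf (lexx _)) _; rewrite /f.
  case: (leP B c) => Bc.
    have -> : x <= c by lra.
    by lra.
  have lnB : 0 <= ln (B / c) by rewrite ln_ge0 // ler_pdivlMr // mul1r ltW.
  case: (leP x c) => xc.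
    have : 0 <= c * ln (B / c) by rewrite mulr_ge0 // ltW.
    by lra.
  have x1 : 0 < x / c by rewrite divr_gt0 // (lt_trans c0).
  have x2 : 0 < x by apply: lt_trans xc.
  have ci : 0 < c^-1 by rewrite invr_gt0.
  have : ln 2 + ln (x / c) <= ln (B / c).
    rewrite -lnM ?posrE // ler_ln ?posrE ?mulr_gt0 ?divr_gt0 //.
    by rewrite mulrA ler_pM2r ?invr_gt0.
  have := ln2_ge R; have : 0 < c by []; nra.
apply: (le_trans xf); rewrite /f; case: ifP => [xc|/negbT]; first by nra.
rewrite -ltNge => cx.
have K0 : 1 <= K.
  rewrite /K ler1n lt0n; apply/eqP => K0; move: xK; rewrite /K K0.
  by lra.
have lnx : ln (x / c) <= ln (4 * K).
  have x2 : 0 < x by apply: lt_trans cx.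
  have K4 : 0 < 4 * K by lra.
  by rewrite ler_ln ?posrE ?divr_gt0 // ler_pdivrMr.
have ln2 : ln 2 <= 1 :> R by have := @le_ln1Dx R 1; rewrite (_ : 1 + 1 = 2 :> R) //; apply; lra.
have ln4 : ln (4 * K) = 2 * ln 2 + ln K.
  rewrite (_ : 4 * K = 2 * (2 * K)) ?lnM ?posrE //; lra.
have : ln K <= L by rewrite /log_min -/K le_max lexx orbT.
by nra.
Qed.

(* A service of budget B that looked ahead to time [t] certifies that the
   offline cost it accounts for is at least B. The certificate [(B, t, Y)] is
   charged when a request of level B next becomes critical. *)
Definition certified H (C : R * R * R) : Prop :=
  let: (B, t, Y) := C in
  B <= \sum_(S <- offline | [&& S.1 <= t, B <= K * set_cost S.2 &
          all (fun h => (B < h.2) ==> (h.1 < S.1)) H])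
        Num.min (set_cost S.2) B + Y.

(** This is the part of the offline delay crossed when the paid delay rises from [ppaid p] to
    [raised t p]. Successive payments cross disjoint parts, and [slack] is what remains: the offline
    delay of a request is thus charged only once. *)
Definition gain t p : R :=
  Num.min (raised t p) (offline_delay (prq p)) -
  Num.min (ppaid p) (offline_delay (prq p)).

Definition slack p : R :=
  offline_delay (prq p) - Num.min (ppaid p) (offline_delay (prq p)).

Lemma gain_ge0 t p : 0 <= gain t p.
Proof.
by rewrite subr_ge0 le_min !ge_min lexx orbT andbT /raised le_max lexx.
Qed.

Lemma slack_ge0 p : 0 <= slack p.
Proof. by rewrite subr_ge0 ge_min lexx orbT. Qed.

Lemma slack_pay t p : slack p = gain t p + slack (pay t p).
Proof. by rewrite /slack /gain /=; lra. Qed.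

Lemma gain_residual t p : ppaid p <= delay (prq p) t ->
  delay (prq p) t <= offline_delay (prq p) -> gain t p = residual t p.
Proof.
move=> h1 h2; rewrite /gain /residual /raised max_r // !min_l //.
exact: le_trans h2.
Qed.

Definition active (st : state i) : seq (delay_request i) :=
  [seq a.1 | a <- queue st] ++ [seq prq p | p <- pendings st ++ candidates_of st].

(** Per unit of budget, a service spends 1 on cheap elements, [g] on own solutions, 2 on unpaid
    delays, and puts [2 * g + 1] in reserve for what its look-ahead transmits and pays. *)
Definition unit_cost : R := 3 * g%:R + 4.

(** Paid delays stay in the potential until the request is served, which is when the schedule really
    incurs them; queued and future requests hold their delay at release for the same purpose. The
    factor 4 matches the charge of [B / 4] guaranteed for each service. *)
Definition potential (st : state i) (future : seq (delay_request i)) H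
    (A : seq (R * R * R)) : R :=
  4 * unit_cost * (\sum_(S <- offline) (9 * L * set_cost S.2 - charged H S)
     + \sum_(C <- A) C.2
     + \sum_(p <- pendings st ++ candidates_of st) slack p
     + \sum_(q <- [seq a.1 | a <- queue st] ++ future) offline_delay q)
  + \sum_(p <- pendings st ++ candidates_of st) ppaid p
  + \sum_(q <- [seq a.1 | a <- queue st] ++ future) delay q (release q)
  + (if serving st is Some s then (2 * g%:R + 1) * budget s else 0).

(** Since the delay up to the certificate's time is paid, a positive residual delay shows that this
    time has passed. *)
Definition has_certificate (A : seq (R * R * R)) p : Prop :=
  exists C, [/\ C \in A, C.1.1 = plevel p & delay (prq p) C.1.2 <= ppaid p].

(** [acc_level] holds because a service starting after the release of [p], with budget at least the
    level of [p], would have served [p] or raised it to that budget. [acc_queue] provides it for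
    requests that become pending at time [u]. *)
Record accounts_ok u (st : state i) (future : seq (delay_request i)) H
    (A : seq (R * R * R)) : Prop := {
  acc_past : forall h, h \in H -> h.1 <= u;
  acc_budget : forall h, h \in H -> 0 < h.2;
  acc_queue : queue st <> [::] -> forall h, h \in H -> h.1 < u;
  acc_level : forall p, p \in pendings st ++ candidates_of st ->
    forall h, h \in H -> plevel p < h.2 -> h.1 < release (prq p);
  acc_offline : forall q, q \in active st ++ future -> offline_serves q;
  acc_cert : forall p, p \in pendings st ->
    plevel p = pbase p \/ has_certificate A p;
  acc_certified : forall C, C \in A -> certified H C;
  acc_nonneg : forall C, C \in A -> 0 <= C.2
}.

(* The cost of an event, with the delays of the requests [sv] it serves, is
   paid for by the decrease of the potential. *)
Definition paid_for u (st st' : state i) (future : seq (delay_request i))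
    (tr : seq (data R)) H A H' A' : Prop :=
  exists sv : seq (delay_request i),
  [/\ perm_eq (active st) (active st' ++ sv),
    forall q, q \in sv -> release q <= u /\ has (fun d => serves d q) tr,
    \sum_(d <- tr) set_cost (decode i d) + \sum_(q <- sv) delay q u
      + potential st' future H' A' <= potential st future H A &
    accounts_ok u st' future H' A'].

Lemma potential_ge0 u st future H A :
  state_ok g k u st future -> accounts_ok u st future H A ->
  0 <= potential st future H A.
Proof.
move=> sok ok; have g0 : 0 <= g%:R :> R by [].
have ppaid0 p : p \in pendings st ++ candidates_of st -> 0 <= ppaid p.
  rewrite mem_cat /candidates_of => /orP[/(state_pending sok)/pending_paid//|].
  by case: (serving st) (state_service sok) => // s /service_pending H1 /H1 /pending_paid.
rewrite /potential !addr_ge0 //.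
- rewrite mulr_ge0 ?addr_ge0 //; first by rewrite /unit_cost; lra.
  + by apply: sumr_ge0 => S _; rewrite subr_ge0 charged_le //; apply: acc_budget ok.
  + by apply: sumr_ge0_seq => C /(acc_nonneg ok).
  + by apply: sumr_ge0 => p _; apply: slack_ge0.
  + apply: sumr_ge0_seq => q ql; apply: offline_delay_ge0; apply: (acc_offline ok).
    by move: ql; rewrite /active !mem_cat => /orP[->|->]; rewrite ?orbT.
- exact: sumr_ge0_seq.
- by apply: sumr_ge0 => q _; apply: delay_ge0.
- case: (serving st) (state_service sok) => // s sok'.
  by rewrite mulr_ge0 ?ltW ?(service_budget sok') //; lra.
Qed.

Lemma min_sum_le (T : Type) (s : seq T) (P : pred T) (F : T -> R) B :
  0 <= B -> (forall x, 0 <= F x) ->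
  Num.min (\sum_(x <- s | P x) F x) B <= \sum_(x <- s | P x) Num.min (F x) B.
Proof.
move=> B0 F0; elim: s => [|a s IH]; first by rewrite !big_nil ge_min lexx.
rewrite !big_cons; case: ifP => // _.
have : 0 <= \sum_(x <- s | P x) F x by apply: sumr_ge0.
have := F0 a; move: IH; set X := \sum_(_ <- _ | _) _; set Y := \sum_(_ <- _ | _) _.
rewrite !minEle; case: ifP; case: ifP; case: ifP; lra.
Qed.

Lemma set_cost_bigcup (s : seq (R * {set 'I_(nelem i)})) (P : pred _) :
  set_cost (\big[@finset.setU _/finset.set0]_(S <- s | P S) S.2) <=
  \sum_(S <- s | P S) set_cost S.2.
Proof.
elim: s => [|a s IH]; first by rewrite !big_nil /set_cost big_set0.
rewrite !big_cons; case: ifP => // _; apply: le_trans (lerD (lexx _) IH).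
set E := \big[_/_]_(_ <- _ | _) _; rewrite /set_cost.
rewrite (finset.big_setID a.2) /= (finset.setIidPr (finset.subsetUl _ _)) lerD2l.
apply: (@set_costS _ _ i); apply/fintype.subsetP => e; rewrite !inE.
by case: (e \in a.2).
Qed.

Lemma bigcup_member (s : seq (R * {set 'I_(nelem i)})) (P : pred _) S :
  S \in s -> P S -> S.2 \subset \big[@finset.setU _/finset.set0]_(S <- s | P S) S.2.
Proof.
elim: s => // a s IH; rewrite inE big_cons => /predU1P[->|Ss] PS.
  by rewrite PS finset.subsetUl.
case: ifP => _; last exact: IH.
exact: fintype.subset_trans (IH Ss PS) (finset.subsetUr _ _).
Qed.

(** Compare the optimum with the union [E] of the offline transmissions up to [t] that serve some
    candidate. A candidate not served by [E] waits past [t] offline as well, so its residual delay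
    is all gain. Each set of the union costs at least [B / K]: it serves a request of level
    [B <= k * pbase], and it contains an expensive element because the cheap ones do not suffice. It
    follows every service of larger budget, since these precede the release of that request. *)
Lemma service_certified u s H :
  service_ok g k u s ->
  (forall p, p \in candidates s -> offline_serves (prq p)) ->
  (forall p, p \in candidates s -> forall h, h \in H -> budget s < h.2 ->
      h.1 < release (prq p)) ->
  budget s <= pc_opt (service_pc s) ->
  certified H (budget s, ahead s, \sum_(p <- candidates s) gain (ahead s) p).
Proof.
move=> sok off lev opt; have B0 := service_budget sok.
set B := budget s in lev opt B0 *; set t := ahead s.
pose rel S := (S.1 <= t) && has (fun p => (release (prq p) <= S.1) &&
   satisfies S.2 (req (prq p))) (candidates s).
pose E := \big[@finset.setU _/finset.set0]_(S <- offline | rel S) S.2.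
have relP S : rel S -> [&& S.1 <= t, B <= K * set_cost S.2 &
          all (fun h => (B < h.2) ==> (h.1 < S.1)) H].
  case/andP=> -> /hasP[p pc /andP[rS sS]] /=; apply/andP; split; last first.
    apply/allP => h hH; apply/implyP => Bh; exact: lt_le_trans (lev p pc h hH Bh) rS.
  have pok := service_pending sok pc.
  have cb := pending_opt pok sS.
  have Bk : B <= k%:R * set_cost S.2.
    have <- : plevel p = B := service_level sok pc.
    apply: le_trans (pending_level_le pok) _.
    by rewrite ler_wpM2l.
  have Bm : B <= (nelem i)%:R * set_cost S.2.
    have := service_hard sok pc; rewrite /serves decode_cheap_elements -/B => hard.
    have /subsetPn[e eS] : ~~ (S.2 \subset [set e | cost e * (nelem i)%:R <= B]).
      by apply: contra hard => /satisfies_up; apply.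
    rewrite inE -ltNge => /ltW /le_trans; apply; rewrite mulrC ler_wpM2l //.
    by rewrite /set_cost (bigD1 e) //= lerDl sumr_ge0 // => e' _; apply: cost_ge0.
  by rewrite /K minnE -minnE /minn; case: ifP.
rewrite /certified -/B -/t.
have le1 : B <= \sum_(S <- offline | rel S) set_cost S.2 +
     \sum_(p <- candidates s) gain t p.
  apply: le_trans opt _; apply: le_trans (pc_opt_le _ E) _.
  rewrite service_pcE; apply: lerD; first exact: set_cost_bigcup.
  rewrite big_mkcond; apply: ler_sum_seq => p pc; case: ifP => [un|_]; last exact: gain_ge0.
  have rt : release (prq p) <= t.
    exact: le_trans (pending_release (service_pending sok pc)) (service_ahead sok).
  case: (offline_dichotomy (off p pc) rt) => [[S [So rS St sS]]|dD].
    have relS : rel S by rewrite /rel St; apply/hasP; exists p; rewrite ?rS ?sS.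
    have := satisfies_up (bigcup_member So relS) sS.
    by rewrite -/E (negbTE un).
  have [dh|hd] := leP (delay (prq p) t) (ppaid p).
    by rewrite /residual /raised max_l // subrr gain_ge0.
  by rewrite gain_residual // ltW.
have le2 := @min_sum_le _ offline rel (fun S => set_cost S.2) B (ltW B0)
  (fun S => set_cost_ge0 S.2).
have le3 : \sum_(S <- offline | rel S) Num.min (set_cost S.2) B <=
   \sum_(S <- offline | [&& S.1 <= t, B <= K * set_cost S.2 &
          all (fun h => (B < h.2) ==> (h.1 < S.1)) H]) Num.min (set_cost S.2) B.
  rewrite big_mkcond [leRHS]big_mkcond; apply: ler_sum => S _.
  case: ifP => [/relP->//|_]; case: ifP => // _.
  by rewrite le_min set_cost_ge0 ltW.
have Y0 : 0 <= \sum_(p <- candidates s) gain t p.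
  by apply: sumr_ge0 => p _; apply: gain_ge0.
(* If the costs add up to more than [B], the truncated sum alone reaches [B]. *)
move: le2; rewrite minEle; case: ifP => _; lra.
Qed.

Lemma perm_filter_map (T T' : eqType) (f : T -> T') (a : pred T) (l : seq T) :
  perm_eq (map f l) (map f [seq x <- l | a x] ++ map f [seq x <- l | ~~ a x]).
Proof. by rewrite -map_cat perm_map // perm_sym perm_filterC. Qed.

Lemma sum_filterC (T : Type) (a : pred T) (l : seq T) (F : T -> R) :
  \sum_(x <- l) F x = \sum_(x <- l | a x) F x + \sum_(x <- l | ~~ a x) F x.
Proof. exact: bigID. Qed.

Lemma account_queue u st future H A out q n qs :
  queue st = (q, n) :: qs -> state_ok g k u st future -> good_solution g st out ->
  accounts_ok u st future H A ->
  paid_for u st (step g u st out).1.1 future (step g u st out).2 H A H A.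
Proof.
move=> Eq sok gs ok.
have S0 : serving st = None by case: (state_mode sok) => //; rewrite Eq.
have C0 : candidates_of st = [::] by rewrite /candidates_of S0.
have ru : release q = u by apply: (@state_queue _ _ _ _ _ _ _ _ sok q n); rewrite Eq mem_head.
have offq : offline_serves q.
  by apply: (acc_offline ok); rewrite /active Eq /= mem_head.
have past0 h : h \in H -> h.1 < u by apply: (acc_queue ok); rewrite Eq.
have off' q' : q' \in active (State qs (pendings st) (serving st)) ++ future -> offline_serves q'.
  move=> ql; apply: (acc_offline ok); move: ql.
  rewrite /active Eq /= /candidates_of /= -/(candidates_of st) inE.
  by rewrite !mem_cat => ->; rewrite orbT.
have D0 := offline_delay_ge0 offq.
have U0 : 0 <= unit_cost by have : 0 <= g%:R :> R by []; rewrite /unit_cost; lra.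
have drop : accounts_ok u (State qs (pendings st) (serving st)) future H A.
  by case: (ok) => a1 a2 a3 a4 a5 a6 a7 a8; split.
rewrite /step Eq; case: ifP => [unsat|/negbFE sat].
  exfalso; have [S [So rS sS _]] := offline_servesP offq.
  move: gs; rewrite /good_solution /pc_of Eq.
  set Q := [:: _] => o2.
  have o1 : pc_opt Q <= set_cost S.2.
    by apply: le_trans (pc_opt_le Q S.2) _; rewrite /pc_cost big_cons big_nil /= sS addr0.
  have c1 : set_cost S.2 <= \sum_(e : 'I_(nelem i)) cost e.
    rewrite /set_cost big_mkcond; apply: ler_sum => e _; case: ifP => // _.
    exact: cost_ge0.
  rewrite {1}/pc_cost big_cons big_nil /= unsat addr0 in o2.
  have := set_cost_ge0 (decode i out).
  have : g%:R * pc_opt Q <= g%:R * \sum_(e : 'I_(nelem i)) cost e.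
    by rewrite ler_wpM2l // (le_trans o1).
  by move: o2; set X := g%:R * \sum_(_ : _) _; lra.
case: ifP => [c0|/negbT c0] /=.
  exists [:: q]; split => //.
  - by rewrite /active Eq /= perm_sym perm_catC.
  - by move=> q'; rewrite inE => /eqP->; rewrite ru lexx /= sat.
  rewrite !big_seq1 /potential Eq /= /candidates_of /= S0 !big_cons ru.
  by have := mulr_ge0 U0 D0; nra.
exists [::]; split => //.
- rewrite cats0 /active Eq /= /candidates_of /= S0 /= perm_sym.
  by rewrite -[q :: map _ _]cat1s perm_catCA.
- rewrite !big_nil /potential Eq /= /candidates_of /= S0 !cats0 !big_cons ru /= add0r.
  set p := Pending _ _ _ _ _ _.
  have d0 : 0 <= delay q u by apply: delay_ge0; rewrite ru.
  have : slack p <= offline_delay q.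
    by rewrite /slack /= gerBl le_min d0 D0.
  by move=> /(ler_wpM2l U0); rewrite add0r; lra.
- case: (ok) => a1 a2 a3 a4 a5 a6 a7 a8; split => //=.
  + move=> p; rewrite /candidates_of /= S0 cats0 inE => /predU1P[-> h hH _ /=|pl].
      by rewrite ru past0.
    by apply: a4; rewrite mem_cat pl.
  + move=> q'; rewrite /active /candidates_of /= S0 !cats0 /= !mem_cat inE.
    have := off' q'; rewrite /active /candidates_of /= S0 !cats0 /= !mem_cat => H1.
    case/orP => [/orP[q'q|/predU1P[->//|q'p]]|q'f]; apply: H1.
    * by rewrite q'q.
    * by rewrite q'p orbT.
    * by rewrite q'f !orbT.
  + by move=> p; rewrite inE => /predU1P[->|/a6//]; left.
Qed.

(** An answer of cost at least [g * budget s] forces the optimum up to [budget s], so a certificate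
    can be issued. Its third component is taken from the slack of the candidates, while the
    transmission and the delays paid in advance come out of the reserve. *)
Lemma account_finish u st future H A out s :
  queue st = [::] -> serving st = Some s ->
  state_ok g k u st future -> good_solution g st out ->
  accounts_ok u st future H A ->
  g%:R * budget s <= pc_cost (service_pc s) (decode i out) ->
  let st' := State [::] ([seq pay (ahead s) p | p <- candidates s
     & ~~ serves (last_sol s) (prq p)] ++ pendings st) None in
  let C := (budget s, ahead s, \sum_(p <- candidates s) gain (ahead s) p) in
  paid_for u st st' future [:: last_sol s] H A H (C :: A).
Proof.
move=> Q0 Es sok gs ok ge st' C.
have := state_service sok; rewrite Es => se.
have B0 := service_budget se.
have Ec : candidates_of st = candidates s by rewrite /candidates_of Es.
have U0 : 0 <= unit_cost by have : 0 <= g%:R :> R by []; rewrite /unit_cost; lra.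
pose sv := [seq prq p | p <- candidates s & serves (last_sol s) (prq p)].
have offc p : p \in candidates s -> offline_serves (prq p).
  move=> pc; apply: (acc_offline ok).
  by rewrite /active Ec !mem_cat map_f ?orbT // mem_cat pc orbT.
have levc p : p \in candidates s -> forall h, h \in H -> budget s < h.2 ->
      h.1 < release (prq p).
  move=> pc h hH; rewrite -(service_level se pc); apply: (acc_level ok) => //.
  by rewrite mem_cat Ec pc orbT.
have cert : certified H C.
  apply: service_certified se _ _ _ => //.
  have g0 : 0 < g%:R :> R by rewrite ltr0n.
  by rewrite -(ler_pM2l g0); apply: le_trans ge _; move: gs; rewrite /good_solution /pc_of Q0 Es.
have inv p : p \in [seq pay (ahead s) p | p <- candidates s
     & ~~ serves (last_sol s) (prq p)] -> exists2 p', p' \in candidates s & p = pay (ahead s) p'.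
  by case/mapP => p'; rewrite mem_filter => /andP[_ p'c] ->; exists p'.
exists sv; split.
- rewrite /active Q0 Ec /= cats0 !map_cat -map_comp.
  rewrite (_ : @prq _ _ i \o @pay _ _ i _ = @prq _ _ i) //; apply/permP => a.
  have /permP/(_ a) := perm_filter_map (@prq _ _ i)
    (fun p => serves (last_sol s) (prq p)) (candidates s).
  by rewrite !count_cat /sv => ->; rewrite addnA addnAC; congr addn; exact: addnC.
- move=> q /mapP[p]; rewrite mem_filter => /andP[psv pc] -> /=.
  by rewrite psv; split => //; apply: pending_release (service_pending se pc).
- rewrite big_seq1 /potential Q0 Ec Es /= /candidates_of /= !cats0 big_cons !big_cat /=.
  rewrite !big_map !big_filter.
  have sl : \sum_(p <- candidates s) slack p >= \sum_(p <- candidates s) gain (ahead s) p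
    + \sum_(p <- candidates s | ~~ serves (last_sol s) (prq p)) slack (pay (ahead s) p).
    have -> : \sum_(p <- candidates s) slack p = \sum_(p <- candidates s) gain (ahead s) p
       + \sum_(p <- candidates s) slack (pay (ahead s) p).
      by rewrite -big_split /=; apply: eq_bigr => p _; apply: slack_pay.
    rewrite lerD2l.
    rewrite [leRHS](sum_filterC (fun p => ~~ serves (last_sol s) (prq p))) lerDl.
    by apply: sumr_ge0 => p _; apply: slack_ge0.
  have pd : \sum_(p <- candidates s | serves (last_sol s) (prq p)) delay (prq p) u
     + \sum_(p <- candidates s | ~~ serves (last_sol s) (prq p)) ppaid p
    <= \sum_(p <- candidates s) ppaid p.
    rewrite [leRHS](sum_filterC (fun p => serves (last_sol s) (prq p))) lerD2r.
    rewrite big_seq_cond [leRHS]big_seq_cond; apply: ler_sum => p /andP[pc _].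
    exact: service_paid se _ pc.
  have pr : \sum_(p <- candidates s | ~~ serves (last_sol s) (prq p)) raised (ahead s) p =
     \sum_(p <- candidates s | ~~ serves (last_sol s) (prq p)) ppaid p +
     \sum_(p <- candidates s | ~~ serves (last_sol s) (prq p)) residual (ahead s) p.
    by rewrite -big_split /=; apply: eq_bigr => p _; rewrite /residual; lra.
  have := service_last se; rewrite service_pcE => ls.
  have gB : 0 <= g%:R * budget s by rewrite mulr_ge0 // ltW.
  have := ler_wpM2l U0 sl; rewrite mulrDr; rewrite /= in ls *.
  by lra.
- case: (ok) => a1 a2 a3 a4 a5 a6 a7 a8; split => //=.
  + move=> p; rewrite /candidates_of /= cats0 mem_cat => /orP[/inv[p' p'c ->] h hH /=|pl].
      by rewrite (service_level se p'c); apply: levc.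
    by apply: a4; rewrite mem_cat pl.
  + move=> q; rewrite /active /= /candidates_of /= cats0 map_cat !mem_cat => /orP[/orP[]|qf].
    * by case/mapP => p /inv[p' p'c ->] ->; exact: (offc p' p'c).
    * by case/mapP => p pl ->; apply: a5; rewrite /active !mem_cat map_f ?orbT // mem_cat pl.
    * by apply: a5; rewrite mem_cat qf orbT.
  + move=> p; rewrite mem_cat => /orP[/inv[p' p'c ->]|/a6[|[C' [C'A H1 H2]]]].
    * right; exists C; rewrite mem_head /C /= (service_level se p'c); split => //.
      by rewrite /raised le_max lexx orbT.
    * by left.
    * by right; exists C'; rewrite inE C'A orbT.
  + by move=> C'; rewrite inE => /predU1P[->|/a7].
  + move=> C'; rewrite inE => /predU1P[->|/a8//] /=.
    by apply: sumr_ge0 => p _; apply: gain_ge0.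
Qed.

Lemma account_all_served u st future H A out s :
  queue st = [::] -> serving st = Some s -> state_ok g k u st future ->
  accounts_ok u st future H A ->
  pc_cost (service_pc s) (decode i out) < g%:R * budget s ->
  [seq p <- candidates s | ~~ serves out (prq p)] = [::] ->
  paid_for u st (State [::] (pendings st) None) future [:: out] H A H A.
Proof.
move=> Q0 Es sok ok lt all.
have := state_service sok; rewrite Es => se.
have B0 := service_budget se.
have Ec : candidates_of st = candidates s by rewrite /candidates_of Es.
have U0 : 0 <= unit_cost by have : 0 <= g%:R :> R by []; rewrite /unit_cost; lra.
exists [seq prq p | p <- candidates s]; split.
- by rewrite /active Q0 Ec /= /candidates_of /= cats0 map_cat.
- move=> q /mapP[p pc ->]; split; first exact: pending_release (service_pending se pc).
  rewrite /= orbF; apply/negPn/negP => un.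
  have : p \in [seq p <- candidates s | ~~ serves out (prq p)] by rewrite mem_filter un.
  by rewrite all.
- rewrite big_seq1 /potential Q0 Ec Es /= /candidates_of /= !cats0 !big_cat /= big_map.
  have sl : 0 <= \sum_(p <- candidates s) slack p.
    by apply: sumr_ge0 => p _; apply: slack_ge0.
  have pd : \sum_(p <- candidates s) delay (prq p) u <= \sum_(p <- candidates s) ppaid p.
    by apply: ler_sum_seq => p pc; apply: service_paid se _ pc.
  have gB : 0 <= g%:R * budget s by rewrite mulr_ge0 // ltW.
  have cl : set_cost (decode i out) <= g%:R * budget s.
    apply: le_trans (ltW lt); rewrite service_pcE lerDl.
    by apply: sumr_ge0 => p _; apply: residual_ge0.
  have := mulr_ge0 U0 sl; lra.
- case: (ok) => a1 a2 a3 a4 a5 a6 a7 a8; split => //=.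
  + by move=> p; rewrite /candidates_of /= cats0 => pl; apply: a4; rewrite mem_cat pl.
  + move=> q; rewrite /active /= /candidates_of /= cats0 mem_cat => /orP[/mapP[p pl ->]|qf].
      by apply: a5; rewrite /active !mem_cat map_f ?orbT // mem_cat pl.
    by apply: a5; rewrite mem_cat qf orbT.
Qed.

(** The potential depends neither on the time looked ahead to nor on the last solution. *)
Lemma account_look u st future H A s a out :
  queue st = [::] -> serving st = Some s ->
  accounts_ok u st future H A ->
  let s' := Service (budget s) a out (candidates s) in
  paid_for u st (State [::] (pendings st) (Some s')) future [::] H A H A.
Proof.
move=> Q0 Es ok s'; exists [::]; split => //.
- by rewrite cats0 /active Q0 /candidates_of Es.
- by rewrite !big_nil /potential Q0 Es /candidates_of /= Es; lra.
- case: (ok) => a1 a2 a3 a4 a5 a6 a7 a8; split => //=.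
  + by move=> p pl; apply: a4; move: pl; rewrite /candidates_of Es.
  + by move=> q ql; apply: a5; move: ql; rewrite /active /candidates_of Es Q0.
Qed.

(* Either a critical request was left behind by an earlier service, whose
   certificate is now charged; or the offline solution has served one of the
   critical requests, at least at the price of its level; or it pays for their
   delays. *)
Lemma critical_charge u st future H A v B :
  state_ok g k u st future -> accounts_ok u st future H A ->
  critical_level (pendings st) u = Some v ->
  B = 2 * v ->
  B / 4 <= \sum_(S <- offline) (if chargeable H u B S then Num.min (set_cost S.2) B else 0)
    + \sum_(C <- A | C.1.1 <= B) C.2
    + \sum_(p <- pendings st | plevel p <= B) gain u p.
Proof.
move=> sok ok Ev EB.
have := critical_levelP (pendings st) u; rewrite Ev => -[[p0 p0l p0v] Hv nocrit].
have v0 : 0 < v by rewrite -p0v; apply: pending_level_gt0 (state_pending sok p0l).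
have t1 : 0 <= \sum_(S <- offline) (if chargeable H u B S then Num.min (set_cost S.2) B else 0).
  apply: sumr_ge0 => S _; case: ifP => // _.
  by rewrite le_min set_cost_ge0; lra.
have t2 : 0 <= \sum_(C <- A | C.1.1 <= B) C.2.
  by rewrite big_seq_cond; apply: sumr_ge0 => C /andP[/(acc_nonneg ok)].
have t3 : 0 <= \sum_(p <- pendings st | plevel p <= B) gain u p.
  by apply: sumr_ge0 => p _; apply: gain_ge0.
(* No level below [v] is critical, so levels up to [v / 2] carry less than [v / 2] of the residual
   delay [v]; the upper half of the range carries the rest. *)
have low : residual_sum (pendings st) u (v / 2) < v / 2.
  by apply: residual_sum_lt => [|p pl plv]; [lra|apply: nocrit => //; lra].
have high : v / 2 <= \sum_(p <- pendings st | v / 2 < plevel p <= v) residual u p.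
  have : residual_sum (pendings st) u v = residual_sum (pendings st) u (v / 2) +
     \sum_(p <- pendings st | v / 2 < plevel p <= v) residual u p.
    rewrite /residual_sum (bigID (fun p => plevel p <= v / 2)) /=; congr (_ + _).
      by apply: eq_bigl => p; apply/andP/idP => [[]//|?]; split => //; lra.
    by apply: eq_bigl => p; rewrite andbC -ltNge.
  by lra.
pose U p := [&& v / 2 < plevel p <= v & 0 < residual u p].
have residual_delay p : 0 < residual u p -> ppaid p < delay (prq p) u.
  by rewrite subr_gt0 /raised lt_max ltxx.
case: (pselect (exists p, [/\ p \in pendings st, U p & has_certificate A p])).
  move=> [p [pl /andP[/andP[pv1 pv2] pres] [[[B' t] Y] [CA /= EB' dt]]]].
  have tu : t <= u.
    rewrite leNgt; apply/negP => ut.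
    have := delay_mono (pending_release (state_pending sok pl)) (ltW ut).
    by have := residual_delay _ pres; lra.
  have := acc_certified ok CA; rewrite /certified => cert.
  have Y1 : Y <= \sum_(C <- A | C.1.1 <= B) C.2.
    have rem0 : 0 <= \sum_(C <- rem (B', t, Y) A | C.1.1 <= B) C.2.
      by rewrite big_seq_cond; apply: sumr_ge0 => C /andP[/mem_rem/(acc_nonneg ok)].
    have B'B : B' <= B by lra.
    by rewrite (big_rem (B', t, Y)) //= B'B lerDl.
  (* Since [B' = plevel p] lies in [(v / 2, v]], one has [B / 4 < B' <= B / 2]. Hence every
     transmission counted by the certificate is chargeable for [B]; the constants of [chargeable]
     are made for this. *)
  have : \sum_(S <- offline | [&& S.1 <= t, B' <= K * set_cost S.2 &
          all (fun h => (B' < h.2) ==> (h.1 < S.1)) H]) Num.min (set_cost S.2) B' <=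
     \sum_(S <- offline) (if chargeable H u B S then Num.min (set_cost S.2) B else 0).
    rewrite big_mkcond; apply: ler_sum => S _; case: ifP => [/and3P[St BK nb]|_]; last first.
      by case: ifP => // _; rewrite le_min set_cost_ge0; lra.
    rewrite /chargeable (le_trans St tu) /= (_ : B <= _) /=; last first.
      by move: BK; lra.
    rewrite (_ : all _ _) /=; last first.
      apply/allP => h hH; apply/implyP => Bh; have := allP nb h hH => /implyP; apply.
      by move: Bh; lra.
    by rewrite le_min ge_min lexx /= ge_min; apply/orP; right; lra.
  by lra.
move=> nocert.
have base p : p \in pendings st -> U p -> plevel p = pbase p.
  move=> pl Up; case: (acc_cert ok pl) => // pc.
  by exfalso; apply: nocert; exists p.
have offp p : p \in pendings st -> offline_serves (prq p).
  by move=> pl; apply: (acc_offline ok); rewrite /active !mem_cat map_f ?orbT // mem_cat pl.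
case: (pselect (exists p S, [/\ p \in pendings st, U p, S \in offline &
   [/\ release (prq p) <= S.1, S.1 <= u & satisfies S.2 (req (prq p))]])).
  move=> [p [S [pl Up So [rS Su sS]]]].
  have := Up => /andP[/andP[pv1 pv2] _].
  have pok := state_pending sok pl.
  have cb := pending_opt pok sS; have Eb := base p pl Up.
  have b0 := pending_base pok.
  (* There is a pending request, so [k > 0], and [S] has positive cost, so there is an element. *)
  have K1 : 1 <= K.
    rewrite /K ler1n /minn; case: ifP => _.
      move: (state_size sok); case: (pendings st) pl => // p1 l _ /=.
      by clear; rewrite addnS !addSn; case: k.
    rewrite lt0n; apply/eqP => n0; move: cb; rewrite /set_cost big1; first by lra.
    by case=> e lt; exfalso; rewrite n0 in lt.
  have : B / 4 <= \sum_(S <- offline) (if chargeable H u B S then Num.min (set_cost S.2) B else 0).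
    rewrite (big_rem S) //=.
    have -> : chargeable H u B S.
      rewrite /chargeable Su /=; apply/andP; split; first by nra.
      apply/allP => h hH; apply/implyP => Bh; apply: lt_le_trans rS.
      apply: (acc_level ok) hH _; first by rewrite mem_cat pl.
      by move: Bh; lra.
    have : 0 <= \sum_(S0 <- rem S offline) (if chargeable H u B S0 then Num.min (set_cost S0.2) B else 0).
      apply: sumr_ge0 => S' _; case: ifP => // _.
      by rewrite le_min set_cost_ge0; lra.
    have : B / 4 <= Num.min (set_cost S.2) B by rewrite le_min; apply/andP; split; lra.
    by lra.
  by lra.
move=> noserve.
have : \sum_(p <- pendings st | v / 2 < plevel p <= v) residual u p <=
    \sum_(p <- pendings st | plevel p <= B) gain u p.
  rewrite big_mkcond [leRHS]big_mkcond; apply: ler_sum_seq => p pl.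
  case: ifP => [pv|_]; last by case: ifP => // _; apply: gain_ge0.
  have -> : plevel p <= B by case/andP: pv; lra.
  have [r0|r0] := leP (residual u p) 0; first exact: le_trans r0 (gain_ge0 _ _).
  have Up : U p by rewrite /U pv.
  have ru := pending_release (state_pending sok pl).
  case: (offline_dichotomy (offp p pl) ru) => [[S [So rS Su sS]]|dD].
    by exfalso; apply: noserve; exists p, S.
  by rewrite gain_residual // ltW // residual_delay.
by lra.
Qed.

(** The certificates of budget at most [B] are consumed. None is missed: the requests still pending
    have level above [B], and those of lower level have been served or made candidates of the new
    service. *)
Lemma account_start u st future H A v :
  queue st = [::] -> serving st = None -> state_ok g k u st future ->
  accounts_ok u st future H A ->
  critical_level (pendings st) u = Some v ->
  let B := 2 * v in
  let st' := State [::] [seq p <- pendings st | B < plevel p]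
               (Some (start_service u (pendings st) B)) in
  paid_for u st st' future (start_transmissions (pendings st) B) H A
    ((u, B) :: H) [seq C <- A | B < C.1.1].
Proof.
move=> Q0 Es sok ok Ev B st'.
have key := critical_charge sok ok Ev (erefl B).
have := critical_levelP (pendings st) u; rewrite Ev => -[[p0 p0l p0v] _ _].
have v0 : 0 < v by rewrite -p0v; apply: pending_level_gt0 (state_pending sok p0l).
have B0 : 0 < B by rewrite /B; lra.
have Ec : candidates_of st = [::] by rewrite /candidates_of Es.
have U0 : 0 <= unit_cost by have : 0 <= g%:R :> R by []; rewrite /unit_cost; lra.
have pe := state_pending sok.
pose cands := [seq p <- pendings st | plevel p <= B].
pose nc p := (B < pbase p * (size cands)%:R) && ~~ serves (cheap_elements i B) (prq p).
have Es' : candidates_of st' = [seq pay_upgrade B u p | p <- cands & nc p] by [].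
have cl p : p \in cands -> p \in pendings st by rewrite mem_filter => /andP[].
have Ep (F : pending i -> R) : \sum_(p <- pendings st) F p =
    \sum_(p <- pendings st | B < plevel p) F p + \sum_(p <- cands) F p.
  rewrite big_filter (bigID (fun p => B < plevel p)) /=; congr (_ + _).
  by apply: eq_bigl => p; rewrite leNgt.
exists [seq prq p | p <- cands & ~~ nc p]; split.
- rewrite /active Q0 Ec Es' /= cats0 map_cat -map_comp.
  rewrite (_ : @prq _ _ i \o @pay_upgrade _ _ i _ _ = @prq _ _ i) //; apply/permP => a.
  have /permP/(_ a) := perm_filter_map (@prq _ _ i) nc cands.
  have /permP/(_ a) := perm_filter_map (@prq _ _ i) (fun p => B < plevel p) (pendings st).
  rewrite (_ : [seq p <- pendings st | ~~ (B < plevel p)] = cands); last first.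
    by apply: eq_filter => p; rewrite -leNgt.
  by rewrite !count_cat => -> ->; rewrite addnA.
- move=> q /mapP[p]; rewrite mem_filter => /andP[pnc pc] ->.
  split; first exact: pending_release (pe _ (cl _ pc)).
  rewrite /=; move: pnc; rewrite negb_and negbK => /orP[|->//].
  rewrite -leNgt => cheap; apply/orP; right; rewrite has_map; apply/hasP; exists p.
    by rewrite mem_filter cheap.
  exact: pending_serves (pe _ (cl _ pc)).
- have cE : set_cost (decode i (cheap_elements i B)) <= B.
    rewrite decode_cheap_elements /set_cost.
    case: (posnP (nelem i)) => n0.
      by rewrite big1 ?ltW // => -[e lt]; exfalso; rewrite n0 in lt.
    have n0' : 0 < (nelem i)%:R :> R by rewrite ltr0n.
    apply: le_trans (_ : \sum_(e : 'I_(nelem i)) B / (nelem i)%:R <= _).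
      rewrite big_mkcond; apply: ler_sum => e _; rewrite inE; case: ifP => [?|_].
        by rewrite ler_pdivlMr.
      by rewrite divr_ge0 // ltW.
    by rewrite sumr_const card_ord -[X in X <= _]mulr_natr divfK // gt_eqF.
  have cC : \sum_(p <- cands | pbase p * (size cands)%:R <= B) set_cost (decode i (psol p))
      <= g%:R * B.
    case: (posnP (size cands)) => [/size0nil ->|n0].
      by rewrite big_nil mulr_ge0 // ltW.
    have n0' : 0 < (size cands)%:R :> R by rewrite ltr0n.
    apply: le_trans (_ : \sum_(p <- cands) g%:R * (B / (size cands)%:R) <= _).
      rewrite big_mkcond; apply: ler_sum_seq => p pc; case: ifP => [cheap|_].
        by rewrite (pending_cost (pe _ (cl _ pc))) ler_wpM2l // ler_pdivlMr.
      by rewrite mulr_ge0 // divr_ge0 // ltW.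
    by rewrite sumr_const_seq mulrCA [_ * (B / _)]mulrC divfK // gt_eqF.
  rewrite /potential Q0 Ec Es Es' /= cats0 !big_cat /= big_cons.
  rewrite !big_map !big_filter !Ep /= -/cands.
  have -> : \sum_(S <- offline) (9 * L * set_cost S.2 - (charged H S +
      (if chargeable H u B S then Num.min (set_cost S.2) B else 0))) =
    \sum_(S <- offline) (9 * L * set_cost S.2 - charged H S) -
    \sum_(S <- offline) (if chargeable H u B S then Num.min (set_cost S.2) B else 0).
    by rewrite -sumrB; apply: eq_bigr => S _; lra.
  have eA : \sum_(C <- A) C.2 = \sum_(C <- A | C.1.1 <= B) C.2 +
      \sum_(C <- A | B < C.1.1) C.2.
    rewrite (bigID (fun C => C.1.1 <= B)) /=; congr (_ + _).
    by apply: eq_bigl => C; rewrite -ltNge.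
  have sl : \sum_(p <- cands) gain u p + \sum_(p <- cands | nc p) slack (pay_upgrade B u p)
      <= \sum_(p <- cands) slack p.
    have -> : \sum_(p <- cands) slack p = \sum_(p <- cands) gain u p
       + \sum_(p <- cands) slack (pay_upgrade B u p).
      by rewrite -big_split /=; apply: eq_bigr => p _; apply: (slack_pay u p).
    rewrite lerD2l [leRHS](sum_filterC nc) lerDl.
    by apply: sumr_ge0 => p _; apply: slack_ge0.
  have re : \sum_(p <- cands) residual u p <= 2 * B.
    by rewrite big_filter; apply: (state_residual sok B0).
  have pd : \sum_(p <- cands | ~~ nc p) delay (prq p) u +
      \sum_(p <- cands | nc p) raised u p <=
      \sum_(p <- cands) ppaid p + \sum_(p <- cands) residual u p.
    rewrite -big_split /= [leRHS](sum_filterC nc) addrC; apply: lerD.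
      by apply: ler_sum => p _; rewrite /residual; lra.
    by apply: ler_sum => p _; rewrite /residual addrC subrK /raised le_max lexx orbT.
  have eg : \sum_(p <- pendings st | plevel p <= B) gain u p = \sum_(p <- cands) gain u p.
    by rewrite big_filter.
  rewrite eg in key.
  have key' := ler_wpM2l U0 key; have sl' := ler_wpM2l U0 sl.
  rewrite eA; rewrite /unit_cost in key' sl' U0 *.
  by lra.
- case: (ok) => a1 a2 a3 a4 a5 a6 a7 a8; split => //=.
  + by move=> h; rewrite inE => /predU1P[->|/a1].
  + by move=> h; rewrite inE => /predU1P[->|/a2].
  + move=> p; rewrite Es' mem_cat => /orP[|].
      rewrite mem_filter => /andP[pB pl] h; rewrite inE => /predU1P[-> /=|hH]; first by lra.
      by apply: a4; rewrite ?mem_cat ?pl.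
    case/mapP => p'; rewrite mem_filter => /andP[_]; rewrite mem_filter => /andP[pB pl] -> h.
    rewrite inE => /predU1P[-> /=|hH /= Bh]; first by rewrite ltxx.
    by apply: a4 hH _; [rewrite mem_cat pl|apply: le_lt_trans pB Bh].
  + have offp p : p \in pendings st -> offline_serves (prq p).
      by move=> pl; apply: a5; rewrite /active !mem_cat map_f ?orbT // mem_cat pl.
    move=> q; rewrite /active Es' /= map_cat !mem_cat => /orP[/orP[]|qf].
    * by case/mapP => p; rewrite mem_filter => /andP[_ pl] ->; apply: offp.
    * case/mapP => p /mapP[p']; rewrite mem_filter => /andP[_ /cl pl] -> ->.
      exact: (offp p' pl).
    * by apply: a5; rewrite mem_cat qf orbT.
  + move=> p; rewrite mem_filter => /andP[pB /a6[|[C [CA C1 C2]]]]; first by left.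
    by right; exists C; rewrite mem_filter C1 pB.
  (* The new service has a budget below [B'], so it hides no transmission from a certificate of
     budget [B']. *)
  + move=> C; rewrite mem_filter => /andP[BC /a7]; case: C BC => -[B' t] Y /= BB'.
    rewrite /certified => /le_trans; apply; rewrite lerD2r.
    rewrite big_mkcond [leRHS]big_mkcond; apply: ler_sum => S _.
    by rewrite /= [B' < B]ltNge (ltW BB').
  + by move=> C; rewrite mem_filter => /andP[_ /a8].
Qed.

Lemma account_busy u st future H A out :
  state_ok g k u st future -> good_solution g st out -> ~~ idle st u ->
  accounts_ok u st future H A -> exists H' A',
  paid_for u st (step g u st out).1.1 future (step g u st out).2 H A H' A'.
Proof.
move=> sok gs; rewrite /idle => + ok.
case Eq : (queue st) => [|[q n] qs] /=; last first.
  by move=> _; exists H, A; apply: account_queue Eq sok gs ok.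
case Es : (serving st) => [s|] /=.
  move=> _; rewrite /step Eq Es; case: ifP => [ge|/negbT].
    by eexists _, _; apply: account_finish Eq Es sok gs ok ge.
  rewrite -ltNge => lt; case Ea : (next_time _ _ _) => [a|].
    by exists H, A; apply: account_look Eq Es ok.
  exists H, A; apply: (account_all_served Eq Es sok ok lt).
  have := @next_timeP _ _ _ (size (candidates s)) (ahead s)
     [seq p <- candidates s | ~~ serves out (prq p)].
  rewrite Ea; apply => p; rewrite mem_filter => /andP[_ pc].
  have := state_service sok; rewrite Es => se; split.
    exact: le_trans (pending_release (service_pending se pc)) (service_ahead se).
  rewrite divr_gt0 ?(pending_level_gt0 (service_pending se pc)) // ltr0n.
  by case: (candidates s) pc.
case Ev : (critical_level _ _) => [v|] //= _.
rewrite /step Eq Es Ev; eexists _, _; exact: account_start Eq Es sok ok Ev.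
Qed.

Lemma account_advance u st future u' n H A :
  idle st u -> u < u' -> accounts_ok u st future H A ->
  (forall q, q \in future -> u' <= release q) ->
  let new := [seq q <- future | release q <= u'] in
  let rest := [seq q <- future | u' < release q] in
  [/\ perm_eq (active st ++ future) (active (enqueue n st new) ++ rest),
    potential (enqueue n st new) rest H A = potential st future H A &
    accounts_ok u' (enqueue n st new) rest H A].
Proof.
case: st => -[|//] pe [//|] /and3P[_ _ _] uu' ok fu new rest.
have perm : perm_eq future (new ++ rest).
  rewrite perm_sym (_ : rest = [seq q <- future | ~~ (release q <= u')]); last first.
    by apply: eq_filter => q; rewrite ltNge.
  by rewrite perm_filterC.
have E : [seq a.1 | a <- zip new (iota n (size new))] = new.
  by rewrite -/(unzip1 _) unzip1_zip // size_iota.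
split.
- rewrite /active /= E !cats0; apply/permP => a.
  by have /permP/(_ a) := perm; rewrite !count_cat => ->; lia.
- rewrite /potential /= E.
  by rewrite [in RHS](perm_big _ perm) [\sum_(q <- future) delay _ _](perm_big _ perm).
case: (ok) => a1 a2 a3 a4 a5 a6 a7 a8; split => //=.
- by move=> h /a1 /le_trans; apply; apply: ltW.
- by move=> _ h /a1 /le_lt_trans; apply.
- move=> q; rewrite /active /= E cats0 => ql; apply: a5; move: ql.
  by rewrite /active /= cats0 !mem_cat (perm_mem perm) mem_cat; do ![case: (q \in _)].
Qed.

End CompetitiveRatio.

(** * The program *)

(* A pending request is encoded as (index, (code, (solution, (base, (level,
   paid))))). *)
Definition eidx e := EHead e.
Definition ecode e := EHead (ETail e).
Definition esol e := EHead (ETail (ETail e)).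
Definition ebase e := EHead (ETail (ETail (ETail e))).
Definition elevel e := EHead (ETail (ETail (ETail (ETail e)))).
Definition epaid e := ETail (ETail (ETail (ETail (ETail e)))).
Definition epending idx code sol base level paid :=
  ECons idx (ECons code (ECons sol (ECons base (ECons level paid)))).

Definition arg := EVar 0.

(* Components of the argument (element, (accumulator, env)) of a loop body. *)
Definition elt := EHead arg.
Definition acc := EHead (ETail arg).
Definition env := ETail (ETail arg).

Definition p_raised : fn online_op :=
  FLet (FAsk AskDelay (ECons (eidx (EHead arg)) (ETail arg)))
  (FIf (ELe (epaid (EHead arg)) (EVar 1)) (FExp (EVar 1)) (FExp (epaid (EHead arg)))).

Definition p_residual : fn online_op :=
  FLet (FCall p_raised arg) (FExp (ESub (EVar 1) (epaid (EHead arg)))).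

Definition p_residual_sum : fn online_op :=
  FFold 0 (EHead arg) (ENat 0) (ETail arg)
    (FIf (ELe (elevel elt) (ETail env))
      (FLet (FCall p_residual (ECons elt (EHead env)))
        (FExp (EAdd (EVar 1) acc)))
      (FExp acc)).

Definition p_critical : fn online_op :=
  FFold 0 (EHead arg) ENil arg
    (FLet (FCall p_residual_sum (ECons (EHead env) (ECons (ETail env) (elevel elt))))
    (FIf (ELe (elevel elt) (EVar 1))
       (FIf acc (FIf (ELe (elevel elt) acc) (FExp (elevel elt)) (FExp acc))
         (FExp (elevel elt)))
       (FExp acc))).

Definition p_next_time : fn online_op :=
  FFold 0 (EHead arg) ENil (ETail arg)
    (FLet (FCall p_raised (ECons elt (EHead env)))
    (FLet (FAsk AskDelayInv (ECons (eidx elt)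
             (EAdd (EVar 1) (EDiv (elevel elt) (ETail env)))))
    (FIf acc (FIf (ELe (EVar 2) acc) (FExp (EVar 2)) (FExp acc)) (FExp (EVar 2))))).

Definition p_length : fn online_op :=
  FFold 0 arg (ENat 0) ENil (FExp (EAdd (ENat 1) acc)).

Definition p_sum : fn online_op :=
  FFold 0 arg (ENat 0) ENil (FExp (EAdd elt acc)).

(** Costs come without indices and the fold runs from the last one, so the accumulator carries a
    counter that descends from the number of elements. *)
Definition p_cheap : fn online_op :=
  FLet (FCall p_length (EHead arg))
  (FLet (FFold 0 (EHead arg) (ECons (EVar 1) ENil) (ECons (EVar 1) (ETail arg))
     (FIf (ELe (EMul elt (EHead env)) (ETail env))
       (FExp (ECons (ESub (EHead acc) (ENat 1))
                (ECons (ESub (EHead acc) (ENat 1)) (ETail acc))))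
       (FExp (ECons (ESub (EHead acc) (ENat 1)) (ETail acc)))))
  (FExp (ETail (EVar 2)))).

(** Label 1 is reserved for the length of an answer, which depends on the running time of the
    prize-collecting program; all other lists fall under label 0. *)
Definition p_mem : fn online_op :=
  FFold 1 (ETail arg) ENil (EHead arg)
    (FIf (ELe elt env) (FIf (ELe env elt) (FExp (ENat 1)) (FExp acc)) (FExp acc)).

Definition p_cost : fn online_op :=
  FLet (FCall p_length (EHead arg))
  (FLet (FFold 0 (EHead arg) (ECons (EVar 1) (ENat 0)) (ETail arg)
     (FLet (FCall p_mem (ECons (ESub (EHead acc) (ENat 1)) env))
     (FIf (EVar 1)
       (FExp (ECons (ESub (EHead acc) (ENat 1)) (EAdd elt (ETail acc))))
       (FExp (ECons (ESub (EHead acc) (ENat 1)) (ETail acc))))))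
  (FExp (ETail (EVar 2)))).

(* The input is (instance, (time, (new codes, memory))); the result has the
   form (instance, (time, (number of released requests, (queue, (pendings,
   service))))). *)
Definition p_enqueue : fn online_op :=
  let new := EHead (ETail (ETail arg)) in
  let mem := ETail (ETail (ETail arg)) in
  let count := EHead (EVar 1) in
  FLet (FIf mem (FExp mem) (FExp (ECons (ENat 0) (ECons ENil (ECons ENil ENil)))))
  (FLet (FCall p_length new)
  (FLet (FFold 0 new (ECons (EAdd count (EVar 2)) ENil) ENil
     (FExp (ECons (ESub (EHead acc) (ENat 1))
       (ECons (ECons (ESub (EHead acc) (ENat 1)) elt) (ETail acc)))))
  (FLet (FFold 0 (EHead (ETail (EVar 1))) (ETail (EVar 3)) ENil (FExp (ECons elt acc)))
  (FExp (ECons (EHead arg) (ECons (EHead (ETail arg)) (ECons (EAdd count (EVar 2))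
     (ECons (EVar 4) (ETail (ETail (EVar 1))))))))))).

Definition x_inst e := EHead e.
Definition x_costs e := ETail (EHead e).
Definition x_time e := EHead (ETail e).
Definition x_count e := EHead (ETail (ETail e)).
Definition x_queue e := EHead (ETail (ETail (ETail e))).
Definition x_pendings e := EHead (ETail (ETail (ETail (ETail e)))).
Definition x_service e := ETail (ETail (ETail (ETail (ETail e)))).
Definition s_budget e := EHead e.
Definition s_ahead e := EHead (ETail e).
Definition s_last e := EHead (ETail (ETail e)).
Definition s_cands e := ETail (ETail (ETail e)).

Definition p_pc (g : nat) : fn online_op :=
  FIf (x_queue arg)
    (FLet (FCall p_sum (x_costs arg))
    (FExp (ECons (x_inst arg) (ECons (ECons (ETail (EHead (x_queue arg)))
        (EAdd (EMul (ENat g) (EVar 1)) (ENat 1))) ENil))))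
  (FIf (x_service arg)
    (FLet (FFold 0 (s_cands (x_service arg)) ENil (s_ahead (x_service arg))
       (FLet (FCall p_residual (ECons elt env))
         (FExp (ECons (ECons (ecode elt) (EVar 1)) acc))))
    (FExp (ECons (x_inst arg) (EVar 1))))
    (FExp (ECons (x_inst arg) ENil))).

(* In the programs below variable 0 holds (ctx, (out, cost)), with ctx as returned
   by [p_enqueue], out the last answer of the prize-collecting algorithm and
   cost its cost.  A comment [n] on a line is the variable bound there. *)
Definition ctx := EHead arg.
Definition out := EHead (ETail arg).
Definition cost_out := ETail (ETail arg).

Definition answer queue pend serv alarm trans : expr :=
  ECons (ECons (x_count ctx) (ECons queue (ECons pend serv))) (ECons alarm trans).

Definition p_step_queue (g : nat) : fn online_op :=
  let q := EHead (x_queue ctx) in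
  let qs := ETail (x_queue ctx) in
  FLet (FAsk AskSat (ECons (ETail q) out))
  (FIf (EVar 1)
    (FIf (ELe cost_out (ENat 0))
      (FExp (answer qs (x_pendings ctx) (x_service ctx) (x_time ctx) (ECons out ENil)))
      (FLet (FAsk AskDelay (ECons (EHead q) (x_time ctx)))
      (FExp (answer qs (ECons
          (epending (EHead q) (ETail q) out (EDiv cost_out (ENat g))
             (EDiv cost_out (ENat g)) (EVar 2)) (x_pendings ctx))
        (x_service ctx) (x_time ctx) ENil))))
    (FExp (answer qs (x_pendings ctx) (x_service ctx) (x_time ctx) ENil))).

Definition p_unserved : fn online_op :=
  FFold 0 (EHead arg) ENil (ETail arg)
    (FLet (FAsk AskSat (ECons (ecode elt) env))
    (FIf (EVar 1) (FExp acc) (FExp (ECons elt acc)))).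

Definition p_pc_cost : fn online_op :=
  FFold 0 (EHead arg) (ENat 0) (ETail arg)
    (FLet (FAsk AskSat (ECons (ecode elt) (ETail env)))
    (FIf (EVar 1) (FExp acc)
      (FLet (FCall p_residual (ECons elt (EHead env)))
        (FExp (EAdd (EVar 2) acc))))).

Definition p_pay_all : fn online_op :=
  FFold 0 (EHead arg) (EHead (ETail arg)) (ETail (ETail arg))
    (FLet (FCall p_raised (ECons elt env))
    (FExp (ECons (epending (eidx elt) (ecode elt) (esol elt) (ebase elt)
       (elevel elt) (EVar 1)) acc))).

Definition p_step_service (g : nat) : fn online_op :=
  let s := x_service ctx in
  FLet (FCall p_pc_cost (ECons (s_cands s) (ECons (s_ahead s) out))) (* 1 *)
  (FIf (ELe (EMul (ENat g) (s_budget s)) (EAdd cost_out (EVar 1)))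
    (FLet (FCall p_unserved (ECons (s_cands s) (s_last s))) (* 2 *)
    (FLet (FCall p_pay_all (ECons (EVar 2) (ECons (x_pendings ctx) (s_ahead s))))
    (FExp (answer ENil (EVar 3) ENil (x_time ctx) (ECons (s_last s) ENil)))))
  (FLet (FCall p_unserved (ECons (s_cands s) out)) (* 2 *)
  (FLet (FCall p_length (s_cands s)) (* 3 *)
  (FLet (FCall p_next_time (ECons (EVar 2) (ECons (s_ahead s) (EVar 3)))) (* 4 *)
  (FIf (EVar 4)
    (FExp (answer ENil (x_pendings ctx)
       (ECons (s_budget s) (ECons (EVar 4) (ECons out (s_cands s)))) (x_time ctx) ENil))
    (FExp (answer ENil (x_pendings ctx) ENil (x_time ctx) (ECons out ENil)))))))).

Definition p_filter_le : fn online_op :=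
  FFold 0 (EHead arg) ENil (ETail arg)
    (FIf (ELe (elevel elt) env) (FExp (ECons elt acc)) (FExp acc)).

Definition p_filter_gt : fn online_op :=
  FFold 0 (EHead arg) ENil (ETail arg)
    (FIf (ELe (elevel elt) env) (FExp acc) (FExp (ECons elt acc))).

Definition p_cheap_sols : fn online_op :=
  FFold 0 (EHead arg) (EHead (ETail arg)) (ETail (ETail arg))
    (FIf (ELe (EMul (ebase elt) (EHead env)) (ETail env))
      (FExp (ECons (esol elt) acc)) (FExp acc)).

(* The argument is (candidates, ((number, budget), (cheap elements, time))). *)
Definition p_hard : fn online_op :=
  FFold 0 (EHead arg) ENil (ETail arg)
    (FIf (ELe (EMul (ebase elt) (EHead (EHead env))) (ETail (EHead env)))
      (FExp acc)
      (FLet (FAsk AskSat (ECons (ecode elt) (EHead (ETail env))))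
      (FIf (EVar 1) (FExp acc)
        (FLet (FCall p_raised (ECons elt (ETail (ETail env))))
        (FExp (ECons (epending (eidx elt) (ecode elt) (esol elt) (ebase elt)
           (ETail (EHead env)) (EVar 2)) acc)))))).

Definition p_step_idle : fn online_op :=
  FLet (FCall p_critical (ECons (x_pendings ctx) (x_time ctx))) (* 1 *)
  (FIf (EVar 1)
    (FLet (FExp (EMul (ENat 2) (EVar 1))) (* 2 *)
    (FLet (FCall p_filter_le (ECons (x_pendings ctx) (EVar 2))) (* 3 *)
    (FLet (FCall p_length (EVar 3)) (* 4 *)
    (FLet (FCall p_cheap (ECons (x_costs ctx) (EVar 2))) (* 5 *)
    (FLet (FCall p_cheap_sols (ECons (EVar 3) (ECons ENil (ECons (EVar 4) (EVar 2))))) (* 6 *)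
    (FLet (FCall p_hard (ECons (EVar 3) (ECons (ECons (EVar 4) (EVar 2))
              (ECons (EVar 5) (x_time ctx))))) (* 7 *)
    (FLet (FCall p_filter_gt (ECons (x_pendings ctx) (EVar 2))) (* 8 *)
    (FExp (answer ENil (EVar 8)
       (ECons (EVar 2) (ECons (x_time ctx) (ECons ENil (EVar 7))))
       (x_time ctx) (ECons (EVar 5) (EVar 6)))))))))))
    (FLet (FCall p_length (x_pendings ctx)) (* 2 *)
    (FLet (FCall p_next_time (ECons (x_pendings ctx) (ECons (x_time ctx) (EVar 2)))) (* 3 *)
    (FExp (answer (x_queue ctx) (x_pendings ctx) (x_service ctx) (EVar 3) ENil))))).

Definition p_step (g : nat) : fn online_op :=
  FIf (x_queue ctx) (FCall (p_step_queue g) arg)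
  (FIf (x_service ctx) (FCall (p_step_service g) arg) (FCall p_step_idle arg)).

Lemma closed_p_enqueue : closed_fn 1 p_enqueue. Proof. by []. Qed.
Lemma closed_p_pc g : closed_fn 1 (p_pc g). Proof. by []. Qed.
Lemma closed_p_cost : closed_fn 1 p_cost. Proof. by []. Qed.
Lemma closed_p_step g : closed_fn 1 (p_step g). Proof. by []. Qed.

(** Linearity in [L 1] matters: it makes the time of an event affine in the random time of the
    prize-collecting run, whose mean alone is controlled. *)
Lemma time_bound_p_cost L :
  (time_bound L p_cost <= 100 * (L 0 + 1) * (L 1 + 1))%N.
Proof. by rewrite /=; nia. Qed.

(** * Encodings of states and answers of the oracles *)

Section Encoding.
Variables (R : realType) (ND : nd_class R) (i : instance ND).
Implicit Types (t u B : R) (p : pending i) (q : delay_request i).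

Definition enc_pending p : data R :=
  DCons (DReal (pidx p)%:R) (DCons (request_code (req (prq p)))
   (DCons (psol p) (DCons (DReal (pbase p)) (DCons (DReal (plevel p))
     (DReal (ppaid p)))))).

Definition enc_pendings (l : seq (pending i)) := dlist [seq enc_pending p | p <- l].

Definition enc_queued (a : delay_request i * nat) : data R :=
  DCons (DReal a.2%:R) (request_code (req a.1)).

Definition enc_service (s : option (service i)) : data R :=
  if s is Some s then DCons (DReal (budget s)) (DCons (DReal (ahead s))
     (DCons (last_sol s) (enc_pendings (candidates s))))
  else DNil.

Definition enc_state (n : nat) (st : state i) : data R :=
  DCons (DReal n%:R) (DCons (dlist [seq enc_queued a | a <- queue st])
    (DCons (enc_pendings (pendings st)) (enc_service (serving st)))).

Definition enc_option (a : option R) : data R :=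
  if a is Some x then DReal x else DNil.

Definition enc_context t n st : data R :=
  DCons (instance_data i) (DCons (DReal t) (enc_state n st)).

End Encoding.

Lemma undlist_dlist (R : realType) (l : seq (data R)) : undlist (dlist l) = l.
Proof. by elim: l => //= d l ->. Qed.

Section OracleFacts.
Variables (R : realType) (ND : nd_class R) (i : instance ND).
Variable released : seq (delay_request i).
Implicit Types (t u y : R) (q : delay_request i).

Definition known u q (n : nat) : bool :=
  (onth released n == Some q) && (release q <= u).

Lemma lookup_known u q n : known u q n -> lookup released (DReal n%:R) = Some q.
Proof.
move=> /andP[/eqP H _].
by rewrite /lookup Num.Theory.natr_nat Num.Theory.natrK.
Qed.

Lemma online_oracle_delay u t q n : known u q n -> u <= t ->
  online_oracle released AskDelay (DCons (DReal n%:R) (DReal t)) = DReal (delay q t).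
Proof.
move=> kn ut; rewrite /online_oracle [dhead _]/= (lookup_known kn) /=.
by case/andP: kn => _ /le_trans -> .
Qed.

Lemma online_oracle_delay_inv u y q n : known u q n ->
  online_oracle released AskDelayInv (DCons (DReal n%:R) (DReal y)) =
    DReal (delay_inv q y).
Proof. by move=> kn; rewrite /online_oracle [dhead _]/= (lookup_known kn). Qed.

Lemma sat_oracleE q (d : data R) :
  sat_oracle i (DCons (request_code (req q)) d) = dbool R (serves d q).
Proof.
rewrite /sat_oracle /=; congr dbool; apply/asboolP/idP => [[q' E H]|H].
  by rewrite /serves (request_code_inj E).
by exists (req q).
Qed.

End OracleFacts.

(** * The programs compute the abstract algorithm, with short loops *)

Section Specifications.
Variables (R : realType) (ND : nd_class R) (i : instance ND).
Implicit Types (t u B : R) (p : pending i) (q : delay_request i) (st : state i).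
Variables (now : R) (O : online_op -> data R -> data R).
Variable known : delay_request i -> nat -> bool.
Hypothesis ask_delay : forall q n t, known q n -> now <= t ->
  O AskDelay (DCons (DReal n%:R) (DReal t)) = DReal (delay q t).
Hypothesis ask_delay_inv : forall q n y, known q n ->
  O AskDelayInv (DCons (DReal n%:R) (DReal y)) = DReal (delay_inv q y).
Hypothesis ask_sat : forall q d,
  O AskSat (DCons (request_code (req q)) d) = dbool R (serves d q).

Notation enc := (@enc_pending _ _ i).
Notation encs := (@enc_pendings _ _ i).
Notation known_all := (all (fun p => known (prq p) (pidx p))).

Lemma dfunE f d : den O 1 f (init_store d) = dfun O f d. Proof. by []. Qed.

Lemma init_store0 (d : data R) : init_store d 0 = d. Proof. by []. Qed.

Lemma update_lt (s : store R) x y d : (y < x)%N -> update s x d y = s y.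
Proof. by move=> yx; rewrite update_neq // ltn_eqF. Qed.

Variable L : nat -> nat.
Definition loops f d : Prop := short_loops O L 1 f (init_store d).

Ltac ev := rewrite ?dfunE ?(updateE, init_store0, update_lt) /= ?truthy_dbool //.

Lemma p_raisedE t p : known (prq p) (pidx p) -> now <= t ->
  dfun O p_raised (DCons (enc p) (DReal t)) = DReal (raised t p).
Proof.
move=> kn nt; rewrite -dfunE /p_raised /=; ev.
rewrite (ask_delay kn nt) /= truthy_dbool /raised.
by case: leP.
Qed.

Lemma loops_raised d : loops p_raised d.
Proof. by rewrite /loops /=; split => //; case: ifP. Qed.
(* Sealed, as is each later subroutine once its needed facts are proved, so that simplification
   stops at calls. *)
Opaque p_raised.

Lemma p_residualE t p : known (prq p) (pidx p) -> now <= t ->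
  dfun O p_residual (DCons (enc p) (DReal t)) = DReal (residual t p).
Proof.
move=> kn nt; rewrite -dfunE /p_residual /=; ev.
by rewrite p_raisedE.
Qed.

Lemma loops_residual d : loops p_residual d.
Proof. by rewrite /loops /=; split => //; apply: loops_raised. Qed.
Opaque p_residual.

Lemma p_lengthE (l : seq (data R)) : dfun O p_length (dlist l) = DReal (size l)%:R.
Proof.
rewrite -dfunE /p_length /=; ev; rewrite undlist_dlist.
by elim: l => //= d l ->; rewrite /= -natrD.
Qed.

Lemma loops_length d : (size (undlist d) <= L 0)%N -> loops p_length d.
Proof. by rewrite /loops /=; split. Qed.
Opaque p_length.

Lemma p_sumE (T : Type) (l : seq T) (F : T -> R) :
  dfun O p_sum (dlist [seq DReal (F a) | a <- l]) = DReal (\sum_(a <- l) F a).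
Proof.
rewrite -dfunE /p_sum /=; ev; rewrite undlist_dlist.
by elim: l => [|a l] /=; rewrite ?big_nil // big_cons => ->.
Qed.

Opaque p_sum.

Lemma p_residual_sumE l t x : known_all l -> now <= t ->
  dfun O p_residual_sum (DCons (encs l) (DCons (DReal t) (DReal x))) =
    DReal (residual_sum l t x).
Proof.
move=> kn nt; rewrite -dfunE /p_residual_sum /=; ev; rewrite undlist_dlist /residual_sum.
elim: l kn => [|p l IH] /=; first by rewrite big_nil.
case/andP=> kp /IH {}IH; rewrite big_cons truthy_dbool IH.
case: ifP => // _; ev; by rewrite p_residualE.
Qed.

Lemma loops_residual_sum d : (size (undlist (dhead d)) <= L 0)%N -> loops p_residual_sum d.
Proof.
rewrite /loops /p_residual_sum /= => Hd; split => // x acc; case: ifP => // _; split => //; exact: loops_residual.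
Qed.
Opaque p_residual_sum.

Lemma p_criticalE l t : known_all l -> now <= t ->
  dfun O p_critical (DCons (encs l) (DReal t)) = enc_option (critical_level l t).
Proof.
move=> kn nt; rewrite -dfunE /p_critical /=; ev; rewrite undlist_dlist /critical_level.
have sumE p : dfun O p_residual_sum (DCons (encs l) (DCons (DReal t) (DReal (plevel p))))
   = DReal (residual_sum l t (plevel p)) by apply: p_residual_sumE.
move: (encs l) (residual_sum l t) sumE => E G sumE.
elim: l {kn} => [|p l IH] //=; rewrite IH {IH}; ev; rewrite sumE /= truthy_dbool.
case: ifP => // _; case: (foldr _ _ _) => [v|] //=.
by rewrite truthy_dbool; case: ifP.
Qed.

Lemma loops_critical d : (size (undlist (dhead d)) <= L 0)%N -> loops p_critical d.
Proof.
rewrite /loops /p_critical /= => Hd; split => // x acc; split; first exact: loops_residual_sum.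
by do 3 case: ifP => // _.
Qed.
Opaque p_critical.

Lemma p_next_timeE l n t : known_all l -> now <= t ->
  dfun O p_next_time (DCons (encs l) (DCons (DReal t) (DReal n%:R))) =
    enc_option (next_time n t l).
Proof.
move=> kn nt; rewrite -dfunE /p_next_time /=; ev; rewrite undlist_dlist /next_time.
elim: l kn => [|p l IH] //= /andP[kp /IH {}IH]; rewrite IH {IH}; ev.
rewrite p_raisedE //= (ask_delay_inv _ kp); case: (foldr _ _ _) => [v|] //=.
by rewrite truthy_dbool; case: ifP.
Qed.

Lemma loops_next_time d : (size (undlist (dhead d)) <= L 0)%N -> loops p_next_time d.
Proof.
rewrite /loops /p_next_time /= => Hd; split => // x acc; split; first exact: loops_raised.
by split => //; do 2 case: ifP => // _.
Qed.
Opaque p_next_time.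

Lemma predrN (j : nat) : (j.+1)%:R - 1%:R = j%:R :> R.
Proof. by rewrite -natrB // subSS subn0. Qed.

Lemma p_cheapE B : dfun O p_cheap
   (DCons (dlist [seq DReal (cost e) | e <- enum 'I_(nelem i)]) (DReal B)) =
  cheap_elements i B.
Proof.
rewrite -dfunE /p_cheap /=; ev; rewrite p_lengthE undlist_dlist size_map size_enum_ord.
rewrite /cheap_elements; set m := nelem i.
(* Generalised to the suffix of the elements from index [j] on, for which the counter has come down
   to [j]. *)
suff H (l : seq 'I_m) j : map val l = iota j (size l) -> (j + size l)%N = m ->
   foldr (fun x acc : data R => if truthy (dop (fun a b => dbool R (a <= b))
       (dop (fun a b => DReal (a * b)) x (DReal m%:R)) (DReal B))
     then DCons (dop (fun a b => DReal (a - b)) (dhead acc) (DReal 1%:R))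
       (DCons (dop (fun a b => DReal (a - b)) (dhead acc) (DReal 1%:R)) (dtail acc))
     else DCons (dop (fun a b => DReal (a - b)) (dhead acc) (DReal 1%:R)) (dtail acc))
    (DCons (DReal m%:R) DNil) [seq DReal (cost e) | e <- l] =
   DCons (DReal j%:R) (dlist [seq DReal (nat_of_ord e)%:R | e <- l & cost e * m%:R <= B]).
  by rewrite (H _ 0%N) ?val_enum_ord ?size_enum_ord.
elim: l j => [|e l IH] j /=; first by rewrite addn0 => _ ->.
move=> [ej /IH H1]; rewrite -addSnnS => /H1 ->.
by rewrite /= truthy_dbool predrN; case: ifP => //= _; rewrite ej.
Qed.

Lemma loops_cheap d : (size (undlist (dhead d)) <= L 0)%N -> loops p_cheap d.
Proof.
rewrite /loops /p_cheap /= => Hd; split; first exact: loops_length.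
by split => //; split => // x acc; case: ifP.
Qed.
Opaque p_cheap.

Lemma p_memE x d : truthy (dfun O p_mem (DCons (DReal x) d)) =
  has (fun a => if a is DReal y then y == x else false) (undlist d).
Proof.
rewrite -dfunE /p_mem /=; ev; elim: (undlist d) => //= a l IH.
case: a => [|y|? ?] //=; rewrite !truthy_dbool eq_le.
by case: ifP => //= _; case: ifP.
Qed.

Lemma loops_mem d : (size (undlist (dtail d)) <= L 1)%N -> loops p_mem d.
Proof.
by rewrite /loops /=; split => // x acc; do 2 case: ifP => // _.
Qed.
Opaque p_mem.

Lemma p_costE d : dfun O p_cost
   (DCons (dlist [seq DReal (cost e) | e <- enum 'I_(nelem i)]) d) =
  DReal (set_cost (decode i d)).
Proof.
rewrite -dfunE /p_cost /=; ev; rewrite p_lengthE undlist_dlist size_map size_enum_ord.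
have -> : set_cost (decode i d) = \sum_(e <- enum 'I_(nelem i) | e \in decode i d) cost e.
  by rewrite big_enum_cond.
set m := nelem i.
set F := (fun x acc : data R => _).
suff H (l : seq 'I_m) j : map val l = iota j (size l) -> (j + size l)%N = m ->
   foldr F (DCons (DReal m%:R) (DReal 0%:R)) [seq DReal (cost e) | e <- l] =
   DCons (DReal j%:R) (DReal (\sum_(e <- l | e \in decode i d) cost e)).
  by rewrite (H _ 0%N) ?val_enum_ord ?size_enum_ord.
elim: l j => [|e l IH] j /=; first by rewrite addn0 big_nil => _ ->.
move=> [ej /IH H1]; rewrite -addSnnS => /H1 ->.
rewrite /F; ev; rewrite predrN p_memE big_cons inE ej.
by case: ifP => //= _.
Qed.

Lemma loops_cost d : (size (undlist (dhead d)) <= L 0)%N ->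
  (size (undlist (dtail d)) <= L 1)%N -> loops p_cost d.
Proof.
rewrite /loops /p_cost /= => H0 H1; split; first exact: loops_length.
split => //; split => // x acc; split; first exact: loops_mem.
by case: ifP.
Qed.
Opaque p_cost.

Lemma p_unservedE l d : dfun O p_unserved (DCons (encs l) d) =
  encs [seq p <- l | ~~ serves d (prq p)].
Proof.
rewrite -dfunE /p_unserved /=; ev; rewrite undlist_dlist /enc_pendings.
elim: l => [|p l IH] //=; rewrite IH; ev; rewrite ask_sat truthy_dbool.
by case: ifP.
Qed.

Lemma loops_unserved d : (size (undlist (dhead d)) <= L 0)%N -> loops p_unserved d.
Proof.
rewrite /loops /p_unserved /= => Hd; by split => // x acc; split => //; case: ifP.
Qed.
Opaque p_unserved.

Lemma p_pc_costE l t d : known_all l -> now <= t ->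
  dfun O p_pc_cost (DCons (encs l) (DCons (DReal t) d)) =
  DReal (\sum_(p <- l | ~~ serves d (prq p)) residual t p).
Proof.
move=> kn nt; rewrite -dfunE /p_pc_cost /=; ev; rewrite undlist_dlist.
elim: l kn => [|p l IH] /=; first by rewrite big_nil.
case/andP=> kp /IH {}IH; rewrite big_cons IH; ev; rewrite ask_sat truthy_dbool.
by case: ifP => //= _; ev; rewrite p_residualE.
Qed.

Lemma loops_pc_cost d : (size (undlist (dhead d)) <= L 0)%N -> loops p_pc_cost d.
Proof.
rewrite /loops /p_pc_cost /= => Hd; split => // x acc; split => //; case: ifP => // _; split => //.
exact: loops_residual.
Qed.
Opaque p_pc_cost.

Lemma p_pay_allE l pe t : known_all l -> now <= t ->
  dfun O p_pay_all (DCons (encs l) (DCons (encs pe) (DReal t))) =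
  encs ([seq pay t p | p <- l] ++ pe).
Proof.
move=> kn nt; rewrite -dfunE /p_pay_all /=; ev; rewrite undlist_dlist /enc_pendings.
elim: l kn => [|p l IH] //= /andP[kp /IH {}IH]; rewrite IH; ev.
by rewrite p_raisedE.
Qed.

Lemma loops_pay_all d : (size (undlist (dhead d)) <= L 0)%N -> loops p_pay_all d.
Proof.
rewrite /loops /p_pay_all /= => Hd; by split => // x acc; split => //; apply: loops_raised.
Qed.
Opaque p_pay_all.

Lemma p_filter_leE l B : dfun O p_filter_le (DCons (encs l) (DReal B)) =
  encs [seq p <- l | plevel p <= B].
Proof.
rewrite -dfunE /p_filter_le /=; ev; rewrite undlist_dlist /enc_pendings.
by elim: l => [|p l IH] //=; rewrite IH truthy_dbool; case: ifP.
Qed.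

Lemma loops_filter_le d : (size (undlist (dhead d)) <= L 0)%N -> loops p_filter_le d.
Proof.
rewrite /loops /p_filter_le /= => Hd; by split => // x acc; case: ifP.
Qed.
Opaque p_filter_le.

Lemma p_filter_gtE l B : dfun O p_filter_gt (DCons (encs l) (DReal B)) =
  encs [seq p <- l | B < plevel p].
Proof.
rewrite -dfunE /p_filter_gt /=; ev; rewrite undlist_dlist /enc_pendings.
by elim: l => [|p l IH] //=; rewrite IH truthy_dbool ltNge; case: ifP.
Qed.

Lemma loops_filter_gt d : (size (undlist (dhead d)) <= L 0)%N -> loops p_filter_gt d.
Proof.
rewrite /loops /p_filter_gt /= => Hd; by split => // x acc; case: ifP.
Qed.
Opaque p_filter_gt.

Lemma p_cheap_solsE l n B :
  dfun O p_cheap_sols (DCons (encs l) (DCons DNil (DCons (DReal n%:R) (DReal B)))) =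
  dlist [seq psol p | p <- l & pbase p * n%:R <= B].
Proof.
rewrite -dfunE /p_cheap_sols /=; ev; rewrite undlist_dlist.
by elim: l => [|p l IH] //=; rewrite IH truthy_dbool; case: ifP.
Qed.

Lemma loops_cheap_sols d : (size (undlist (dhead d)) <= L 0)%N -> loops p_cheap_sols d.
Proof.
rewrite /loops /p_cheap_sols /= => Hd; by split => // x acc; case: ifP.
Qed.
Opaque p_cheap_sols.

Lemma p_hardE l n B E t : known_all l -> now <= t ->
  dfun O p_hard (DCons (encs l) (DCons (DCons (DReal n%:R) (DReal B)) (DCons E (DReal t)))) =
  encs [seq pay_upgrade B t p | p <- l & (B < pbase p * n%:R) && ~~ serves E (prq p)].
Proof.
move=> kn nt; rewrite -dfunE /p_hard /=; ev; rewrite undlist_dlist /enc_pendings.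
elim: l kn => [|p l IH] //= /andP[kp /IH {}IH]; rewrite IH truthy_dbool ltNge.
case: ifP => //= _; ev; rewrite ask_sat truthy_dbool; case: ifP => //= _; ev.
by rewrite p_raisedE.
Qed.

Lemma loops_hard d : (size (undlist (dhead d)) <= L 0)%N -> loops p_hard d.
Proof.
rewrite /loops /p_hard /= => Hd; split => // x acc; case: ifP => // _; split => //; case: ifP => // _.
by split => //; apply: loops_raised.
Qed.
Opaque p_hard.

(** At the first event the memory is [DNil], no state having been stored yet. *)
Definition enc_memory (n : nat) (st : state i) (mem : data R) : Prop :=
  mem = enc_state n st \/ [/\ mem = DNil, n = 0%N & st = State [::] [::] None].

Lemma p_enqueueE n st mem t (new : seq (delay_request i)) :
  enc_memory n st mem ->
  dfun O p_enqueue (DCons (instance_data i) (DCons (DReal t)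
    (DCons (dlist [seq request_code (req q) | q <- new]) mem))) =
  enc_context t (n + size new) (enqueue n st new).
Proof.
move=> Hm; rewrite -dfunE /p_enqueue /=; ev.
have -> : (if truthy mem then mem
     else DCons (DReal 0%:R) (DCons DNil (DCons DNil DNil))) = enc_state n st.
  by case: Hm => [->|[-> -> ->]].
rewrite p_lengthE size_map /= !undlist_dlist /enc_context /enc_state -natrD /=.
do 3 congr DCons; congr DCons.
have -> (l : seq (delay_request i)) : foldr
    (fun x acc : data R => DCons (dop (fun a b => DReal (a - b)) (dhead acc) (DReal 1%:R))
       (DCons (DCons (dop (fun a b => DReal (a - b)) (dhead acc) (DReal 1%:R)) x) (dtail acc)))
    (DCons (DReal (n + size l)%:R) DNil) [seq request_code (req q) | q <- l] =
  DCons (DReal n%:R) (dlist [seq enc_queued a | a <- zip l (iota n (size l))]).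
  elim: l n {Hm} => [|q l IH] n /=; first by rewrite addn0.
  by rewrite -addSnnS IH /= predrN.
rewrite map_cat /=; elim: (queue st) => //= a l ->.
by [].
Qed.

Lemma loops_enqueue n st mem t (new : seq (delay_request i)) :
  enc_memory n st mem -> (size new <= L 0)%N -> (size (queue st) <= L 0)%N ->
  loops p_enqueue (DCons (instance_data i) (DCons (DReal t)
    (DCons (dlist [seq request_code (req q) | q <- new]) mem))).
Proof.
move=> Hm Hn Hq; rewrite /loops /p_enqueue /=; split; first by case: ifP.
have Hn' : (size (undlist (dlist [seq request_code (req q) | q <- new])) <= L 0)%N.
  by rewrite undlist_dlist size_map.
split; first exact: loops_length.
split; first by split.
split => //; split => //; ev.
by case: Hm => [->|[-> _ _]] //=; rewrite undlist_dlist size_map.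
Qed.
Opaque p_enqueue.

Definition known_state (st : state i) : bool :=
  [&& all (fun a => known a.1 a.2) (queue st), known_all (pendings st) &
    if serving st is Some s then (now <= ahead s) && known_all (candidates s)
    else true].

Lemma p_pcE g n st : known_state st ->
  dfun O (p_pc g) (enc_context now n st) = pc_data (pc_of g st).
Proof.
case/and3P=> kq kp ks; rewrite -dfunE /p_pc /=; ev.
rewrite /pc_of /pc_data; case: (queue st) => [|[q j] qs] /=; last first.
  by ev; rewrite p_sumE /= big_enum.
case: (serving st) ks => [s|] //= /andP[nt kc]; ev.
rewrite undlist_dlist /service_pc /=; congr DCons.
elim: (candidates s) kc => [|p l IH] //= /andP[kc /IH ->]; ev.
by rewrite p_residualE.
Qed.

Lemma size_costs : size (undlist (dlist [seq DReal (cost e) | e <- enum 'I_(nelem i)]))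
  = nelem i.
Proof. by rewrite undlist_dlist size_map size_enum_ord. Qed.

Lemma size_encs l : size (undlist (encs l)) = size l.
Proof. by rewrite undlist_dlist size_map. Qed.

Lemma loops_pc g n t st : (nelem i <= L 0)%N ->
  (size (candidates_of st) <= L 0)%N -> loops (p_pc g) (enc_context t n st).
Proof.
move=> Hm Hc; rewrite /loops /p_pc /=; case: ifP => _.
  by split => //; apply: loops_length; rewrite size_costs.
case: ifP => //; rewrite /candidates_of in Hc.
case: (serving st) Hc => [s|] //= Hc _; split => //; split.
  by rewrite size_encs.
by move=> x acc; split => //; apply: loops_residual.
Qed.

Lemma p_step_queueE g n st d q j qs : queue st = (q, j) :: qs -> known_state st ->
  dfun O (p_step_queue g) (DCons (enc_context now n st) (DCons d
     (DReal (set_cost (decode i d))))) =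
  let: (st', al, tr) := step g now st d in
  DCons (enc_state n st') (DCons (enc_option al) (dlist tr)).
Proof.
move=> Eq; rewrite /known_state Eq /= => /and3P[/andP[kq _] _ _].
rewrite -dfunE /p_step_queue /= Eq /=; ev.
rewrite ask_sat truthy_dbool /step Eq; case: ifP => sat //=.
case: ifP => c0 //=.
by rewrite (ask_delay kq).
Qed.

Lemma p_step_serviceE g n st d s : queue st = [::] -> serving st = Some s ->
  known_state st ->
  dfun O (p_step_service g) (DCons (enc_context now n st) (DCons d
     (DReal (set_cost (decode i d))))) =
  let: (st', al, tr) := step g now st d in
  DCons (enc_state n st') (DCons (enc_option al) (dlist tr)).
Proof.
move=> Eq Es; rewrite /known_state Es => /and3P[_ kp /andP[nt kc]].
have kf (a : pred (pending i)) : known_all [seq p <- candidates s | a p].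
  by elim: (candidates s) kc => //= p l IH /andP[kp' /IH kl]; case: ifP => //= _; rewrite kp'.
rewrite -dfunE /p_step_service /= Es /=; ev.
rewrite p_pc_costE //= truthy_dbool /step Eq Es service_pcE; case: ifP => _ /=; ev.
  by rewrite p_unservedE p_pay_allE.
rewrite p_unservedE p_lengthE size_map p_next_timeE //.
by case: (next_time _ _ _).
Qed.

Lemma p_step_idleE g n st d : queue st = [::] -> serving st = None ->
  known_state st ->
  dfun O p_step_idle (DCons (enc_context now n st) (DCons d
     (DReal (set_cost (decode i d))))) =
  let: (st', al, tr) := step g now st d in
  DCons (enc_state n st') (DCons (enc_option al) (dlist tr)).
Proof.
move=> Eq Es /and3P[_ kp _].
have kf (a : pred (pending i)) : known_all [seq p <- pendings st | a p].
  by elim: (pendings st) kp => //= p l IH /andP[kp' /IH kl]; case: ifP => //= _; rewrite kp'.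
rewrite -dfunE /p_step_idle /= Es Eq /=; ev.
rewrite p_criticalE // /step Eq Es; case: (critical_level _ _) => [v|] /=; ev; last first.
  by rewrite p_lengthE size_map p_next_timeE // /enc_state Eq Es.
by rewrite p_filter_leE p_filter_gtE p_lengthE size_map p_cheapE p_cheap_solsE p_hardE.
Qed.

Lemma loops_step_queue g d : loops (p_step_queue g) d.
Proof. by rewrite /loops /p_step_queue /=; split => //; do 2 case: ifP => // _. Qed.

Lemma loops_step_service g n st d s : serving st = Some s ->
  (size (candidates s) <= L 0)%N -> known_state st ->
  loops (p_step_service g) (DCons (enc_context now n st) (DCons d
     (DReal (set_cost (decode i d))))).
Proof.
move=> Es Hc; rewrite /known_state Es => /and3P[_ kp /andP[nt kc]].
have Hf (a : pred (pending i)) : (size [seq p <- candidates s | a p] <= L 0)%N.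
  by rewrite size_filter (leq_trans (count_size _ _)).
rewrite /loops /p_step_service /= Es /=.
split; first by apply: loops_pc_cost; rewrite size_encs.
case: ifP => _.
  split; first by apply: loops_unserved; rewrite size_encs.
  split => //; apply: loops_pay_all; ev.
  by rewrite p_unservedE size_encs.
split; first by apply: loops_unserved; rewrite size_encs.
split; first by apply: loops_length; rewrite size_encs.
split; last by case: ifP.
by apply: loops_next_time; ev; rewrite p_unservedE size_encs.
Qed.

Lemma loops_step_idle n st d : (nelem i <= L 0)%N ->
  (size (pendings st) <= L 0)%N -> known_state st ->
  loops p_step_idle (DCons (enc_context now n st) (DCons d
     (DReal (set_cost (decode i d))))).
Proof.
move=> Hm Hp /and3P[_ kp _].
have Hf (a : pred (pending i)) : (size [seq p <- pendings st | a p] <= L 0)%N.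
  by rewrite size_filter (leq_trans (count_size _ _)).
rewrite /loops /p_step_idle /=.
split; first by apply: loops_critical; rewrite size_encs.
case: ifP; ev; rewrite p_criticalE //; last first.
  move=> _; split; first by apply: loops_length; rewrite size_encs.
  by split => //; apply: loops_next_time; rewrite size_encs.
case: (critical_level _ _) => [v|] //= _; split => //.
split; first by apply: loops_filter_le; rewrite size_encs.
split; first by apply: loops_length; ev; rewrite p_filter_leE size_encs.
split; first by apply: loops_cheap; rewrite size_costs.
split; first by apply: loops_cheap_sols; ev; rewrite p_filter_leE size_encs.
split; first by apply: loops_hard; ev; rewrite p_filter_leE size_encs.
by split => //; apply: loops_filter_gt; rewrite size_encs.
Qed.
Opaque p_step_queue p_step_service p_step_idle.

Lemma p_stepE g n st d : known_state st ->
  dfun O (p_step g) (DCons (enc_context now n st) (DCons d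
     (DReal (set_cost (decode i d))))) =
  let: (st', al, tr) := step g now st d in
  DCons (enc_state n st') (DCons (enc_option al) (dlist tr)).
Proof.
move=> ks; rewrite -dfunE /p_step /=; ev.
case Eq : (queue st) => [|[q j] qs] /=; last by ev; apply: p_step_queueE Eq ks.
case Es : (serving st) => [s|] /=; ev; first exact: p_step_serviceE Eq Es ks.
exact: p_step_idleE.
Qed.

Lemma loops_step g n st d : (nelem i <= L 0)%N ->
  (size (pendings st) <= L 0)%N -> (size (candidates_of st) <= L 0)%N ->
  known_state st ->
  loops (p_step g) (DCons (enc_context now n st) (DCons d
     (DReal (set_cost (decode i d))))).
Proof.
move=> Hm Hp Hc ks; rewrite /loops /p_step /=.
case: ifP => _; first exact: loops_step_queue.
case Es : (serving st) => [s|] /=; last exact: loops_step_idle.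
by apply: (loops_step_service _ _ _ Es) => //; move: Hc; rewrite /candidates_of Es.
Qed.

End Specifications.

(** * Expectations over coin tosses *)

Section CoinSums.
Variable R : realType.
Implicit Types (D : set (seq bool)) (f : seq bool -> \bar R).

Definition coin_sum D f : \bar R :=
  (\esum_(w in D) ((2^-1 ^+ size w)%:E * f w))%E.

Definition prefix_free D : Prop :=
  forall w w' u u', D w -> D w' -> w ++ u = w' ++ u' -> w = w'.

Lemma coin_pos (w : seq bool) : 0 < 2^-1 ^+ size w :> R.
Proof. by rewrite exprn_gt0 // invr_gt0. Qed.

Lemma le_coin_sum D f f' : (forall w, D w -> (f w <= f' w)%E) ->
  (coin_sum D f <= coin_sum D f')%E.
Proof.
move=> H; apply: le_esum => w Dw; apply: lee_wpmul2l; last exact: H.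
by rewrite lee_fin ltW // coin_pos.
Qed.

Lemma eq_coin_sum D f f' : (forall w, D w -> f w = f' w) ->
  coin_sum D f = coin_sum D f'.
Proof. by move=> H; apply: eq_esum => w /H ->. Qed.

Lemma esumZl (T : choiceType) (D : set T) (r : R) (a : T -> \bar R) :
  0 < r -> (forall x, (0 <= a x)%E) ->
  (\esum_(x in D) (r%:E * a x) = r%:E * \esum_(x in D) a x)%E.
Proof.
move=> r0 a0; rewrite /esum -ereal_sup_pZl //; congr ereal_sup.
rewrite eqEsubset; split => y /= [A AD <-].
  exists (\sum_(x \in A) a x)%E; first by exists A.
  by rewrite ge0_mule_fsumr.
case: AD => B BD <-; exists B => //.
by rewrite ge0_mule_fsumr.
Qed.

Definition concat_set D (E : seq bool -> set (seq bool)) : set (seq bool) :=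
  [set w | exists w1 w2, [/\ D w1, E w1 w2 & w = w1 ++ w2]].

(** Prefix-freeness makes the cut of a word into its two stages unique, so no word is counted twice;
    the second stage may depend on the coins of the first. *)
Lemma coin_sum_concat D E f : prefix_free D -> (forall w, (0 <= f w)%E) ->
  coin_sum (concat_set D E) f =
  coin_sum D (fun w1 => coin_sum (E w1) (fun w2 => f (w1 ++ w2))).
Proof.
move=> pf f0; rewrite /coin_sum.
transitivity (\esum_(w1 in D) \esum_(w2 in E w1)
   ((2^-1 ^+ size (w1 ++ w2))%:E * f (w1 ++ w2)))%E; last first.
  apply: eq_esum => w1 Dw1; rewrite -esumZl ?coin_pos //; last first.
    by move=> w2; rewrite mule_ge0 // lee_fin ltW // coin_pos.
  by apply: eq_esum => w2 _; rewrite size_cat exprD EFinM muleA.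
have pos w : (0 <= (2^-1 ^+ size w)%:E * f w)%E.
  by rewrite mule_ge0 // lee_fin ltW // coin_pos.
rewrite esum_esum //.
apply: (@reindex_esum R _ _ _ _ (fun k : seq bool * seq bool => k.1 ++ k.2)).
split.
- by move=> [w1 w2] /= [D1 E2]; exists w1, w2.
- move=> [w1 w2] [w1' w2']; rewrite !inE /= => -[D1 E1] [D1' E1'] e.
  have ew := pf _ _ _ _ D1 D1' e; move: e; rewrite /= -ew => /eqP.
  by rewrite eqseq_cat // => /andP[_ /eqP->].
- by move=> _ /= [w1 [w2 [D1 E2 ->]]]; exists (w1, w2).
Qed.

Lemma coin_sum_cst D (c : R) : coin_sum D (fun=> 1%E) = 1%E -> 0 <= c ->
  coin_sum D (fun=> c%:E) = c%:E.
Proof.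
move=> D1; rewrite le_eqVlt => /predU1P[<-|c0].
  by rewrite /coin_sum esum1 // => w _; rewrite mule0.
have pos (w : seq bool) : (0 <= (2^-1 ^+ size w)%:E * 1 :> \bar R)%E.
  by rewrite mule1 lee_fin ltW // coin_pos.
rewrite -[RHS]mule1 -D1 /coin_sum -(esumZl D c0 pos).
by apply: eq_esum => w _; rewrite mule1 muleC.
Qed.

Lemma coin_sum_affine D (n : seq bool -> nat) (c d : nat) (m : R) :
  coin_sum D (fun=> 1%E) = 1%E ->
  (coin_sum D (fun w => (n w)%:R%:E) <= m%:E)%E ->
  (coin_sum D (fun w => (c + d * n w)%:R%:E) <= (c%:R + d%:R * m)%:E)%E.
Proof.
move=> D1 Dn.
have -> : coin_sum D (fun w => (c + d * n w)%:R%:E) =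
  (c%:R%:E + d%:R%:E * coin_sum D (fun w => (n w)%:R%:E))%E.
  rewrite -[X in (X + _)%E](coin_sum_cst D1) ?ler0n // /coin_sum.
  case: (posnP d) => [->|d0].
    rewrite mul0e adde0; apply: eq_esum => w _.
    by rewrite mul0n addn0.
  have pos (w : seq bool) : (0 <= (2^-1 ^+ size w)%:E * (n w)%:R%:E :> \bar R)%E.
    by rewrite mule_ge0 // lee_fin ?ler0n // ltW // coin_pos.
  have d0' : 0 < d%:R :> R by rewrite ltr0n.
  rewrite -(esumZl D d0' pos) -esumD; first last.
  - by move=> w _; rewrite !mule_ge0 // lee_fin ?ler0n // ltW // coin_pos.
  - by move=> w _; rewrite mule_ge0 // lee_fin ?ler0n // ltW // coin_pos.
  apply: eq_esum => w _; rewrite -!EFinM -EFinD; congr EFin.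
  by rewrite natrD natrM mulrDr [in RHS]mulrCA.
rewrite EFinD EFinM; apply: leeD => //.
by apply: lee_wpmul2l => //; rewrite lee_fin ler0n.
Qed.

(** The tower rule for expected time. Mass 1 means almost sure halting and has to be carried along:
    without it the constant terms would not integrate to themselves. *)
Lemma coin_sum_step D E (f f1 : seq bool -> nat) (f2 : seq bool -> seq bool -> nat)
    (t1 t2 : R) :
  prefix_free D ->
  coin_sum D (fun=> 1%E) = 1%E ->
  (coin_sum D (fun w => (f1 w)%:R%:E) <= t1%:E)%E ->
  0 <= t2 ->
  (forall w, D w -> coin_sum (E w) (fun=> 1%E) = 1%E /\
     (coin_sum (E w) (fun w2 => (f2 w w2)%:R%:E) <= t2%:E)%E) ->
  (forall w1 w2, D w1 -> E w1 w2 -> (f (w1 ++ w2) <= f1 w1 + f2 w1 w2)%N) ->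
  coin_sum (concat_set D E) (fun=> 1%E) = 1%E /\
  (coin_sum (concat_set D E) (fun w => (f w)%:R%:E) <= (t1 + t2)%:E)%E.
Proof.
move=> pf D1 Df t20 HE Hf; split.
  rewrite coin_sum_concat //; rewrite -[RHS]D1; apply: eq_coin_sum => w Dw.
  by case: (HE w Dw).
rewrite coin_sum_concat //.
apply: (@le_trans _ _ (coin_sum D (fun w1 => (f1 w1)%:R%:E + t2%:E)%E)).
  apply: le_coin_sum => w1 Dw1; have [E1 E2] := HE _ Dw1.
  apply: (@le_trans _ _ (coin_sum (E w1) (fun w2 => (f1 w1 + 1 * f2 w1 w2)%:R%:E))).
    apply: le_coin_sum => w2 Ew2; rewrite lee_fin ler_nat mul1n; exact: Hf.
  by apply: le_trans (coin_sum_affine _ _ E1 E2) _; rewrite mul1r EFinD.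
have -> : coin_sum D (fun w1 => (f1 w1)%:R%:E + t2%:E)%E =
   (coin_sum D (fun w1 => (f1 w1)%:R%:E) + t2%:E)%E.
  rewrite -[X in (_ + X)%E](coin_sum_cst D1) // /coin_sum -esumD; first last.
  - by move=> w _; rewrite mule_ge0 // lee_fin // ltW // coin_pos.
  - by move=> w _; rewrite mule_ge0 // lee_fin ?ler0n // ltW // coin_pos.
  by apply: eq_esum => w _; rewrite ge0_muleDr // lee_fin ?ler0n.
by rewrite EFinD leeD2r.
Qed.

(** Outcomes are pairs, but the word determines the value, so the sum may run over words alone. *)
Lemma expectation_coin_sum (T : choiceType) (S : set (seq bool * T))
    (val : seq bool -> T) (F : T -> \bar R) :
  (forall w x, S (w, x) -> x = val w) ->
  expectation_over S F = coin_sum [set w | exists x, S (w, x)] (fun w => F (val w)).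
Proof.
move=> H; rewrite /expectation_over /coin_sum.
apply: (@reindex_esum R _ _ _ _ (fun w : seq bool => (w, val w))); split.
- by move=> w /= [x Sx]; rewrite -(H _ _ Sx).
- by move=> w w' _ _ [].
- by move=> [w x] /= Sx; exists w; [exists x|rewrite (H _ _ Sx)].
Qed.

Lemma expectation_le (T : choiceType) (S : set (seq bool * T))
    (F : T -> \bar R) (c : \bar R) :
  halts_almost_surely R S -> (forall w x, S (w, x) -> (F x <= c)%E) -> (0 <= c)%E ->
  (expectation_over S F <= c)%E.
Proof.
rewrite /halts_almost_surely /expectation_over => S1 H c0.
case: c H c0 => [c| |] //= H c0; last by rewrite leey.
apply: (@le_trans _ _ (\esum_(o in S) ((2^-1 ^+ size o.1)%:E * c%:E))%E).
  apply: le_esum => -[w x] Sx; apply: lee_wpmul2l; last exact: H Sx.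
  by rewrite lee_fin ltW // coin_pos.
have c0' : 0 <= c by rewrite -lee_fin.
case: (ltgtP 0 c) c0' => // {c0}[c0|<-] _; last first.
  by rewrite esum1 // => o _; rewrite mule0.
rewrite (@eq_esum _ _ S _ (fun o => (c%:E * ((2^-1 ^+ size o.1)%:E * 1))%E)); last first.
  by move=> o _; rewrite mule1 muleC.
have pos (o : seq bool * T) : (0 <= (2^-1 ^+ size o.1)%:E * 1 :> \bar R)%E.
  by rewrite mule1 lee_fin ltW // coin_pos.
by rewrite (esumZl S c0 pos) S1 mule1.
Qed.

End CoinSums.

(** * Runs of the online algorithm *)

(** [P] is the only part that may toss coins and is called exactly once, so the coin words of an
    event are those of one run of [P]. *)
Definition online_algorithm (P : program pc_op) (g : nat) : program online_op :=
  PSeq (PCall 0 (fprog p_enqueue) (EVar 0))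
  (PSeq (PCall 1 (fprog (p_pc g)) (EVar 0))
  (PSeq (PCall 1 (pmap_op (fun=> AskSat) P) (EVar 1))
  (PSeq (PCall 2 (fprog p_cost) (ECons (ETail (EHead (EVar 0))) (EVar 1)))
        (PCall 0 (fprog (p_step g)) (ECons (EVar 0) (ECons (EVar 1) (EVar 2))))))).

Lemma deterministic_online_algorithm P g :
  deterministic P -> deterministic (online_algorithm P g).
Proof.
by move=> dP; rewrite /online_algorithm /= deterministic_pmap_op dP.
Qed.

Section RunLemmas.
Variables (R : realType) (Op : Type) (O : Op -> data R -> data R).

Lemma exec_seq_inv (p1 p2 : program Op) s w s' n :
  exec O (PSeq p1 p2) s w s' n -> exists w1 w2 s1 n1 n2,
  [/\ exec O p1 s w1 s1 n1, exec O p2 s1 w2 s' n2 & w = w1 ++ w2].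
Proof. by move=> H; inversion H; subst; exists w1, w2, s1, n1, n2. Qed.

Lemma exec_call x p e s w out n : run O p (eval e s) w out n ->
  exec O (PCall x p e) s w (update s x out) n.+1.
Proof. by case=> s' E ->; apply: ExecCall. Qed.

Lemma exec_call_inv x p e s w s' n : exec O (PCall x p e) s w s' n ->
  exists out n', run O p (eval e s) w out n' /\ s' = update s x out.
Proof.
move=> H; inversion H; subst; exists (s'0 0%N), n0; split => //.
by exists s'0.
Qed.

Lemma run_functional p d w1 o1 n1 w2 o2 n2 u1 u2 :
  run O p d w1 o1 n1 -> run O p d w2 o2 n2 -> w1 ++ u1 = w2 ++ u2 ->
  [/\ w1 = w2, o1 = o2 & n1 = n2].
Proof.
move=> [s1 E1 ->] [s2 E2 ->] e.
by have [-> -> ->] := exec_functional E1 E2 e.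
Qed.

Lemma run_unique p d w o1 n1 o2 n2 :
  run O p d w o1 n1 -> run O p d w o2 n2 -> o1 = o2 /\ n1 = n2.
Proof. by move=> r1 r2; have [] := @run_functional _ _ _ _ _ _ _ _ [::] [::] r1 r2 erefl. Qed.

Lemma run_deterministic p d w1 o1 n1 o2 n2 :
  run O p d [::] o1 n1 -> deterministic p -> run O p d w1 o2 n2 ->
  w1 = [::] /\ o2 = o1.
Proof.
move=> r1 dp r2; have e : w1 = [::] by case: r2 => s E _; apply: deterministic_exec dp E.
by subst w1; have [->] := run_unique r2 r1.
Qed.

End RunLemmas.

Lemma height_le_size (R : realType) (d : data R) : (height d <= data_size d)%N.
Proof. by elim: d => //= a Ha b Hb; rewrite ltnS geq_max; lia. Qed.

(** * One event: output, running time and coins *)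

Section Event.
Variables (R : realType) (ND : nd_class R) (i : instance ND).
Variables (P : program pc_op) (g : nat).
Implicit Types (st : state i) (q : delay_request i).

Lemma height_answer (d input : data R) w n :
  run (fun=> sat_oracle i) P input w d n ->
  (height d <= data_size input + psize P * n)%N.
Proof.
case=> s E ->; apply: (height_exec _ E).
- by move=> _ d'; rewrite height_dbool.
- by apply: leq_trans (height_le_size _); apply: height_gt0.
- move=> x; rewrite /init_store /update; case: eqP => _; first exact: height_le_size.
  by apply: leq_trans (height_le_size _); apply: height_gt0.
Qed.

Definition event_time (X z n : nat) : nat :=
  (time_bound (fun=> X) p_enqueue + time_bound (fun=> X) (p_pc g)
   + time_bound (fun=> X) (p_step g) + 100 * (X + 1) * (z + psize P * n + 1)
   + n + 30)%N.

Section OneEvent.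
Variables (past new : seq (delay_request i)) (u : R) (st0 : state i) (mem : data R).
Variable (X : nat).
Let released := past ++ new.
Let st := enqueue (size past) st0 new.
Hypothesis mem_ok : enc_memory (size past) st0 mem.
Hypothesis known_ok : known_state u (known released u) st.
Hypothesis size_new : (size new <= X)%N.
Hypothesis size_queue : (size (queue st0) <= X)%N.
Hypothesis size_elem : (nelem i <= X)%N.
Hypothesis size_pend : (size (pendings st) <= X)%N.
Hypothesis size_cands : (size (candidates_of st) <= X)%N.

Let O := online_oracle released.
Let ask_delay q n t : known released u q n -> u <= t ->
  O AskDelay (DCons (DReal n%:R) (DReal t)) = DReal (delay q t).
Proof. exact: online_oracle_delay. Qed.
Let ask_delay_inv q n y : known released u q n ->
  O AskDelayInv (DCons (DReal n%:R) (DReal y)) = DReal (delay_inv q y).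
Proof. exact: online_oracle_delay_inv. Qed.
Let ask_sat q d : O AskSat (DCons (request_code (req q)) d) = dbool R (serves d q).
Proof. exact: sat_oracleE. Qed.

Let input := event_data u new mem.
Let context : data R := enc_context u (size past + size new) st.

Lemma run_enqueue : exists2 t, run O (fprog p_enqueue) input [::] context t &
  (t <= time_bound (fun=> X) p_enqueue + 2)%N.
Proof.
have -> : context = dfun O p_enqueue input by rewrite (@p_enqueueE R ND i O (size past) st0 mem u new mem_ok).
apply: run_fprog; first exact: closed_p_enqueue.
exact: (@loops_enqueue R ND i O (fun=> X) (size past) st0).
Qed.

Lemma run_pc : exists2 t, run O (fprog (p_pc g)) context [::] (pc_data (pc_of g st)) t &
  (t <= time_bound (fun=> X) (p_pc g) + 2)%N.
Proof.
have -> : pc_data (pc_of g st) = dfun O (p_pc g) context.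
  by rewrite (@p_pcE R ND i u O (known released u) ask_delay).
apply: run_fprog; first exact: closed_p_pc.
exact: loops_pc.
Qed.

Lemma run_cost (d : data R) (m : nat) : (size (undlist d) <= m)%N ->
  exists2 t, run O (fprog p_cost) (DCons (dtail (dhead context)) d) [::]
    (DReal (set_cost (decode i d))) t & (t <= 100 * (X + 1) * (m + 1) + 2)%N.
Proof.
move=> dm; pose L := fun j => if j == 0%N then X else m.
have -> : DReal (set_cost (decode i d)) =
    dfun O p_cost (DCons (dtail (dhead context)) d) by rewrite p_costE.
have [||t rt tb] := @run_fprog _ _ O L p_cost (DCons (dtail (dhead context)) d).
- exact: closed_p_cost.
- by apply: (@loops_cost R O L) => //=; rewrite size_costs.
- exists t => //; apply: leq_trans tb _; rewrite leq_add2r.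
  exact: (time_bound_p_cost L).
Qed.

Definition event_output (d : data R) : data R :=
  let: (st', al, tr) := step g u st d in
  DCons (enc_state (size past + size new) st') (DCons (enc_option al) (dlist tr)).

Lemma run_step (d : data R) : exists2 t,
  run O (fprog (p_step g)) (DCons context (DCons d (DReal (set_cost (decode i d)))))
    [::] (event_output d) t & (t <= time_bound (fun=> X) (p_step g) + 2)%N.
Proof.
have -> : event_output d = dfun O (p_step g)
    (DCons context (DCons d (DReal (set_cost (decode i d))))).
  by rewrite (@p_stepE R ND i u O (known released u) ask_delay ask_delay_inv ask_sat).
apply: run_fprog; first exact: closed_p_step.
exact: (@loops_step R ND i u O (known released u) ask_delay ask_sat).
Qed.

Lemma event_run w d n :
  run (fun=> sat_oracle i) P (pc_data (pc_of g st)) w d n ->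
  exists2 t, run O (online_algorithm P g) input w (event_output d) t &
    (t <= event_time X (data_size (pc_data (pc_of g st))) n)%N.
Proof.
move=> rP; have [t1 r1 b1] := run_enqueue; have [t2 r2 b2] := run_pc.
have [|t3 r3 b3] := @run_cost d (data_size (pc_data (pc_of g st)) + psize P * n).
  by apply: leq_trans (size_undlist _) (height_answer rP).
have [t4 r4 b4] := run_step d.
exists (t1.+1 + (t2.+1 + (n.+1 + (t3.+1 + t4.+1).+1).+1).+1).+1; last first.
  by rewrite /event_time; lia.
have rP' : run O (pmap_op (fun=> AskSat) P) (pc_data (pc_of g st)) w d n.
  by case: rP => s E ->; exists s => //; apply/exec_pmap_op.
set s0 := init_store input.
set s1 := update s0 0 context.
set s2 := update s1 1 (pc_data (pc_of g st)).
set s3 := update s2 1 d.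
set s4 := update s3 2 (DReal (set_cost (decode i d))).
set s5 := update s4 0 (event_output d).
exists s5; last by rewrite /s5 updateE.
apply: (@ExecSeq _ _ _ _ _ _ s1 _ [::] w).
  exact: (@exec_call _ _ O 0 (fprog p_enqueue) (EVar 0) s0 _ _ _ r1).
apply: (@ExecSeq _ _ _ _ _ _ s2 _ [::] w).
  exact: (@exec_call _ _ O 1 (fprog (p_pc g)) (EVar 0) s1 _ _ _ r2).
rewrite -[w]cats0; apply: (@ExecSeq _ _ _ _ _ _ s3).
  exact: (@exec_call _ _ O 1 (pmap_op (fun=> AskSat) P) (EVar 1) s2 _ _ _ rP').
apply: (@ExecSeq _ _ _ _ _ _ s4 _ [::] [::]).
  exact: (@exec_call _ _ O 2 (fprog p_cost) (ECons (ETail (EHead (EVar 0))) (EVar 1)) s3 _ _ _ r3).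
exact: (@exec_call _ _ O 0 (fprog (p_step g)) (ECons (EVar 0) (ECons (EVar 1) (EVar 2))) s4 _ _ _ r4).
Qed.

(** With [event_run] this identifies the halting words of an event with those of [P], which carries
    almost sure halting over to the event. *)
Lemma event_run_inv w out n : run O (online_algorithm P g) input w out n ->
  exists d n', run (fun=> sat_oracle i) P (pc_data (pc_of g st)) w d n'.
Proof.
case=> s E _; have [t1 r1 _] := run_enqueue; have [t2 r2 _] := run_pc.
have [w1 [v1 [s1 [n1 [m1 [E1 E1' ->]]]]]] := exec_seq_inv E.
have [y1 [n1' [R1 ?]]] := exec_call_inv E1; subst s1.
have [e1 y1E] := run_deterministic r1 (deterministic_fprog _) R1; subst w1 y1.
have [w2 [v2 [s2 [n2 [m2 [E2 E2' ->]]]]]] := exec_seq_inv E1'.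
have [y2 [n2' [R2 ?]]] := exec_call_inv E2; subst s2.
have [e2 y2E] := run_deterministic r2 (deterministic_fprog _) R2; subst w2 y2.
have [w3 [v3 [s3 [n3 [m3 [E3 E3' ->]]]]]] := exec_seq_inv E2'.
have [y3 [n3' [R3 ?]]] := exec_call_inv E3; subst s3.
have [w4 [v4 [s4 [n4 [m4 [E4 E4' ->]]]]]] := exec_seq_inv E3'.
have [y4 [n4' [[s4' R4 _] _]]] := exec_call_inv E4.
have e4 := deterministic_exec (deterministic_fprog _) R4; subst w4.
have [y5 [n5' [[s5' R5 _] _]]] := exec_call_inv E4'.
have e5 := deterministic_exec (deterministic_fprog _) R5; subst v4.
exists y3, n3'; rewrite /= !cats0; case: R3 => s3 R3 ->.
by move/exec_pmap_op: R3 => R3; exists s3.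
Qed.

End OneEvent.

End Event.

Section Steps.
Variables (R : realType) (ND : nd_class R) (i : instance ND) (A : program online_op).

Lemma online_steps_functional past future alarm mem w1 (s1 : schedule i) n1 w2 s2 n2 u1 u2 :
  online_steps A past future alarm mem w1 s1 n1 ->
  online_steps A past future alarm mem w2 s2 n2 ->
  w1 ++ u1 = w2 ++ u2 -> [/\ w1 = w2, s1 = s2 & n1 = n2].
Proof.
move=> H; elim: H w2 s2 n2 u1 u2 => {past future alarm mem w1 s1 n1}.
  move=> past future alarm mem Hn w2 s2 n2 u1 u2 H; inversion H; subst => //.
  by rewrite Hn in H0.
move=> past future alarm mem t w1 w2 out s n1 n2 Hn new rest r1 _ IH w' s' n' u1 u2 H.
inversion H; subst; first by rewrite Hn in H0.
rewrite Hn in H0; case: H0 => ?; subst t0.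
rewrite -!catA => e; have [? ? ?] := run_functional r1 H1 e; subst.
move/eqP: e; rewrite eqseq_cat // => /andP[_ /eqP e].
by have [-> -> ->] := IH _ _ _ _ _ H2 e.
Qed.

Lemma online_steps_unique past future alarm mem w (s1 : schedule i) n1 s2 n2 :
  online_steps A past future alarm mem w s1 n1 ->
  online_steps A past future alarm mem w s2 n2 -> s1 = s2 /\ n1 = n2.
Proof.
move=> r1 r2.
by have [] := @online_steps_functional _ _ _ _ _ _ _ _ _ _ [::] [::] r1 r2 erefl.
Qed.

Lemma next_event_spec (future : seq (delay_request i)) (alarm : \bar R) :
  alarm != -oo%E ->
  match next_event future alarm return Prop with
  | u%:E => [/\ forall q, q \in future -> u <= release q,
       forall a, alarm = a%:E -> u <= a &
       alarm = u%:E \/ exists2 q, q \in future & release q = u]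
  | +oo%E => alarm = +oo%E /\ future = [::]
  | -oo%E => False
  end.
Proof.
move=> al; rewrite /next_event.
have H : match \big[Order.min/+oo%E]_(q <- future) (release q)%:E return Prop with
  | u%:E => (forall q, q \in future -> u <= release q) /\
       exists2 q, q \in future & release q = u
  | +oo%E => future = [::]
  | -oo%E => False
  end.
  elim: future => [|q l]; first by rewrite big_nil.
  rewrite big_cons; case: (\big[_/_]_(_ <- _) _) => [v| |] //.
    move=> [lv [q' q'l q'v]]; rewrite minEle lee_fin; case: ifP => [qv|/negbT].
      split; last by exists q; rewrite ?mem_head.
      by move=> q2; rewrite inE => /predU1P[->//|/lv /(le_trans qv)].
    rewrite -ltNge => vq; split; last by exists q'; rewrite // inE q'l orbT.
    by move=> q2; rewrite inE => /predU1P[->|/lv//]; apply: ltW.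
  move=> ->; rewrite minEle leey; split; last by exists q; rewrite ?mem_head.
  by move=> q2; rewrite inE => /eqP->.
case: alarm al => [a| |] // _; case: (\big[_/_]_(_ <- _) _) H => [v| |] //.
- move=> [lv [q ql qv]]; rewrite minEle lee_fin; case: ifP => [av|/negbT].
    split; [|by move=> _ [<-]|by left].
    by move=> q' /lv; apply: le_trans.
  by rewrite -ltNge => va; split => // [_ [<-]|]; [apply: ltW|right; exists q].
- by move=> ->; rewrite minEle leey; split => //; [move=> _ [<-]|left].
- by move=> [lv [q ql qv]]; rewrite minEle leNgt ltry /=; split => //; right; exists q.
Qed.

End Steps.

(** * Configurations between events and their successors *)

Section Configurations.
Variables (R : realType) (ND : nd_class R) (i : instance ND).
Variables (P : program pc_op) (g k : nat).
Hypothesis g_gt0 : (0 < g)%N.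
Implicit Types (t u : R) (q : delay_request i) (st : state i).

(** Indices travel with their requests. A transition creates no new pair, so every index keeps the
    meaning it has for the oracle. *)
Definition items st : seq (delay_request i * nat) :=
  queue st ++ [seq (prq p, pidx p) | p <- pendings st ++ candidates_of st].

Lemma activeE st : active st = [seq a.1 | a <- items st].
Proof. by rewrite /active /items !map_cat -!map_comp. Qed.

Lemma itemsP st a : reflect (a \in queue st \/ (exists2 p,
   p \in pendings st ++ candidates_of st & a = (prq p, pidx p))) (a \in items st).
Proof.
rewrite mem_cat; apply: (iffP orP) => -[aq|H]; [by left|right|by left|right].
  by case/mapP: H => p pl ->; exists p.
by case: H => p pl ->; apply: map_f.
Qed.

Lemma step_items u st d : {subset items (step g u st d).1.1 <= items st}.
Proof.
rewrite /step; case Eq : (queue st) => [|[q j] qs].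
- case Es : (serving st) => [s|].
    case: ifP => _ /=.
      move=> a /itemsP[//|[p]]; rewrite /candidates_of /= cats0 mem_cat => /orP[|pl ->].
        case/mapP=> p'; rewrite mem_filter => /andP[_ p'c] -> ->.
        apply/itemsP; right; exists p' => //.
        by rewrite mem_cat /candidates_of Es p'c orbT.
      by apply/itemsP; right; exists p; rewrite // mem_cat pl.
    case: (next_time _ _ _) => [t|] /= a /itemsP[//|[p]].
      rewrite /candidates_of /= => pl ->; apply/itemsP; right; exists p => //.
      by rewrite /candidates_of Es.
    rewrite /candidates_of /= cats0 => pl ->; apply/itemsP; right; exists p => //.
    by rewrite mem_cat pl.
  case: (critical_level _ _) => [v|] //= a /itemsP[//|[p]].
  rewrite /candidates_of /= mem_cat => /orP[|].
    rewrite mem_filter => /andP[_ pl] ->; apply/itemsP; right; exists p => //.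
    by rewrite mem_cat pl.
  case/mapP=> p'; rewrite mem_filter => /andP[_]; rewrite mem_filter => /andP[_ pl] -> ->.
  by apply/itemsP; right; exists p' => //; rewrite mem_cat pl.
- have drop : {subset items (State qs (pendings st) (serving st)) <= items st}.
    move=> a /itemsP[/= aq|[p /= pl ->]]; apply/itemsP.
      by left; rewrite Eq inE aq orbT.
    by right; exists p.
  case: ifP => _ //; case: ifP => _ //= a /itemsP[aq|[p /=]].
    by apply/itemsP; left; rewrite Eq inE aq orbT.
  rewrite inE => /predU1P[-> ->|pl ->].
    by apply/itemsP; left; rewrite Eq mem_head.
  by apply/itemsP; right; exists p.
Qed.

Lemma known_state_items u (kn : delay_request i -> nat -> bool) st :
  (forall q n, (q, n) \in items st -> kn q n) ->
  (forall s, serving st = Some s -> u <= ahead s) -> known_state u kn st.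
Proof.
move=> H Hs; apply/and3P; split.
- by apply/allP => -[q n] qn; apply: H; apply/itemsP; left.
- apply/allP => p pl; apply: H; apply/itemsP; right; exists p => //.
  by rewrite mem_cat pl.
- case Es: (serving st) Hs => [s|] // -> //; apply/allP => p pl.
  apply: H; apply/itemsP; right; exists p => //.
  by rewrite mem_cat /candidates_of Es pl orbT.
Qed.

Lemma known_extend l l' u v q n : u <= v -> known l u q n -> known (l ++ l') v q n.
Proof.
move=> uv /andP[/eqP ln ru]; apply/andP; split; last exact: le_trans uv.
by rewrite onth_cat -onthTE ln.
Qed.

Lemma enqueue_nil n st : enqueue n st [::] = st.
Proof. by case: st => qs pe se; rewrite /enqueue /= cats0. Qed.

Variable codes : nat.

(** The state [st] already contains the requests arriving at [u], whereas [mem] encodes the one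
    before their arrival. The bound [codes] on descriptions keeps the prize-collecting inputs
    polynomial. *)
Record configuration (past future : seq (delay_request i)) (alarm : \bar R)
    (mem : data R) u st : Prop := {
  conf_next : next_event future alarm = u%:E;
  conf_mem : exists2 st0, enc_memory (size past) st0 mem &
    st = enqueue (size past) st0 [seq q <- future | release q <= u];
  conf_state : state_ok g k u st [seq q <- future | u < release q];
  conf_known : forall q n, (q, n) \in items st ->
    known (past ++ [seq q <- future | release q <= u]) u q n;
  conf_codes : forall q, q \in active st ++ [seq q <- future | u < release q] ->
    (data_size (request_code (req q)) <= codes)%N
}.

Lemma conf_known_state past future alarm mem u st :
  configuration past future alarm mem u st ->
  known_state u (known (past ++ [seq q <- future | release q <= u]) u) st.
Proof.
move=> c; apply: known_state_items; first exact: conf_known c.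
by move=> s Es; move: (state_service (conf_state c)); rewrite Es => /service_ahead.
Qed.

Section Next.
Variables (past future : seq (delay_request i)) (alarm : \bar R) (mem : data R).
Variables (u : R) (st : state i).
Hypothesis conf : configuration past future alarm mem u st.
Let new := [seq q <- future | release q <= u].
Let rest := [seq q <- future | u < release q].
Let past' := past ++ new.
Variable (d : data R).
Hypothesis good : good_solution g st d.
Let st' := (step g u st d).1.1.
Let alarm' : \bar R := if (step g u st d).1.2 is Some a then (Num.max u a)%:E else +oo%E.
Let trans := (step g u st d).2.
Let mem' := enc_state (size past') st'.

(** The offline schedule is quantified inside because the run does not depend on it, while the
    optimum is an infimum over all schedules. *)
Definition continues v st2 : Prop :=
  let rest2 := [seq q <- rest | v < release q] in
  [/\ configuration past' rest alarm' mem' v st2,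
    events_left g k v st2 rest2 + 1 <= events_left g k u st rest &
    forall (offline : schedule i) H A, accounts_ok k offline u st rest H A ->
      exists sv H' A',
      [/\ perm_eq (active st ++ rest) (active st2 ++ rest2 ++ sv),
        forall q, q \in sv -> release q <= u /\ has (fun d => serves d q) trans,
        \sum_(d <- trans) set_cost (decode i d) + \sum_(q <- sv) delay q u
          + potential g k offline st2 rest2 H' A' <= potential g k offline st rest H A &
        accounts_ok k offline v st2 rest2 H' A']].

Lemma conf_after : ([/\ next_event rest alarm' = +oo%E, active st ++ rest = [::] & trans = [::]])
  \/ exists v st2, continues v st2.
Proof.
have sok := conf_state conf.
have alarmN : alarm' != -oo%E by rewrite /alarm'; case: (_.1.2).
have spec := next_event_spec rest alarmN.
have [idl|busy] := boolP (idle st u); last first.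
  have [sok' al' ev'] := step_busy g_gt0 sok good busy.
  (* A busy transition rings again at once, and all later releases come strictly after [u]; so
     nothing arrives before the algorithm is idle. *)
  have ea : alarm' = u%:E by rewrite /alarm' al' maxxx.
  right; exists u, st'.
  have r2 : [seq q <- rest | u < release q] = rest.
    by rewrite filter_id.
  have n2 : [seq q <- rest | release q <= u] = [::].
    rewrite -filter_predI (eq_filter (a2 := pred0)) ?filter_pred0 // => q /=.
    by rewrite leNgt andNb.
  have nu : next_event rest alarm' = u%:E.
    case: (next_event rest alarm') spec => [v [lv av hv]|[ao _]|//]; last first.
      by move: ao; rewrite ea.
    case: hv => [|[q qr qv]]; first by rewrite ea => -[->].
    have := av u ea; rewrite -qv leNgt.
    by move: qr; rewrite mem_filter => /andP[->].
  rewrite /continues r2; split => //.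
    split => //; rewrite ?r2 ?n2 //.
    - by exists st'; [left|rewrite enqueue_nil].
    - move=> q n /step_items qn; rewrite cats0; apply: (conf_known conf qn).
    - move=> q; rewrite mem_cat => /orP[|qr]; last first.
        by apply: (conf_codes conf); rewrite mem_cat qr orbT.
      rewrite activeE => /mapP[a /step_items al ->].
      by apply: (conf_codes conf); rewrite mem_cat activeE map_f.
  move=> offline H A ok.
  have [H' [A' [sv [pe svP co ok']]]] := account_busy g_gt0 sok good busy ok.
  exists sv, H', A'; split => //.
  apply/permP => a; have /permP/(_ a) := pe; rewrite !count_cat => ->.
  by rewrite -addnA [(count a sv + _)%N]addnC.
have := step_idle g d idl => es.
have st'E : st' = st by rewrite /st' es.
have trE : trans = [::] by rewrite /trans es.
have qe : queue st = [::] by case/and3P: idl; case: (queue st).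
have se : serving st = None by case/and3P: idl => _; case: (serving st).
have alE : alarm' = if next_time (size (pendings st)) u (pendings st) is Some a
    then (Num.max u a)%:E else +oo%E by rewrite /alarm' es.
have ntP := @next_timeP _ _ _ (size (pendings st)) u (pendings st).
have ntH p : p \in pendings st -> release (prq p) <= u /\ 0 < plevel p / (size (pendings st))%:R.
  move=> pl; have pok := state_pending sok pl; split; first exact: pending_release pok.
  rewrite divr_gt0 ?(pending_level_gt0 pok) // ltr0n.
  by case: (pendings st) pl.
have {}ntP := ntP ntH.
case nE: (next_event rest alarm') spec => [v| |] // spec.
  have [lv av hv] := spec.
  have aE a : next_time (size (pendings st)) u (pendings st) = Some a ->
      u < a /\ alarm' = a%:E.
    move=> na; move: ntP; rewrite alE na => -[ua _ _]; split => //.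
    by rewrite max_r // ltW.
  have rel q : q \in rest -> u < release q by rewrite mem_filter => /andP[].
  have uv : u < v.
    case: hv => [|[q /rel qr <-] //].
    rewrite alE; case na: (next_time _ _ _) => [a|] // [<-].
    by have [ua _] := aE a na; rewrite lt_max ua orbT.
  have [||sok2 ev2] := idle_advance g_gt0 (size past') sok idl uv lv.
  - by move=> a /aE[_ /av].
  - case: hv => [hv|[q qr qv]]; [left|by right; exists q].
    move: hv; rewrite alE; case na: (next_time _ _ _) => [a|] // [<-].
    by have [ua _] := aE a na; rewrite max_r ?ltW.
  right; exists v, (enqueue (size past') st [seq q <- rest | release q <= v]).
  have itemsE q n : (q, n) \in items (enqueue (size past') st
     [seq q <- rest | release q <= v]) ->
     (q, n) \in items st \/ (q, n) \in zip [seq q <- rest | release q <= v]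
       (iota (size past') (size [seq q <- rest | release q <= v])).
    rewrite /items /= qe /= mem_cat => /orP[->|H]; first by right.
    by left; rewrite /candidates_of in H *; rewrite H.
  split.
  - split => //.
    + by exists st => //; left; rewrite /mem' st'E.
    + move=> q n /itemsE[/(conf_known conf) kq|].
        by apply: known_extend (ltW uv) kq.
      move=> /mem_zip_iota[qn nm on]; apply/andP; split.
        by rewrite onth_cat ltnNge nm /= on.
      by move: qn; rewrite mem_filter => /andP[].
    + move=> q; rewrite mem_cat => /orP[|].
        rewrite activeE => /mapP[[q' n] /itemsE[ql|/mem_zip_iota[ql _ _]] -> /=].
          apply: (conf_codes conf); rewrite mem_cat activeE.
          by apply/orP; left; apply/mapP; exists (q', n).
        apply: (conf_codes conf); rewrite mem_cat; apply/orP; right.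
        by move: ql; rewrite mem_filter => /andP[].
      rewrite mem_filter => /andP[_ qr].
      by apply: (conf_codes conf); rewrite mem_cat qr orbT.
  - exact: ev2.
  - move=> offline H A ok.
    have [pe po ok'] := account_advance g_gt0 (size past') idl uv ok lv.
    exists [::], H, A; rewrite cats0 trE !big_nil po; split => //.
    by rewrite !add0r.
(* [next_time] is undefined only on the empty list: without alarm and without future requests,
   nothing is left to serve. *)
left; have [ao ro] := spec.
have pe0 : pendings st = [::].
  by move: ntP ao; rewrite alE; case: (next_time _ _ _).
split => //.
by rewrite ro cats0 /active qe pe0 /candidates_of se.
Qed.

End Next.
End Configurations.

HB.instance Definition _ (R : realType) := gen_eqMixin (data R).

(** * Expected running time and cost of whole runs *)

Section Claims.
Variables (R : realType) (ND : nd_class R) (i : instance ND).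
Variables (P : program pc_op) (g k codes X Z : nat) (tP : R).
Hypothesis g_gt0 : (0 < g)%N.
Hypothesis P_halts : forall Q : pc_input i, penalties_ge0 Q ->
  halts_almost_surely R (pc_outcomes P Q).
Hypothesis P_time : forall Q : pc_input i, penalties_ge0 Q ->
  (data_size (pc_data Q) <= Z)%N ->
  (expectation_over (pc_outcomes P Q) (fun n => n%:R%:E) <= tP%:E)%E.
Hypothesis P_good : forall (Q : pc_input i) w E n, penalties_ge0 Q ->
  pc_run P Q w E n -> pc_cost Q E <= g%:R * pc_opt Q.
Hypothesis kX : (k <= X)%N.
Hypothesis mX : (nelem i <= X)%N.
Hypothesis Z_ok : (data_size (instance_data i) + k * (codes + 3) + codes + 10 <= Z)%N.
Hypothesis tP_ge0 : 0 <= tP.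
Implicit Types (Q : pc_input i) (w : seq bool) (st : state i).

Notation A := (online_algorithm P g).
Notation runP Q := (run (fun=> sat_oracle i) P (pc_data Q)).

Lemma pc_of_ge0 st : penalties_ge0 (pc_of g st).
Proof.
rewrite /pc_of; case: (queue st) => [|[q j] qs] /=.
  case: (serving st) => // s; rewrite /penalties_ge0 all_map.
  by elim: (candidates s) => //= p l ->; rewrite residual_ge0.
rewrite andbT addr_ge0 // mulr_ge0 //.
by apply: sumr_ge0 => e _; apply: cost_ge0.
Qed.

Definition answer_words Q : set (seq bool) := [set w | exists d n, runP Q w d n].
Definition answer_time Q w : nat := xget 0%N [set n | exists d, runP Q w d n].

Lemma answer_timeE Q w d n : runP Q w d n -> answer_time Q w = n.
Proof.
move=> r; rewrite /answer_time; case: xgetP => [m -> [d' r']|/(_ n)].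
  by have [_ ->] := run_unique r r'.
by case; exists d.
Qed.

Lemma answer_outcomes Q : [set w | exists n, pc_outcomes P Q (w, n)]%classic = answer_words Q.
Proof.
rewrite eqEsubset; split => w /=.
  by move=> [n [E [d r _]]]; exists d, n.
by move=> [d [n r]]; exists n, (decode_set (nelem i) d), d.
Qed.

Lemma answer_val Q w n : pc_outcomes P Q (w, n) -> n = answer_time Q w.
Proof. by move=> [E [d r _]]; rewrite (answer_timeE r). Qed.

Lemma answer_mass Q : penalties_ge0 Q -> coin_sum (answer_words Q) (fun=> 1%E) = 1%E :> \bar R.
Proof.
move=> /P_halts; rewrite /halts_almost_surely (expectation_coin_sum _ (@answer_val Q)).
by rewrite answer_outcomes.
Qed.

Lemma answer_time_le Q : penalties_ge0 Q -> (data_size (pc_data Q) <= Z)%N ->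
  (coin_sum (answer_words Q) (fun w => (answer_time Q w)%:R%:E) <= tP%:E)%E.
Proof.
move=> /P_time H /H; rewrite (expectation_coin_sum _ (@answer_val Q)).
by rewrite answer_outcomes.
Qed.

Lemma answer_prefix_free Q : prefix_free (answer_words Q).
Proof.
move=> w w' u u' [d [n r]] [d' [n' r']] e.
by have [] := run_functional r r' e.
Qed.

Lemma answer_good st w d n : runP (pc_of g st) w d n -> good_solution g st d.
Proof.
move=> r; apply: (@P_good _ w _ n); first exact: pc_of_ge0.
by exists d.
Qed.

Lemma data_size_dlist (l : seq (data R)) m :
  all (fun d => data_size d <= m)%N l ->
  (data_size (dlist l) <= size l * (m + 1) + 1)%N.
Proof. by elim: l => //= d l IH /andP[dm /IH]; rewrite mulSn; lia. Qed.

Lemma size_pc_data past future alarm mem u st :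
  configuration g k codes past future alarm mem u st ->
  (data_size (pc_data (pc_of g st)) <= Z)%N.
Proof.
move=> c; apply: leq_trans Z_ok.
have cod q : q \in active st -> (data_size (request_code (req q)) <= codes)%N.
  by move=> qa; apply: (conf_codes c); rewrite mem_cat qa.
have consE (a b : data R) : data_size (DCons a b) = (data_size a + data_size b).+1 by [].
rewrite /pc_data consE.
suff : (data_size (dlist [seq DCons (request_code qp.1) (DReal qp.2) | qp <- pc_of g st])
   <= k * (codes + 3) + codes + 5)%N by lia.
rewrite /pc_of; case Eq : (queue st) => [|[q j] qs].
  case Es : (serving st) => [s|] /=; last by lia.
  have sk : (size (candidates s) <= k)%N.
    by have := state_size (conf_state c); rewrite /candidates_of Es; lia.
  apply: leq_trans (@data_size_dlist _ (codes + 2) _) _.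
    rewrite /service_pc !all_map; apply/allP => p pl /=.
    have : (data_size (request_code (req (prq p))) <= codes)%N.
      apply: cod; rewrite /active mem_cat map_f ?orbT //.
      by rewrite mem_cat /candidates_of Es pl orbT.
    by lia.
  rewrite !size_map; nia.
have : (data_size (request_code (req q)) <= codes)%N.
  by apply: cod; rewrite /active Eq mem_head.
by rewrite /=; lia.
Qed.

Definition step_words past future alarm mem : set (seq bool) :=
  [set w | exists (s : schedule i) n, online_steps A past future alarm mem w s n].

Definition steps_time past future alarm mem w : nat :=
  xget 0%N [set n | exists s : schedule i, online_steps A past future alarm mem w s n].

Lemma steps_timeE past future alarm mem w (s : schedule i) n :
  online_steps A past future alarm mem w s n -> steps_time past future alarm mem w = n.
Proof.
move=> r; rewrite /steps_time; case: xgetP => [m -> [s' r']|/(_ n)].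
  by have [_ ->] := online_steps_unique r r'.
by case; exists s.
Qed.

Definition fixed_time : nat :=
  (time_bound (fun=> X) p_enqueue + time_bound (fun=> X) (p_pc g)
   + time_bound (fun=> X) (p_step g) + 100 * (X + 1) * (Z + 1) + 30)%N.
Definition slowdown : nat := (100 * (X + 1) * psize P + 1)%N.
Definition mean_event_time : R := fixed_time%:R + slowdown%:R * tP.

Lemma event_time_le z n : (z <= Z)%N ->
  (event_time P g X z n <= fixed_time + slowdown * n)%N.
Proof.
move=> zZ; rewrite /event_time /fixed_time /slowdown.
have : (100 * (X + 1) * (z + psize P * n + 1) <=
   100 * (X + 1) * (Z + 1) + 100 * (X + 1) * psize P * n)%N.
  have -> : (z + psize P * n + 1 = z + 1 + psize P * n)%N by lia.
  rewrite mulnDr !mulnA leq_add2r leq_mul2l; apply/orP; right; lia.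
by lia.
Qed.

Section OneConfiguration.
Variables (past future : seq (delay_request i)) (alarm : \bar R) (mem : data R).
Variables (u : R) (st : state i).
Hypothesis conf : configuration g k codes past future alarm mem u st.
Let new := [seq q <- future | release q <= u].
Let rest := [seq q <- future | u < release q].
Let past' := past ++ new.
Let out d := event_output g past new u (enqueue (size past) st new) d.

Definition after (d : data R) : \bar R * data R :=
  (if (step g u st d).1.2 is Some a then (Num.max u a)%:E else +oo%E,
   enc_state (size past') (step g u st d).1.1).

Lemma conf_event : exists st0, st = enqueue (size past) st0 new /\
  (forall w d n, runP (pc_of g st) w d n ->
    exists2 t, run (online_oracle past') A (event_data u new mem) w
        (event_output g past new u st0 d) t & (t <= fixed_time + slowdown * n)%N) /\
  (forall w o n, run (online_oracle past') A (event_data u new mem) w o n ->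
    exists d n', runP (pc_of g st) w d n').
Proof.
have [st0 m0 Est] := conf_mem conf; exists st0; split => //.
have kn := conf_known_state conf.
have szk := state_size (conf_state conf).
rewrite Est in kn szk *.
have sz : [/\ (size new <= X)%N, (size (queue st0) <= X)%N,
   (size (pendings (enqueue (size past) st0 new)) <= X)%N &
   (size (candidates_of (enqueue (size past) st0 new)) <= X)%N].
  have qE : size (queue (enqueue (size past) st0 new)) = (size (queue st0) + size new)%N.
    by rewrite /= size_cat size_zip size_iota minnn.
  move: szk; rewrite qE; move: (size _) (size _) (size _) (size _) (size _) kX.
  by move=> a b c e f kX' szk; split; lia.
case: sz => s1 s2 s3 s4; split.
  move=> w d n r; have [t rt tb] := @event_run _ _ _ P g past new u st0 mem X m0 kn
    s1 s2 mX s3 s4 w d n r.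
  exists t => //; apply: leq_trans tb _; apply: event_time_le.
  by have := size_pc_data conf; rewrite Est.
move=> w o n; exact: (@event_run_inv _ _ _ P g past new u st0 mem X m0 kn s1 s2 mX s4).
Qed.

Lemma steps_event w d n w2 (s : schedule i) m :
  runP (pc_of g st) w d n ->
  online_steps A past' rest (after d).1 (after d).2 w2 s m ->
  exists2 t, online_steps A past future alarm mem (w ++ w2)
    ([seq (u, decode i x) | x <- (step g u st d).2] ++ s) (t + m) &
    (t <= fixed_time + slowdown * n)%N.
Proof.
move=> r st2; have [st0 [Est [fwd _]]] := conf_event.
have [t rt tb] := fwd _ _ _ r; exists t => //.
have := @OnlineEvent _ _ A i past future alarm mem u w w2
  (event_output g past new u st0 d) s t m (conf_next conf) rt.
rewrite /new_alarm /new_memory /transmissions /event_output -Est.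
move: st2; rewrite /after; case: (step g u st d) => [[st' al] tr] /= st2.
rewrite undlist_dlist size_cat in st2 *; apply.
by case: al st2.
Qed.

Lemma steps_event_inv w (s : schedule i) n :
  online_steps A past future alarm mem w s n -> exists w1 w2 d n1 s2 m,
  [/\ w = w1 ++ w2, runP (pc_of g st) w1 d n1,
    online_steps A past' rest (after d).1 (after d).2 w2 s2 m &
    s = [seq (u, decode i x) | x <- (step g u st d).2] ++ s2].
Proof.
move=> H; have [st0 [Est [fwd bwd]]] := conf_event.
inversion H; subst; first by rewrite (conf_next conf) in H0.
rewrite (conf_next conf) in H0; case: H0 => ?; subst t.
have [d [n' r]] := bwd _ _ _ H1; have [t rt _] := fwd _ _ _ r.
have [? _] := run_unique H1 rt; subst out0.
exists w1, w2, d, n'.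
move: H2; rewrite /new_alarm /new_memory /transmissions /event_output -Est.
rewrite /after; case: (step _ _ _ d) => [[st' al] tr] /= H2.
exists s0, n2; split => //; last by rewrite undlist_dlist.
by move: H2; rewrite size_cat; case: (al).
Qed.

End OneConfiguration.

Lemma mean_event_time_ge0 : 0 <= mean_event_time.
Proof. by rewrite /mean_event_time addr_ge0 ?ler0n // mulr_ge0 ?ler0n. Qed.

Lemma stopped past future alarm mem : next_event future alarm = +oo%E ->
  step_words past future alarm mem = [set [::]]%classic /\
  steps_time past future alarm mem [::] = 0%N.
Proof.
move=> ne; split; last exact: (steps_timeE (OnlineEnd _ _ _ ne)).
rewrite eqEsubset; split => w /=; last first.
  by move=> ->; exists [::], 0%N; apply: OnlineEnd.
by move=> [s [n H]]; inversion H; subst => //; rewrite ne in H0.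
Qed.

Lemma event_mean past future alarm mem u st (t2 : R) :
  configuration g k codes past future alarm mem u st ->
  let past' := past ++ [seq q <- future | release q <= u] in
  let rest := [seq q <- future | u < release q] in
  0 <= t2 ->
  (forall w d n, runP (pc_of g st) w d n ->
    let next := after past future u st d in
    coin_sum (step_words past' rest next.1 next.2) (fun=> 1%E) = 1%E :> \bar R /\
    (coin_sum (step_words past' rest next.1 next.2)
       (fun w => (steps_time past' rest next.1 next.2 w)%:R%:E) <= t2%:E)%E) ->
  coin_sum (step_words past future alarm mem) (fun=> 1%E) = 1%E :> \bar R /\
  (coin_sum (step_words past future alarm mem)
     (fun w => (steps_time past future alarm mem w)%:R%:E)
    <= (mean_event_time + t2)%:E)%E.
Proof.
move=> conf past' rest t20 H; pose Q := pc_of g st.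
pose next := after past future u st.
(* The word [w1] determines the answer [d], so the existential ranges over at most one continuation
   and yields a second stage that depends on [w1] alone. *)
pose E w1 : set (seq bool) := [set w2 | exists d n, runP Q w1 d n /\
    step_words past' rest (next d).1 (next d).2 w2]%classic.
pose f2 w1 w2 := xget 0%N [set m | exists d n, runP Q w1 d n /\
    m = steps_time past' rest (next d).1 (next d).2 w2]%classic.
have DE : step_words past future alarm mem = concat_set (answer_words Q) E.
  rewrite eqEsubset; split => w /=.
    move=> [s [n /(steps_event_inv conf)[w1 [w2 [d [n1 [s2 [m [-> r st2 _]]]]]]]]].
    exists w1, w2; split => //; first by exists d, n1.
    by exists d, n1; split => //; exists s2, m.
  move=> [w1 [w2 [_ [d [n [r [s2 [m st2]]]]] ->]]].
  by have [t ? _] := steps_event conf r st2; eexists; eexists; eassumption.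
have EE w1 d n : runP Q w1 d n -> E w1 = step_words past' rest (next d).1 (next d).2.
  move=> r; rewrite eqEsubset; split => w2 /=; last by move=> ?; exists d, n.
  move=> [d' [n' [r' ?]]].
  by have [-> _] := run_unique r r'.
have fE w1 w2 d n : runP Q w1 d n ->
    f2 w1 w2 = steps_time past' rest (next d).1 (next d).2 w2.
  move=> r; rewrite /f2; case: xgetP => [m -> [d' [n' [r' ->]]]|].
    by have [-> _] := run_unique r r'.
  by move=> /(_ (steps_time past' rest (next d).1 (next d).2 w2)); case; exists d, n.
have pc0 := pc_of_ge0 st; have szQ := size_pc_data conf.
rewrite DE; apply: (@coin_sum_step R _ E _
   (fun w => fixed_time + slowdown * answer_time Q w)%N f2) => //.
- exact: answer_prefix_free.
- exact: answer_mass.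
- by apply: coin_sum_affine; [apply: answer_mass|apply: answer_time_le].
- move=> w [d [n r]]; have [H1 H2] := H _ _ _ r; rewrite (EE _ _ _ r); split => //.
  apply: le_trans H2; apply: le_coin_sum => w2 _; by rewrite (fE _ _ _ _ r).
- move=> w1 w2 _ [d [n [r [s2 [m st2]]]]].
  have [t st1 tb] := steps_event conf r st2.
  rewrite (steps_timeE st1) (fE _ _ _ _ r) (steps_timeE st2) leq_add2r.
  by rewrite (answer_timeE r).
Qed.

(** Each continuation takes 1 from the nonnegative quantity [events_left]. The bound has [N + 1]
    events because the one at hand takes place even when [N = 0]. *)
Lemma steps_mean N past future alarm mem u st :
  configuration g k codes past future alarm mem u st ->
  events_left g k u st [seq q <- future | u < release q] <= N%:R ->
  coin_sum (step_words past future alarm mem) (fun=> 1%E) = 1%E :> \bar R /\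
  (coin_sum (step_words past future alarm mem)
     (fun w => (steps_time past future alarm mem w)%:R%:E)
    <= (N.+1%:R * mean_event_time)%:E)%E.
Proof.
elim: N past future alarm mem u st => [|N IH] past future alarm mem u st conf ev.
  have -> : 1%:R * mean_event_time = mean_event_time + 0 by rewrite mul1r addr0.
  apply: (event_mean conf) => // w d n r next.
  have [[ne _ _]|[v [st2 [conf2 ev2 _]]]] := conf_after g_gt0 conf (answer_good r).
    have [-> z] := stopped (past ++ [seq q <- future | release q <= u]) (after past future u st d).2 ne.
    by rewrite /coin_sum !esum_set1 ?z ?expr0 ?mule1 ?mule0.
  exfalso; have := events_left_ge0 g_gt0 (conf_state conf2).
  by move: ev2 ev; set e := events_left _ _ _ _ _; set e' := events_left _ _ _ _ _; lra.
rewrite -[N.+2]add1n natrD mulrDl mul1r.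
apply: (event_mean conf).
  by rewrite mulr_ge0 ?ler0n // mean_event_time_ge0.
move=> w d n r next.
have [[ne _ _]|[v [st2 [conf2 ev2 _]]]] := conf_after g_gt0 conf (answer_good r).
  have [-> z] := stopped (past ++ [seq q <- future | release q <= u]) (after past future u st d).2 ne.
  rewrite /coin_sum !esum_set1 ?z ?expr0 ?mule1 ?mule0 //.
  by split => //; rewrite lee_fin mulr_ge0 ?ler0n // mean_event_time_ge0.
apply: IH conf2 _; rewrite -natr1 in ev.
by move: ev2 ev; set e := events_left _ _ _ _ _; set e' := events_left _ _ _ _ _; lra.
Qed.

Section DelayCosts.
Implicit Types (s : schedule i) (q : delay_request i).

Lemma service_time_ge s q : ((release q)%:E <= service_time s q)%E.
Proof.
rewrite /service_time; elim: s => [|tE s IH]; first by rewrite big_nil leey.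
rewrite big_cons; case: ifP => // /andP[rt _].
by rewrite le_min IH lee_fin rt.
Qed.

Lemma service_time_le s q tE : tE \in s -> release q <= tE.1 ->
  satisfies tE.2 (req q) -> (service_time s q <= tE.1%:E)%E.
Proof.
move=> + rt sat; rewrite /service_time; elim: s => // a s IH.
rewrite inE big_cons => /predU1P[<-|/IH H]; first by rewrite rt sat ge_min lexx.
by case: ifP => // _; rewrite ge_min H orbT.
Qed.

Lemma delay_cost_mono s s' q : (service_time s q <= service_time s' q)%E ->
  (delay_cost s q <= delay_cost s' q)%E.
Proof.
have := service_time_ge s q; have := service_time_ge s' q; rewrite /delay_cost.
case: (service_time s' q) => [t'| |] //; last by move=> *; rewrite leey.
case: (service_time s q) => [t| |] // _; rewrite !lee_fin => rt tt'.
exact: delay_mono.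
Qed.

Lemma delay_cost_cat s s' q : (delay_cost (s ++ s') q <= delay_cost s' q)%E.
Proof.
apply: delay_cost_mono; rewrite /service_time big_cat /=.
by rewrite ge_min lexx orbT.
Qed.

Lemma delay_cost_served s q tE : tE \in s -> release q <= tE.1 ->
  satisfies tE.2 (req q) -> (delay_cost s q <= (delay q tE.1)%:E)%E.
Proof.
move=> tEs rt sat; have := service_time_le tEs rt sat.
have := service_time_ge s q; rewrite /delay_cost.
case: (service_time s q) => [t| |] //; rewrite !lee_fin => rt' tt'.
exact: delay_mono.
Qed.

End DelayCosts.

Lemma lee_sum_seq (T : eqType) (l : seq T) (F G : T -> \bar R) :
  (forall x, x \in l -> (F x <= G x)%E) -> (\sum_(x <- l) F x <= \sum_(x <- l) G x)%E.
Proof. by move=> H; rewrite big_seq [leRHS]big_seq; apply: lee_sum. Qed.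

(** Telescoping of the payments along one run, whatever its coins. Requests of [active st ++ rest]
    are those still to be served; transmissions put in front of a schedule can only lower delay
    costs, and the potential left at the end is nonnegative. *)
Lemma steps_paid (offline : schedule i) N past future alarm mem u st H C w s n :
  configuration g k codes past future alarm mem u st ->
  let rest := [seq q <- future | u < release q] in
  events_left g k u st rest <= N%:R ->
  accounts_ok k offline u st rest H C ->
  online_steps A past future alarm mem w s n ->
  ((\sum_(tE <- s) set_cost tE.2)%:E + \sum_(q <- active st ++ rest) delay_cost s q
    <= (potential g k offline st rest H C)%:E)%E.
Proof.
elim: N past future alarm mem u st H C w s n =>
    [|N IH] past future alarm mem u st H C w s n conf rest ev acc run1.
  have [w1 [w2 [d [n1 [s2 [m [_ r st2 ->]]]]]]] := steps_event_inv conf run1.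
  have [[ne ar tr]|[v [st' [conf2 ev2 _]]]] := conf_after g_gt0 conf (answer_good r).
    rewrite tr ar big_nil adde0 /=.
    have -> : s2 = [::] by inversion st2; subst => //; rewrite ne in H0.
    rewrite big_nil lee_fin; exact: (potential_ge0 (conf_state conf) acc).
  exfalso; have := events_left_ge0 g_gt0 (conf_state conf2).
  by move: ev2 ev; rewrite -/rest; set e := events_left _ _ _ _ _; set e' := events_left _ _ _ _ _; lra.
have [w1 [w2 [d [n1 [s2 [m [_ r st2 ->]]]]]]] := steps_event_inv conf run1.
have [[ne ar tr]|[v [st' [conf2 ev2 co]]]] := conf_after g_gt0 conf (answer_good r).
  rewrite tr ar big_nil adde0 /=.
  have -> : s2 = [::] by inversion st2; subst => //; rewrite ne in H0.
  rewrite big_nil lee_fin; exact: (potential_ge0 (conf_state conf) acc).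
have [sv [H' [C' [pe svP paid acc']]]] := co _ _ _ acc.
have ev' : events_left g k v st' [seq q <- rest | v < release q] <= N%:R.
  rewrite -natr1 in ev.
  by move: ev2 ev; rewrite -/rest; set e := events_left _ _ _ _ _; set e' := events_left _ _ _ _ _; lra.
have {IH} IH := IH _ _ _ _ _ _ _ _ _ _ _ conf2 ev' acc' st2.
set trans := (step g u st d).2 in svP paid *.
set tr := [seq (u, decode i x) | x <- trans].
rewrite big_cat /= EFinD (perm_big _ pe) /= catA big_cat /=.
have svle : (\sum_(q <- sv) delay_cost (tr ++ s2) q <= (\sum_(q <- sv) delay q u)%:E)%E.
  rewrite -sumEFin; apply: lee_sum_seq => q /svP[ru /hasP[x xt sx]].
  apply: (@delay_cost_served (tr ++ s2) q (u, decode i x)) => //.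
  by rewrite mem_cat /tr map_f.
pose rest2 := [seq q <- rest | v < release q].
have rle : (\sum_(q <- active st' ++ rest2) delay_cost (tr ++ s2) q
    <= \sum_(q <- active st' ++ rest2) delay_cost s2 q)%E.
  by apply: lee_sum_seq => q _; apply: delay_cost_cat.
apply: (@le_trans _ _ ((\sum_(d <- trans) set_cost (decode i d))%:E +
   (\sum_(q <- sv) delay q u)%:E + (potential g k offline st' rest2 H' C')%:E)%E);
  last by rewrite -!EFinD lee_fin.
rewrite big_map /= [X in (_ + X <= _)%E]addeC addeACA; apply: leeD; first exact: leeD.
by apply: le_trans IH; apply: leeD.
Qed.

End Claims.

(** * Conclusion *)

Lemma delay_cost_ge0 (R : realType) (ND : nd_class R) (i : instance ND)
    (s : schedule i) q : (0 <= delay_cost s q)%E.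
Proof.
rewrite /delay_cost; have := service_time_ge s q.
case: (service_time s q) => [t| |] //; rewrite ?lee_fin => rt.
exact: delay_ge0.
Qed.

Lemma schedule_cost_ge0 (R : realType) (ND : nd_class R) (i : instance ND)
    (rs : seq (delay_request i)) (s : schedule i) : (0 <= schedule_cost rs s)%E.
Proof.
rewrite /schedule_cost adde_ge0 //; last by apply: sume_ge0 => q _; apply: delay_cost_ge0.
by rewrite lee_fin; apply: sumr_ge0 => S _; apply: set_cost_ge0.
Qed.

(** A deterministic run has the empty coin word, of probability 1, so expectations are plain values
    and only the randomized statement needs a proof. *)
Lemma deterministic_pc_randomized (R : realType) (ND : nd_class R) P (gamma : R) :
  deterministic_pc_approx ND P gamma -> randomized_pc_approx ND P gamma.
Proof.
move=> [dP [a [b H]]]; exists a, b => i Q Q0.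
have [E [n [[out r EE] nb co]]] := H i Q Q0.
have uniq w E' n' : pc_run P Q w E' n' -> [/\ w = [::], E' = E & n' = n].
  move=> [out' r' ->]; have [w0 oe] := run_deterministic r dP r'.
  subst w out'; have [_ ->] := run_unique r' r.
  by rewrite EE.
have SE : pc_outcomes P Q = [set ([::], n)]%classic.
  rewrite eqEsubset; split => -[w n'] /=.
    by move=> [E' /uniq[/= -> _ ->]].
  by move=> [-> ->]; exists E, out.
split.
- by rewrite /halts_almost_surely /expectation_over SE esum_set1 expr0 mul1e.
- rewrite /expectation_over SE esum_set1 /= expr0 mul1e lee_fin ?ler0n //.
  by rewrite ler_nat.
- by move=> w E' n' /uniq[_ -> _].
Qed.

Lemma deterministic_steps (R : realType) (ND : nd_class R) (i : instance ND) A
    past future alarm mem w (s : schedule i) n :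
  deterministic A -> online_steps A past future alarm mem w s n -> w = [::].
Proof.
move=> dA; elim=> //= {past future alarm mem w s n} past future alarm mem t w1 w2 out s n1 n2 _.
by move=> [s' E _] _ ->; rewrite (deterministic_exec dA E).
Qed.

(** Almost sure halting provides an outcome, since the sum over an empty set would be 0; its coin
    word is empty, and it is the only one. *)
Lemma randomized_competitive_deterministic (R : realType) (ND : nd_class R) A ratio :
  deterministic A -> randomized_competitive ND A ratio ->
  deterministic_competitive ND A ratio.
Proof.
move=> dA [a [b H]]; split => //; exists a, b => i rs.
have [halts time comp] := H i rs.
have [[w [s n]] run1] : exists o, online_outcomes A rs o.
  apply: contrapT => no.
  have S0 : online_outcomes A rs = set0.
    by rewrite eqEsubset; split => o // ro; apply: no; exists o.
  move: halts; rewrite /halts_almost_surely S0 /expectation_over esum_set0 => /eqP.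
  by rewrite eqe eq_sym oner_eq0.
rewrite /online_outcomes /= in run1.
have w0 : w = [::] := deterministic_steps dA run1; subst w.
have SE : online_outcomes A rs = [set ([::], (s, n))]%classic.
  rewrite eqEsubset; split => -[w [s' n']] /=; last by move=> [-> -> ->].
  move=> run2; have w0 : w = [::] := deterministic_steps dA run2; subst w.
  by have [/= -> ->] := online_steps_unique run2 run1.
exists s, n; split => //.
- move: time; rewrite /expectation_over SE esum_set1 /= expr0 mul1e ?lee_fin ?ler0n //.
  by rewrite ler_nat.
- move: comp; rewrite /expectation_over SE esum_set1 /= expr0 mul1e //.
  exact: schedule_cost_ge0.
Qed.

(** * The initial configuration *)

Section Initial.
Variables (R : realType) (ND : nd_class R) (i : instance ND) (g codes : nat).
Hypothesis g_gt0 : (0 < g)%N.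
Variable rs : seq (delay_request i).
Let k := size rs.
Hypothesis codes_ok : forall q, q \in rs -> (data_size (request_code (req q)) <= codes)%N.
Variable u : R.
Hypothesis start : next_event rs +oo%E = u%:E.
Let new := [seq q <- rs | release q <= u].
Let rest := [seq q <- rs | u < release q].
Definition initial_state : state i := enqueue 0 (State [::] [::] None) new.

Lemma queue_initial : [seq a.1 | a <- queue initial_state] = new.
Proof. by rewrite /= -/(unzip1 _) unzip1_zip // size_iota. Qed.

Lemma perm_initial : perm_eq (active initial_state ++ rest) rs.
Proof.
rewrite /active queue_initial /= cats0.
rewrite (_ : rest = [seq q <- rs | ~~ (release q <= u)]); last first.
  by apply: eq_filter => q; rewrite ltNge.
by rewrite perm_filterC.
Qed.

Lemma conf_initial :
  configuration g k codes [::] rs +oo%E DNil u initial_state.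
Proof.
have := next_event_spec rs (isT : (+oo : \bar R)%E != -oo%E); rewrite start => -[lb _ _].
have szk : (size new + size rest = k)%N.
  by have /perm_size := perm_initial; rewrite /active queue_initial /= cats0 size_cat.
split => //.
- by exists (State [::] [::] None) => //; right.
- split => //=.
  + by rewrite size_zip size_iota minnn /candidates_of /= !addn0 szk.
  + move=> q n /mem_zip_iota[qn _ _]; apply/eqP; rewrite eq_le.
    by move: qn; rewrite mem_filter => /andP[-> /lb].
  + by move=> q; rewrite mem_filter => /andP[].
  + by right.
  + by move=> x x0; rewrite /residual_sum big_nil mulr_ge0 // ltW.
- move=> q n; rewrite /items /= cats0 => /mem_zip_iota[qn _ on].
  apply/andP; split; first by rewrite subn0 in on; rewrite on.
  by move: qn; rewrite mem_filter => /andP[].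
- by move=> q; rewrite (perm_mem perm_initial); apply: codes_ok.
Qed.

(** A natural polynomial bound on the initial [events_left], with [4 * x] in place of
    [2 * ln (2 * k)]. *)
Definition max_events (x : nat) : nat :=
  (((x ^ 2 * (g + 1) + 2 * x ^ 2 + 2) * (4 * x) + 2 * x + 2) * x)%N.

Lemma events_initial x : (k <= x)%N ->
  events_left g k u initial_state rest <= (max_events x)%:R.
Proof.
move=> kx; case: (posnP k) => [k0|k0].
  have rs0 : rs = [::] by apply: size0nil.
  rewrite /events_left /initial_state /new /rest rs0 /= big_nil !mulr0 !addr0.
  exact: ler0n.
have kR : 0 < k%:R :> R by rewrite ltr0n.
have ln2k : 2 * ln (2 * k%:R) <= 4 * k%:R :> R.
  by have := @ln_le_self R (2 * k%:R); rewrite mulr_gt0 // => /(_ isT); lra.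
have W : queue_worth R g k + 1 <=
   (((k ^ 2 * (g + 1) + 2 * k ^ 2 + 2) * (4 * k) + 2 * k + 2)%N)%:R.
  rewrite !natrD !natrM !natrD !natrM /queue_worth /service_worth.
  have S0 : 0 <= k%:R ^+ 2 * (g%:R + 1) + 2 * k%:R ^+ 2 + 2 :> R.
    by rewrite !addr_ge0 // mulr_ge0 ?exprn_ge0 // addr_ge0.
  by have := ler_wpM2l S0 ln2k; lra.
have Q1 := @queue_worth_ge1 R g k k0.
apply: le_trans (_ : (queue_worth R g k + 1) * k%:R <= _).
  have szk : (size new + size rest = k)%N.
    by have /perm_size := perm_initial; rewrite /active queue_initial /= cats0 size_cat.
  rewrite /events_left /= size_zip size_iota minnn big_nil !addr0 -szk natrD.
  rewrite -/rest -/new.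
  by have : 0 <= (size new)%:R :> R by []; nra.
apply: le_trans (ler_wpM2r (ltW kR) W) _.
by rewrite -natrM ler_nat /max_events !(leq_mul, leq_add) // leq_exp2r.
Qed.

Lemma accounts_initial (offline : schedule i) :
  (forall q, q \in rs -> offline_serves offline q) ->
  accounts_ok k offline u initial_state rest [::] [::].
Proof.
move=> off; split => //=; first by move=> q; rewrite (perm_mem perm_initial); apply: off.
Qed.

(** Offline transmissions enter with [4 * 9 = 36] times [unit_cost * L], offline delays with
    [4 * unit_cost] and once more through the delay at release; 72 covers all of them. *)
Lemma potential_initial (offline : schedule i) :
  (forall q, q \in rs -> offline_serves offline q) ->
  potential g k offline initial_state rest [::] [::] <=
  72 * (3 * g%:R + 4) * log_min R k (nelem i) *
   (\sum_(S <- offline) set_cost S.2 + \sum_(q <- rs) offline_delay offline q).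
Proof.
move=> off; rewrite /potential /candidates_of /= !big_nil queue_initial.
have perm : perm_eq (new ++ rest) rs.
  by have := perm_initial; rewrite /active queue_initial /= cats0.
rewrite !(perm_big _ perm) /= !addr0.
under eq_bigr do rewrite subr0.
rewrite -big_distrr /=.
have L1 := @L_ge1 R ND i k.
set L := log_min _ _ _ in L1 *.
set c := \sum_(S <- offline) _.
set D := \sum_(q <- rs) offline_delay _ _.
have c0 : 0 <= c by apply: sumr_ge0 => S _; apply: set_cost_ge0.
have D0 : 0 <= D.
  by apply: sumr_ge0_seq => q /off; apply: offline_delay_ge0.
have dD : \sum_(q <- rs) delay q (release q) <= D.
  by apply: ler_sum_seq => q /off; apply: offline_delay_release.
have g0 : 0 <= g%:R :> R by [].
rewrite /unit_cost; set U := 3 * g%:R + 4.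
have U1 : 1 <= U by rewrite /U; lra.
have h1 : 0 <= U * (L * c) by rewrite !mulr_ge0 //; lra.
have h2 : D <= U * (L * D).
  have : D <= L * D by rewrite ler_peMl.
  by move=> h; apply: le_trans h _; rewrite ler_peMl // mulr_ge0 //; lra.
have h3 : U * D <= U * (L * D) by rewrite ler_wpM2l ?ler_peMl //; lra.
by nra.
Qed.

End Initial.

Lemma schedule_costE (R : realType) (ND : nd_class R) (i : instance ND)
    (rs : seq (delay_request i)) (offline : schedule i) :
  (forall q, q \in rs -> offline_serves offline q) ->
  schedule_cost rs offline = (\sum_(S <- offline) set_cost S.2 +
    \sum_(q <- rs) offline_delay offline q)%:E.
Proof.
move=> off; rewrite /schedule_cost EFinD; congr (_ + _)%E.
rewrite -sumEFin big_seq [RHS]big_seq; apply: eq_bigr => q /off.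
rewrite /offline_serves /offline_delay /delay_cost.
by case: (service_time offline q).
Qed.

Lemma schedule_cost_unserved (R : realType) (ND : nd_class R) (i : instance ND)
    (rs : seq (delay_request i)) (offline : schedule i) q :
  q \in rs -> ~~ offline_serves offline q -> schedule_cost rs offline = +oo%E.
Proof.
move=> qrs un; have qy : delay_cost offline q = +oo%E.
  move: un; rewrite /offline_serves /delay_cost.
  by case: (service_time offline q).
have : (\sum_(q <- rs) delay_cost offline q = +oo)%E.
  rewrite (big_rem q) //= qy addye //.
  apply/eqP => H; have : (0 <= \sum_(q0 <- rem q rs) delay_cost offline q0)%E.
    by apply: sume_ge0 => q' _; apply: delay_cost_ge0.
  by rewrite H.
by move=> H; rewrite /schedule_cost H addey.
Qed.

Section OnlineSize.
Variables (R : realType) (ND : nd_class R) (i : instance ND).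
Variable rs : seq (delay_request i).

Lemma data_size_gt0 (d : data R) : (0 < data_size d)%N.
Proof. by case: d. Qed.

Lemma online_size_gt0 : (0 < online_size rs)%N.
Proof. by rewrite /online_size addn_gt0 data_size_gt0. Qed.

Lemma instance_online_size : (data_size (instance_data i) <= online_size rs)%N.
Proof. exact: leq_addr. Qed.

Lemma nelem_online_size : (nelem i <= online_size rs)%N.
Proof.
apply: leq_trans instance_online_size.
have dlist_size (l : seq (data R)) : (size l <= data_size (dlist l))%N.
  by elim: l => //= d l IH; lia.
have := dlist_size [seq DReal (cost e) | e <- enum 'I_(nelem i)].
by rewrite size_map size_enum_ord /=; lia.
Qed.

Lemma size_online_size : (size rs <= online_size rs)%N.
Proof.
rewrite /online_size -sum1_size; apply: leq_trans (leq_addl _ _).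
exact: leq_sum.
Qed.

Lemma code_online_size q : q \in rs ->
  (data_size (request_code (req q)) <= online_size rs)%N.
Proof.
by move=> qrs; rewrite /online_size (big_rem q) //=; lia.
Qed.

End OnlineSize.

Definition query_size (x : nat) : nat := (x + x * (x + 3) + x + 10)%N.

(** The number of events times the mean time of one, with every length bounded by the input size
    [x]. *)
Definition running_time (P : program pc_op) (g a b x : nat) : nat :=
  ((max_events g x).+1 *
   (fixed_time g x (query_size x) + slowdown P x * (a * query_size x ^ b)))%N.

Ltac prove_poly_bounded := match goal with
  | |- poly_bounded (fun=> ?c) => exact: poly_bounded_cst
  | |- poly_bounded (fun x => x) => exact: poly_bounded_id
  | |- poly_bounded (fun x => (@?f x + @?h x)%N) =>
      apply: (@poly_boundedD f h); prove_poly_bounded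
  | |- poly_bounded (fun x => (@?f x * @?h x)%N) =>
      apply: (@poly_boundedM f h); prove_poly_bounded
  | |- poly_bounded (fun x => (@?f x ^ ?n)%N) =>
      apply: (@poly_boundedX f n); prove_poly_bounded
  | |- poly_bounded (fun x => time_bound _ _) => exact: poly_bounded_time
  end.

Lemma poly_bounded_running_time P g a b : poly_bounded (running_time P g a b).
Proof.
rewrite /running_time /slowdown /fixed_time /max_events /query_size.
under eq_fun do rewrite -addn1.
prove_poly_bounded.
Qed.

Lemma online_algorithm_competitive (R : realType) (ND : nd_class R) P (C gamma : R) :
  1008 <= C -> 1 <= gamma -> randomized_pc_approx ND P gamma ->
  randomized_competitive ND (online_algorithm P (Num.truncn gamma).+1)
    (fun k m => C * gamma * log_min R k m).
Proof.
move=> C1008 gamma1 [a [b approx]]; set g := (Num.truncn gamma).+1.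
have gamma0 : 0 <= gamma by apply: le_trans gamma1.
have C0 : 0 < C by lra.
have /andP[tl tu] : (Num.truncn gamma)%:R <= gamma < g%:R by apply: truncn_itv.
have gg : g%:R <= 2 * gamma by rewrite /g -natr1; lra.
have g1 : 1 <= g%:R :> R by rewrite ler1n.
set A := online_algorithm P g.
have [a' [b' time_le]] := poly_bounded_running_time P g a b.
exists a', b' => i rs; set X := online_size rs.
have X0 : (0 < X)%N := online_size_gt0 rs.
pose Z := query_size X; pose tP : R := (a * Z ^ b)%:R; pose k := size rs.
have P_halts (Q : pc_input i) : penalties_ge0 Q -> halts_almost_surely R (pc_outcomes P Q).
  by move=> /(approx i Q)[].
have P_time (Q : pc_input i) : penalties_ge0 Q -> (data_size (pc_data Q) <= Z)%N ->
    (expectation_over (pc_outcomes P Q) (fun n => n%:R%:E) <= tP%:E)%E.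
  move=> /(approx i Q)[_ H _] sZ; apply: le_trans H _.
  by rewrite lee_fin ler_nat leq_mul //; case: (b) => // c; rewrite leq_exp2r.
have P_good (Q : pc_input i) w E n : penalties_ge0 Q -> pc_run P Q w E n ->
    pc_cost Q E <= g%:R * pc_opt Q.
  move=> Q0 r; have [_ _ H] := approx i Q Q0; apply: le_trans (H _ _ _ r) _.
  by apply: ler_wpM2r (ltW tu); apply: pc_cost_ge0.
have kX : (k <= X)%N by apply: size_online_size.
have mX : (nelem i <= X)%N by apply: nelem_online_size.
have Z_ok : (data_size (instance_data i) + k * (X + 3) + X + 10 <= Z)%N.
  by rewrite /Z /query_size !leq_add2r leq_add ?instance_online_size // leq_mul2r kX orbT.
have tP0 : 0 <= tP by apply: ler0n.
pose words := step_words P g [::] rs +oo%E DNil.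
pose time := steps_time P g [::] rs +oo%E DNil.
pose sched w : schedule i := xget [::] [set s | exists n, online_run A rs w s n]%classic.
have outcomeE w (x : schedule i * nat) : online_outcomes A rs (w, x) -> x = (sched w, time w).
  case: x => s n; rewrite /online_outcomes /= => r; rewrite /time (steps_timeE r).
  rewrite /sched; case: xgetP => [s' -> [n' r']|/(_ s)]; last by case; exists n.
  by have [-> _] := online_steps_unique r r'.
have outcomes : [set w | exists x, online_outcomes A rs (w, x)]%classic = words.
  rewrite eqEsubset; split => w /=; first by move=> [[s n] r]; exists s, n.
  by move=> [s [n r]]; exists (s, n).
have ratio0 : 0 < C * gamma * log_min R (size rs) (nelem i).
  by rewrite !mulr_gt0 // (lt_le_trans ltr01) // L_ge1.
suff [mass mean paid] : [/\ coin_sum words (fun=> 1%E) = 1%E :> \bar R,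
    (coin_sum words (fun w => (time w)%:R%:E) <= (running_time P g a b X)%:R%:E :> \bar R)%E &
    forall w s n, online_run A rs w s n -> (schedule_cost rs s <=
      (C * gamma * log_min R (size rs) (nelem i))%:E * offline_opt rs)%E].
  have halts : halts_almost_surely R (online_outcomes A rs).
    by rewrite /halts_almost_surely (expectation_coin_sum _ outcomeE) outcomes.
  split => //.
    rewrite (expectation_coin_sum _ outcomeE) outcomes; apply: le_trans mean _.
    by rewrite lee_fin ler_nat time_le.
  apply: (expectation_le halts) => [w [s n]|]; first exact: paid.
  apply: mule_ge0; first by rewrite lee_fin ltW.
  by apply/ereal_infP => _ [s _ <-]; apply: schedule_cost_ge0.
have bound0 : (schedule_cost [::] ([::] : schedule i) = 0)%E.
  by rewrite /schedule_cost !big_nil adde0.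
have := next_event_spec rs (isT : (+oo : \bar R)%E != -oo%E).
case start : (next_event rs +oo%E) => [u| |] //; last first.
  move=> [_ rs0]; have [wordsE timeE] := stopped P g [::] DNil start.
  split.
  - by rewrite /words wordsE /coin_sum esum_set1 ?expr0 ?mul1e.
  - by rewrite /words wordsE /coin_sum esum_set1 /time ?timeE ?mule0 ?lee_fin.
  - move=> w s n r; inversion r; subst; last by rewrite start in H.
    rewrite bound0 mule_ge0 ?lee_fin ?(ltW ratio0) //.
    by apply/ereal_infP => _ [s' _ <-]; apply: schedule_cost_ge0.
move=> _; have code_le q := @code_online_size _ _ i rs q.
have conf := conf_initial g code_le start.
have ev := events_initial g u kX.
have [mass mean] := steps_mean (isT : (0 < g)%N) P_halts P_time P_good kX mX Z_ok tP0 conf ev.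
split => //.
  apply: le_trans mean _; rewrite lee_fin /mean_event_time /running_time /tP.
  by rewrite -natrM -natrD -natrM ler_nat.
(* The optimum is an infimum that need not be attained, so the cost is compared with every offline
   schedule; one that leaves a request unserved costs [+oo]. *)
move=> w s n r; rewrite -lee_pdivrMl //; apply/ereal_infP => _ [offline _ <-].
rewrite lee_pdivrMl //.
have [/hasP[q qrs un]|/hasPn served] := boolP (has (fun q => ~~ offline_serves offline q) rs).
  by rewrite (schedule_cost_unserved qrs un) gt0_muley ?leey // lte_fin.
have {}served q : q \in rs -> offline_serves offline q by move=> /served /negPn.
have acc := accounts_initial u served.
have := steps_paid (isT : (0 < g)%N) P_good kX mX Z_ok tP0 conf ev acc r.
rewrite (perm_big _ (perm_initial rs u)) /=.
rewrite -[X in (X <= _)%E -> _]/(schedule_cost rs s) => paid; apply: le_trans paid _.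
rewrite (schedule_costE served) -EFinM lee_fin.
apply: le_trans (potential_initial g u served) _.
apply: ler_wpM2r.
  rewrite addr_ge0 //; first by apply: sumr_ge0 => S _; apply: set_cost_ge0.
  by apply: sumr_ge0_seq => q /served; apply: offline_delay_ge0.
apply: ler_wpM2r; first by rewrite (le_trans ler01) // L_ge1.
(* Since [1 <= g <= 2 * gamma], one has [72 * (3 * g + 4) <= 72 * 7 * g <= 1008 * gamma]. *)
have : 1008 * gamma <= C * gamma by apply: ler_wpM2r.
lra.
Qed.

Theorem theorem6p3 (R : realType) :
  exists2 C : R, 0 < C &
  forall (ND : nd_class R) (gamma : R), 1 <= gamma ->
  let ratio := fun k m : nat => C * gamma * log_min R k m in
  ((exists P, deterministic_pc_approx ND P gamma) ->
   exists A, deterministic_competitive ND A ratio) /\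
  ((exists P, randomized_pc_approx ND P gamma) ->
   exists A, randomized_competitive ND A ratio).
Proof.
exists 1008; first by rewrite ltr0n.
move=> ND gamma gamma1 ratio; split=> -[P approx].
  exists (online_algorithm P (Num.truncn gamma).+1).
  apply: randomized_competitive_deterministic.
    by case: approx => dP _; apply: deterministic_online_algorithm.
  by apply: (online_algorithm_competitive (lexx _)) => //; apply: deterministic_pc_randomized.
exists (online_algorithm P (Num.truncn gamma).+1).
exact: (online_algorithm_competitive (lexx _)).
Qed.
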